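(* Let $n\geqslant 0$ and $m\geqslant n$, $m\geqslant 1$. The image $f_m(\mathcal{P}^n)\subset\mathrm{Qsym}[t_1,\dots,t_m][\alpha]$ of the group $\mathcal{P}^n$ generated by all $n$-dimensional polytopes consists of all homogeneous polynomials $g=g(\alpha,t_1,\dots,t_m)\in\mathrm{Qsym}[t_1,\dots,t_m][\alpha]$ of degree $n$ satisfying the equations (1) $g(\alpha,t_1,\dots,t_{q-1},t_q,-t_q,t_{q+2},\dots,t_m)=g(\alpha,t_1,\dots,t_{q-1},0,0,t_{q+2},\dots,t_m)$ for every $q=1,\dots,m-1$; (2) $g(-\alpha,t_1,\dots,t_{m-1},\alpha)=g(\alpha,t_1,\dots,t_{m-1},0)$. Moreover, these equations are equivalent to the Bayer–Billera (generalized Dehn–Sommerville) relations; that is, a homogeneous polynomial of degree $n$ $$g=g_{\varnothing}\alpha^n+\sum_{k=1}^{n}\ \sum_{0\leqslant a_1<\dots<a_k\leqslant n-1}g_{\{a_1,\dots,a_k\}}\,\alpha^{a_1}M_{(n-a_k,\,a_k-a_{k-1},\dots,\,a_2-a_1)}$$ satisfies (1) and (2) if and only if for every $S\subset\{0,\dots,n-1\}$ and every $\{i,k\}\subseteq S\cup\{-1,n\}$ with $i<k-1$ and $S\cap\{i+1,\dots,k-1\}=\varnothing$ one has $$\sum_{j=i+1}^{k-1}(-1)^{j-i-1}g_{S\cup\{j\}}=(1-(-1)^{k-i-1})g_S .$$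
   Context: A combinatorial polytope is a combinatorial equivalence class of convex polytopes. The ring of polytopes $\mathcal{P}$ is, as an abelian group, free on all (non-empty) combinatorial polytopes, with multiplication the direct product and unit the point; $\mathcal{P}^n$ is the free abelian subgroup generated by $n$-dimensional polytopes. For a composition $\omega=(j_1,\dots,j_k)$ (ordered tuple of integers $j_i\ge1$), $M_\omega=\sum_{l_1<\dots<l_k}t_{l_1}^{j_1}\cdots t_{l_k}^{j_k}$ is the quasi-symmetric monomial; $\mathrm{Qsym}[t_1,\dots,t_m]$ is the ring of finite integer combinations of quasi-symmetric monomials in $t_1,\dots,t_m$ (including constants). Degree: $\deg\alpha=\deg t_i=1$. For $S=\{a_1<\dots<a_k\}\subset\{0,\dots,n-1\}$ the flag number $f_S=f_{a_1,\dots,a_k}(P^n)$ is the number of chains of faces $F^{a_1}\subset\dots\subset F^{a_k}$ of $P^n$ with $\dim F^{a_i}=a_i$ ($f_\varnothing=1$). The linear map $f_m:\mathcal{P}\to\mathrm{Qsym}[t_1,\dots,t_m][\alpha]$ is given on an $n$-dimensional polytope by $$f_m(\alpha,t_1,\dots,t_m)(P^n)=\alpha^n+\sum_{k=1}^{\min\{m,n\}}\ \sum_{0\leqslant a_1<\dots<a_k\leqslant n-1}f_{a_1,\dots,a_k}\,\alpha^{a_1}M_{(n-a_k,\,a_k-a_{k-1},\dots,\,a_2-a_1)},$$ where the composition attached to $\{a_1<\dots<a_k\}$ has $k$ parts: $n-a_k,\ a_k-a_{k-1},\ \dots,\ a_2-a_1$. Equivalently $f_m(P)=\xi_\alpha\Phi(t_m)\cdots\Phi(t_1)P$,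 where $\Phi(t)=\sum_k d_kt^k$, $d_k$ sends a polytope $P^n$ to the sum of its $(n-k)$-dimensional faces, and $\xi_\alpha(P^n)=\alpha^n$. *)

(* Defs.v *)
From HB Require Import structures.
From mathcomp Require Import all_boot all_order all_algebra finmap.
From mathcomp Require Import mpoly freeg.
From mathcomp Require Import boolp classical_sets functions cardinality reals.

Set Implicit Arguments.
Unset Strict Implicit.
Unset Printing Implicit Defensive.

Import Order.TTheory GRing.Theory Num.Theory.

Local Open Scope classical_set_scope.
Local Open Scope ring_scope.

Section Polytopes.
Variable R : realType.

Definition conv (d N : nat) (v : 'I_N -> 'rV[R]_d) : set 'rV[R]_d :=
  [set x | exists w : 'I_N -> R,
     [/\ forall i, 0 <= w i, \sum_(i < N) w i = 1
       & x = \sum_(i < N) w i *: v i]].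

Record polytope : Type := Polytope {
  ambient : nat;
  points : set 'rV[R]_ambient;
  polytopeP : exists (N : nat) (v : 'I_N.+1 -> 'rV[R]_ambient),
    points = conv v
}.

Arguments points : clear implicits.

HB.instance Definition _ := gen_eqMixin polytope.
HB.instance Definition _ := gen_choiceMixin polytope.

(* The rows of X are affinely independent iff the rows (x_i, 1) are linearly
   independent. *)
Definition affinely_independent (d k : nat) (X : 'M[R]_(k, d)) : bool :=
  row_free (row_mx X (const_mx 1 : 'cV[R]_k)).

(* Dimension of the affine hull: one less than the maximal number (at most
   d + 1) of affinely independent points; in particular -1 for set0. *)
Definition aff_dim (d : nat) (A : set 'rV[R]_d) : int :=
  (\max_(k < d.+2 | `[< exists X : 'M[R]_(k, d),
      affinely_independent X /\ forall i, A (row i X) >]) k)%N%:Z - 1.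

(* c = 0 gives the two improper faces: P itself (b = 0) and the empty face
   (b = 1). *)
Definition is_face (d : nat) (A F : set 'rV[R]_d) : Prop :=
  exists (c : 'cV[R]_d) (b : R),
    (forall x, A x -> (x *m c) 0 0 <= b) /\
    F = A `&` [set x | (x *m c) 0 0 = b].

Definition faces (P : polytope) : set (set 'rV[R]_(ambient P)) :=
  is_face (points P).
Arguments faces : clear implicits.

Definition comb_equivalent (P Q : polytope) : Prop :=
  exists phi : set 'rV[R]_(ambient P) -> set 'rV[R]_(ambient Q),
    set_bij (faces P) (faces Q) phi /\
    (forall F G, faces P F -> faces P G -> (F `<=` G <-> phi F `<=` phi G)).

Lemma comb_equivalent_refl P : comb_equivalent P P.
Proof. by exists id; split=> //; split=> // F; exists F. Qed.

Lemma comb_equivalent_sym P Q : comb_equivalent P Q -> comb_equivalent Q P.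
Proof.
case=> phi [[phiS phi_inj phi_surj] phi_mono].
have inv_ex G : exists F, faces Q G -> faces P F /\ phi F = G.
  have [QG|nQG] := pselect (faces Q G); last by exists set0 => /nQG.
  by have [F PF <-] := phi_surj G QG; exists F.
have [psi psiP] := choice inv_ex.
exists psi; split; last first.
  move=> F G QF QG; have [PF eF] := psiP F QF; have [PG eG] := psiP G QG.
  by rewrite -{1}eF -{1}eG; apply: iff_sym; apply: phi_mono.
split.
- by move=> G QG; have [] := psiP G QG.
- move=> F G; rewrite !inE => QF QG eFG.
  by have [_ <-] := psiP F QF; have [_ <-] := psiP G QG; rewrite eFG.
- move=> F PF; exists (phi F); first exact: phiS.
  have [PF' e] := psiP _ (phiS F PF).
  by apply: phi_inj => //; rewrite inE.
Qed.

Lemma comb_equivalent_trans Q P T :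
  comb_equivalent P Q -> comb_equivalent Q T -> comb_equivalent P T.
Proof.
case=> phi [[phiS phi_inj phi_surj] phi_mono].
case=> psi [[psiS psi_inj psi_surj] psi_mono].
exists (psi \o phi); split; last first.
  move=> F G PF PG /=; rewrite phi_mono //.
  by apply: psi_mono; exact: phiS.
split.
- by move=> F PF; apply: psiS; exact: phiS.
- move=> F G; rewrite !inE => PF PG /= e.
  by apply: phi_inj; rewrite ?inE//; apply: psi_inj; rewrite ?inE//; exact: phiS.
- move=> H TH; have [G QG <-] := psi_surj H TH.
  by have [F PF <-] := phi_surj G QG; exists F.
Qed.

Definition comb_equivb (P Q : polytope) : bool := `[< comb_equivalent P Q >].

Lemma comb_equivb_equiv : equiv_class_of comb_equivb.
Proof.
split=> [P|P Q|Q P T].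
- exact/asboolP/comb_equivalent_refl.
- by apply/asboolP/asboolP; apply: comb_equivalent_sym.
- by move=> /asboolP PQ /asboolP QT; apply/asboolP; exact: comb_equivalent_trans QT.
Qed.

Canonical comb_equivb_rel := EquivRelPack comb_equivb_equiv.

Definition comb_polytope : Type := {eq_quot comb_equivb_rel}%qT.
HB.instance Definition _ := Choice.on comb_polytope.
HB.instance Definition _ := Quotient.on comb_polytope.

(* The dimension of a (non-empty) polytope is a natural number. *)
Definition polytope_dim (P : polytope) : nat := `|aff_dim (points P)|%N.

(* Chains F_1 `<=` ... `<=` F_k of faces with prescribed dimensions
   s = [:: a_1; ...; a_k]; since a_i >= 0, the empty face never occurs.  The
   set of faces is finite, so fset_set takes no junk value. *)
Definition flag_chains (P : polytope) (s : seq nat) :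
    set (seq (set 'rV[R]_(ambient P))) :=
  [set c | [/\ (forall F, F \in c -> faces P F),
               [seq aff_dim F | F <- c] = [seq a%:Z | a <- s]
             & sorted (fun F G => `[< F `<=` G >]) c]].
Arguments flag_chains : clear implicits.

Definition flag_number (P : polytope) (s : seq nat) : nat :=
  #|` fset_set (flag_chains P s)|.

Definition polytope_group : Type := {freeg comb_polytope / int}.

(* The dimension is a combinatorial invariant, so any representative will do. *)
Definition homogeneous_polytopes (n : nat) : set polytope_group :=
  [set x | forall p : comb_polytope, p \in dom x -> polytope_dim (repr p) = n].

End Polytopes.

Arguments points {R} P _ : rename.
Arguments faces {R} P _.
Arguments flag_chains {R} P s _.
Arguments homogeneous_polytopes : clear implicits.

(* int[t_1, ..., t_m][alpha] is {poly {mpoly int[m]}}, with alpha = 'X; the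
   variables t are indexed from 0. *)
Definition tvar (m : nat) (l : 'I_m) : {poly {mpoly int[m]}} := ('X_l)%:P.

Definition qsym_monomial (m : nat) (w : seq nat) : {mpoly int[m]} :=
  \sum_(l : (size w).-tuple 'I_m | sorted ltn [seq val i | i <- l])
    \prod_(i < size w) 'X_(tnth l i) ^+ nth 0%N w i.

Definition is_composition (w : seq nat) : bool := all (fun j => (0 < j)%N) w.

Definition Qsym (m : nat) : set {mpoly int[m]} :=
  [set p | exists s : seq (int * seq nat),
     all (fun cw => is_composition cw.2) s /\
     p = \sum_(cw <- s) cw.1 *: qsym_monomial m cw.2].

Definition Qsym_alpha (m : nat) : set {poly {mpoly int[m]}} :=
  [set g | forall i : nat, @Qsym m g`_i].

(* All monomials of g have total degree n in alpha, t_1, ..., t_m; in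
   particular g = 0 is allowed. *)
Definition homogeneous_of_degree (m n : nat) (g : {poly {mpoly int[m]}}) :
    Prop :=
  forall (i : nat) (mon : 'X_{1..m}), (g`_i)@_mon != 0 -> (i + mdeg mon = n)%N.

(* The substitution g(a, t_1, ..., t_m). *)
Definition subst (m : nat) (a : {poly {mpoly int[m]}})
    (t : 'I_m -> {poly {mpoly int[m]}}) (g : {poly {mpoly int[m]}}) :
    {poly {mpoly int[m]}} :=
  (map_poly (mmap (fun c : int => c%:~R) t) g).[a].

Definition sign_equations (m : nat) (g : {poly {mpoly int[m]}}) : Prop :=
  forall q q' : 'I_m, val q' = q.+1 ->
    subst 'X (fun l => if l == q' then - tvar q else tvar l) g =
    subst 'X (fun l => if (l == q) || (l == q') then 0 else tvar l) g.

Definition euler_equation (m : nat) (g : {poly {mpoly int[m]}}) : Prop :=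
  subst (- 'X) (fun l => if l.+1 == m then 'X else tvar l) g =
  subst 'X (fun l => if l.+1 == m then 0 else tvar l) g.

(* For s = [:: a_1; ...; a_k] increasing, the composition
   (n - a_k, a_k - a_(k-1), ..., a_2 - a_1). *)
Definition flag_composition (n : nat) (s : seq nat) : seq nat :=
  if s is a :: s' then rev (pairmap (fun x y => (y - x)%N) a (rcons s' n))
  else [::].

(* The elements of S in increasing order, as natural numbers. *)
Definition elements (n : nat) (S : {set 'I_n}) : seq nat :=
  [seq val a | a <- enum S].

Definition flag_polynomial (m n : nat) (g : {set 'I_n} -> int) :
    {poly {mpoly int[m]}} :=
  'X^n *~ g (finset.set0) +
  \sum_(1 <= k < (minn m n).+1) \sum_(S : {set 'I_n} | #|S| == k)
    ((qsym_monomial m (flag_composition n (elements S)))%:P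
       * 'X^(head 0%N (elements S))) *~ g S.

(* The empty chain is counted once, so that the coefficient of alpha^n is 1. *)
Definition f_polytope (R : realType) (m : nat) (P : polytope R) :
    {poly {mpoly int[m]}} :=
  @flag_polynomial m (polytope_dim P)
    (fun S => (flag_number P (elements S))%:Z).

(* Linear extension to the free abelian group; flag numbers are combinatorial
   invariants, so any representative will do. *)
Definition f_map (R : realType) (m : nat) (x : polytope_group R) :
    {poly {mpoly int[m]}} :=
  \sum_(p <- dom x) f_polytope m (repr p) *~ coeff p x.

Definition in_extended (n : nat) (S : {set 'I_n}) (e : int) : Prop :=
  [\/ e = -1, e = n%:Z | exists2 a : 'I_n, a \in S & e = (val a)%:Z].

Definition bayer_billera (n : nat) (g : {set 'I_n} -> int) : Prop :=
  forall (S : {set 'I_n}) (i k : int),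
    in_extended S i -> in_extended S k -> i < k - 1 ->
    (forall a : 'I_n, a \in S -> ~~ (i < (val a)%:Z < k)) ->
    \sum_(j < n | i < (val j)%:Z < k)
      (-1) ^+ absz ((val j)%:Z - i - 1)%R * g (j |: S)%SET =
    (1 - (-1) ^+ absz (k - i - 1)%R) * g S.

Lemma flag_number_nil (R : realType) (P : polytope R) : flag_number P [::] = 1%N.
Proof.
rewrite /flag_number (_ : flag_chains P [::] = [set [::]]) ?fset_set1 ?cardfs1//.
by apply/seteqP; split=> [[|F c] [_]|_ ->].
Qed.

(* Main.v *)
(** Faces of a polytope are encoded by the sets of vertices at which a
    supporting affine functional attains its bound.  Cutting the cells of the
    dual hyperplane arrangement one hyperplane at a time proves Euler's
    relation for every interval of the face lattice, hence the
    Bayer-Billera relations for flag numbers.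

    Conversely, let C and I be the pyramid and the prism, acting on flag
    functions, and put E = 2C - I and D = I - C.  Then (E h)(S) is h(S - 1),
    doubled when S contains 0.  If g satisfies the relations in dimension n,
    then h'(S) = g({0} + (S + 2)) - 2 g(S + 2) satisfies them in dimension
    n - 2, and g - D E h' is of the form E h, where h satisfies them in
    dimension n - 1.  By induction every integral solution is an integral
    combination of flag functions of polytopes.

    The coefficient of alpha^b t^mu in the polynomial of g is the value of g
    at the set of the numbers n - (mu_1 + ... + mu_r); reading off
    coefficients, equation (1) becomes the relation at two consecutive
    elements i < k of S or n, and equation (2) the one at i = -1. *)

Require Import Defs.
From HB Require Import structures.
From mathcomp Require Import all_boot all_order all_algebra.
From mathcomp Require Import lra zify mpoly boolp.

Set Implicit Arguments.
Unset Strict Implicit.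
Unset Printing Implicit Defensive.

Import Order.TTheory GRing.Theory Num.Theory.
Local Open Scope ring_scope.

(** * Integral solutions of the Bayer-Billera relations *)

(** A solution of the relations has the form [E h] as soon as adjoining 0 doubles its value. The
    relation on an edge ([lo = 0], [k = 1]) gives this for sets containing 1, so the only
    obstruction sits at sets containing 0 but not 1, and h' is exactly that defect. D is chosen
    because the defect of D E h' is h' with coefficient one: nothing has to be divided, and the
    integral span is reached, not only the rational one. E is no construction on polytopes: it
    describes two vertices, both placed below a copy of the face poset raised by one dimension, and
    only the combination of pyramid and prism realizes it.

    The relations use Euler's formula on all intervals of the face lattice, not only below a face.
    Working with functionals on the generating points treats faces of a face and faces above a face
    alike, so no quotient polytope is ever built. The generating points may repeat and need not be
    vertices; a face is recorded by all the indices lying on it. *)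

Definition adjoin (p : pred nat) (j : nat) : pred nat :=
  fun i => (i == j) || p i.

Definition determined_below (n : nat) (G : pred nat -> int) : Prop :=
  forall p q, (forall i, (i < n)%N -> p i = q i) -> G p = G q.

(* A subset S of {0, ..., n-1} is represented by a predicate, and the index i
   of the relations by lo = i + 1, so that i = -1 becomes lo = 0. *)
Definition dehn_sommerville (n : nat) (G : pred nat -> int) : Prop :=
  forall (p : pred nat) (lo k : nat), (lo <= k <= n)%N ->
    (lo == 0%N) || p lo.-1 -> (k == n) || p k ->
    (forall x, (lo <= x < k)%N -> ~~ p x) ->
  \sum_(lo <= j < k) (-1) ^+ (j - lo) * G (adjoin p j) =
  (1 - (-1) ^+ (k - lo)) * G p.

Definition pcons (b : bool) (p : pred nat) : pred nat :=
  fun i => if i is j.+1 then p j else b.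

(* The chains of dimensions p in a pyramid or prism whose last face not of the
   form "pyramid (prism) over a face" has dimension a correspond to the chains
   of dimensions [pmerge a p] in the base. *)
Definition pmerge (a : nat) (p : pred nat) : pred nat :=
  fun i => (i <= a)%N && p i || (a <= i)%N && p i.+1.

(** The first term counts the chains made of pyramids only. The apex is the pyramid over the empty
    face, so there the membership of 0 puts no condition on the base. *)
Definition cone_op (n : nat) (h : pred nat -> int) (p : pred nat) : int :=
  h (p \o succn) + \sum_(a < n.+1) (p a)%:R * h (pmerge a p).

(** The 2 chooses between the bottom and the top copy of the last face that is not a prism. A chain
    of prisms only offers no such choice and contains no vertex, whence the factor [~~ p 0]. *)
Definition prism_op (n : nat) (h : pred nat -> int) (p : pred nat) : int :=
  (~~ p 0%N)%:R * h (p \o succn) + 2 * \sum_(a < n.+1) (p a)%:R * h (pmerge a p).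

Section Generation.

(** [Sp n] stands for the integral span of the flag functions of n-dimensional polytopes. Only
    formal properties of it enter, so the induction is free of geometry. *)
Variable Sp : nat -> (pred nat -> int) -> Prop.
Hypothesis Sp_ext : forall n G H, (forall p, G p = H p) -> Sp n G -> Sp n H.
Hypothesis Sp_lin : forall n (c : int) G H, Sp n G -> Sp n H ->
  Sp n (fun p => c * G p + H p).
Hypothesis Sp_cone : forall n h, Sp n h -> Sp n.+1 (cone_op n h).
Hypothesis Sp_prism : forall n h, Sp n h -> Sp n.+1 (prism_op n h).
Hypothesis Sp_point : Sp 0 (fun=> 1).
Hypothesis Sp_local : forall n G, Sp n G -> determined_below n G.
Hypothesis Sp_ds : forall n G, Sp n G -> dehn_sommerville n G.

Let E (h : pred nat -> int) (p : pred nat) : int :=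
  (1 + (p 0%N)%:R) * h (p \o succn).

Let D (n : nat) (h : pred nat -> int) (p : pred nat) : int :=
  \sum_(a < n.+1) (p a)%:R * h (pmerge a p) - (p 0%N)%:R * h (p \o succn).

Lemma Sp_E n h : Sp n h -> Sp n.+1 (E h).
Proof.
move=> Sh; have C := Sp_cone Sh; have P := Sp_prism Sh.
apply: (Sp_ext _ (Sp_lin (-1) P (Sp_lin 1 C C))) => p.
rewrite /E /cone_op /prism_op; case: (p 0%N) => /=; lra.
Qed.

Lemma Sp_D n h : Sp n h -> Sp n.+1 (D n h).
Proof.
move=> Sh; have C := Sp_cone Sh; have P := Sp_prism Sh.
apply: (Sp_ext _ (Sp_lin (-1) C P)) => p.
rewrite /D /cone_op /prism_op; case: (p 0%N) => /=; lra.
Qed.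

Lemma ds_lin n c G H : dehn_sommerville n G -> dehn_sommerville n H ->
  dehn_sommerville n (fun p => c * G p + H p).
Proof.
move=> dG dH p lo k lk hlo hk hp.
have /= eG := dG p lo k lk hlo hk hp; have /= eH := dH p lo k lk hlo hk hp.
under eq_bigr do rewrite mulrDr mulrCA.
rewrite big_split -mulr_sumr /= eG eH; lra.
Qed.

Lemma local_lin n c G H : determined_below n G -> determined_below n H ->
  determined_below n (fun p => c * G p + H p).
Proof. by move=> lG lH p q pq; rewrite (lG _ _ pq) (lH _ _ pq). Qed.

Lemma local_pcons n b G : determined_below n.+1 G ->
  determined_below n (fun p => G (pcons b p)).
Proof. by move=> lG p q pq; apply: lG => -[|i] //= /pq. Qed.

(* An edge has exactly two vertices. *)
Lemma ds_edge n G p : determined_below n.+1 G -> dehn_sommerville n.+1 G ->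
  ~~ p 0%N -> (n == 0%N) || p 1%N -> G (adjoin p 0) = 2 * G p.
Proof.
move=> lG dG p0 p1.
have := dG p 0%N 1%N isT isT.
rewrite big_nat1 subnn expr0 mul1r subn0 expr1 opprK => -> //; first by rewrite eqSS eq_sym.
by case.
Qed.

(** Lowering all indices by one turns an interval starting at 1 into one starting at 0. The former
    is legitimate only if 0 belongs to the set, which is what [(0 < lo) || b] ensures. *)
Lemma ds_shift n G b :
  determined_below n.+1 G -> dehn_sommerville n.+1 G ->
  forall (p : pred nat) (lo k : nat), (0 < lo)%N || b -> (lo <= k <= n)%N ->
    (lo == 0%N) || p lo.-1 -> (k == n) || p k ->
    (forall x, (lo <= x < k)%N -> ~~ p x) ->
  \sum_(lo <= j < k) (-1) ^+ (j - lo) * G (pcons b (adjoin p j)) =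
  (1 - (-1) ^+ (k - lo)) * G (pcons b p).
Proof.
move=> lG dG p lo k lob lk hlo hk hp.
have := dG (pcons b p) lo.+1 k.+1; rewrite big_add1 /= !ltnS subSS => <- //.
- apply: eq_bigr => j _; rewrite subSS; congr (_ * _).
  by apply: lG => -[].
- by case: lo lob hlo {lk hp} => [|lo] /=.
- by case=> // x /hp.
Qed.

(** Only intervals from the bottom are new. There the relation for [G] has one more term, j = 0,
    equal to twice the value of [G]; moving it to the right turns 1 + (-1)^k into 1 - (-1)^k. *)
Lemma ds_suspension n G : determined_below n.+1 G -> dehn_sommerville n.+1 G ->
  (forall p, G p = E (fun q => G (pcons false q)) p) ->
  dehn_sommerville n (fun q => G (pcons false q)).
Proof.
move=> lG dG GE p [|lo] k lk hlo hk hp; last first.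
  exact: (ds_shift lG dG).
have hk' : (k.+1 == n.+1) || pcons false p k.+1 by [].
have hp' x : (0 <= x < k.+1)%N -> ~~ pcons false p x by case: x => [|x] //; exact: (hp x).
have := dG (pcons false p) 0%N k.+1 lk isT hk' hp'.
rewrite big_nat_recl //=.
have -> : G (adjoin (pcons false p) 0%N) = 2 * G (pcons false p).
  by rewrite GE /E /=; congr (_ * _); apply: lG => -[].
rewrite subnn expr0 subn0 mul1r.
under eq_bigr => j _ do rewrite subn0 exprS mulN1r mulNr.
rewrite sumrN exprS => H.
under eq_bigr => j _ do rewrite subn0.
have eS : \sum_(0 <= i < k) (-1) ^+ i * G (adjoin (pcons false p) i.+1) =
  \sum_(0 <= i < k) (-1) ^+ i * G (pcons false (adjoin p i)).
  by apply: eq_bigr => j _; congr (_ * _); apply: lG => -[].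
rewrite eS in H; rewrite subn0; lra.
Qed.

(** For an interval from the bottom, take the relation of [G] above 0 for {0} + (S + 2) and the one
    from -1 for S + 2. Both involve [G] at {1} + (S + 2), in the first one doubled by [ds_edge];
    eliminating it leaves the claim. *)
Lemma ds_double n G : determined_below n.+2 G -> dehn_sommerville n.+2 G ->
  dehn_sommerville n (fun p => - 2 * G (pcons false (pcons false p)) +
    G (pcons true (pcons false p))).
Proof.
move=> lG dG p [|lo] k lk hlo hk hp; last first.
  have H b := dG (pcons b (pcons false p)) lo.+3 k.+2.
  have {}H b : \sum_(lo.+1 <= j < k) (-1) ^+ (j - lo.+1) *
        G (pcons b (pcons false (adjoin p j))) =
      (1 - (-1) ^+ (k - lo.+1)) * G (pcons b (pcons false p)).
    have := H b; rewrite 2!big_add1 /= !ltnS 2!subSS => <- //.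
      apply: eq_bigr => j _; rewrite 2!subSS; congr (_ * _).
      by apply: lG => -[|[]].
    by case=> [|[|x]] //; exact: (hp x).
  under eq_bigr do rewrite mulrDr mulrCA.
  rewrite big_split -mulr_sumr /= !H; lra.
have H1 := dG (pcons true (pcons false p)) 1%N k.+2 _ isT.
have H0 := dG (pcons false (pcons false p)) 0%N k.+2 _ isT.
have hk' : (k.+2 == n.+2) || p k by [].
have hp' b x : (b <= x < k.+2)%N -> ~~ pcons (b == 1%N) (pcons false p) x.
  by case: b x => [|b] [|[|x]] //=; [exact: (hp x)|move=> /andP[_ xk]; exact: (hp x)].
move: H1 H0 => /(_ lk hk' (hp' 1%N)) H1 /(_ lk hk' (hp' 0%N)) H0.
have P1 q : q 0%N = false -> q 1%N -> G (adjoin q 0%N) = 2 * G q.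
  by move=> q0 q1; apply: (@ds_edge n.+1) => //; rewrite q0.
move: H1 H0; rewrite !big_add1 /= !big_nat_recl //=.
under eq_bigr => j _ do rewrite subSS subn0 exprS mulN1r mulNr.
under [in X in _ -> X -> _]eq_bigr => j _ do
  rewrite subn0 !exprS !mulN1r opprK.
rewrite !sumrN subn1 /= subnn !expr0 subn0 !exprS !mulN1r !mul1r opprK.
rewrite subn0; set s := (-1) ^+ k; set A := G (pcons true (pcons false p)).
set B := G (pcons false (pcons false p)).
have -> : G (adjoin (pcons false (pcons false p)) 0%N) = A.
  by apply: lG => -[].
have -> : G (adjoin (pcons true (pcons false p)) 1%N) =
    2 * G (adjoin (pcons false (pcons false p)) 1%N).
  by rewrite -P1 //; apply: lG => -[|[]].
have eq2 b j : G (adjoin (pcons b (pcons false p)) j.+2) =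
    G (pcons b (pcons false (adjoin p j))) by apply: lG => -[|[]].
under eq_bigr => j _ do rewrite eq2.
under [in X in _ -> X -> _]eq_bigr => j _ do rewrite eq2.
move=> H1 H0.
under eq_bigr do rewrite subn0 mulrDr mulrCA.
rewrite big_split -mulr_sumr /=.
lra.
Qed.

(** In [D], the terms with a >= 2 are doubled by adjoining 0, the term a = 1 is absent, and the term
    a = 0 exceeds the subtracted one by 2 [h r] - [h r]. So the failure of doubling is [h r]
    itself. *)
Lemma merge_E n h r : determined_below n h ->
  D n.+1 (E h) (pcons true (pcons false r)) =
  2 * D n.+1 (E h) (pcons false (pcons false r)) + h r.
Proof.
move=> lh; rewrite /D !big_ord_recl /= /bump /= !mul0r !mul1r !add0r !subr0.
have -> : E h (pmerge 0%N (pcons true (pcons false r))) = 2 * h r.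
  by rewrite /E /=; congr (_ * _); apply: lh => -[].
have -> : E h (pcons true (pcons false r) \o succn) = h r.
  by rewrite /E /= mul1r; apply: lh.
under eq_bigr => i _.
  have -> : E h (pmerge i.+2 (pcons true (pcons false r))) =
    2 * E h (pmerge i.+2 (pcons false (pcons false r))).
    by rewrite /E /= mul1r; congr (_ * _); apply: lh.
  rewrite mulrCA; over.
rewrite -mulr_sumr; lra.
Qed.

Theorem ds_generated n G :
  determined_below n G -> dehn_sommerville n G -> Sp n G.
Proof.
elim/ltn_ind: n G => -[|[|n]] IH G lG dG.
- apply: (Sp_ext _ (Sp_lin (G pred0 - 1) Sp_point Sp_point)) => p.
  by rewrite mulr1 subrK; apply: lG.
- have lh := local_pcons false lG.
  (* In dimension 1 the upper end of the edge relation is n itself, so doubling holds without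
     correction. *)
  have GE p : G p = E (fun q => G (pcons false q)) p.
    rewrite /E /=; have [p0|p0] := boolP (p 0%N); last first.
      by rewrite mul1r; apply: lG => -[|[]] //= _; exact/negbTE.
    rewrite -(@ds_edge 0) //; apply: lG => -[|[]] //=.
  apply: (Sp_ext _ (Sp_E (IH 0%N isT _ lh (ds_suspension lG dG GE)))) => p.
  by rewrite -GE.
set h' := fun p => - 2 * G (pcons false (pcons false p)) +
    G (pcons true (pcons false p)).
have lh' : determined_below n h'.
  by move=> p q pq; rewrite /h'; congr (_ * _ + _); apply: lG => -[|[]].
have Sh' : Sp n h' by apply: IH => //; exact: ds_double.
have SD := Sp_D (Sp_E Sh').
set G' := fun p => -1 * D n.+1 (E h') p + G p.
have lG' : determined_below n.+2 G' by apply: local_lin => //; exact: Sp_local SD.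
have dG' : dehn_sommerville n.+2 G' by apply: ds_lin => //; exact: Sp_ds SD.
have G'E p : G' p = E (fun q => G' (pcons false q)) p.
  rewrite /E /=; have [p0|p0] := boolP (p 0%N); last first.
    by rewrite mul1r; apply: lG' => -[|[]] //= _; exact/negbTE.
  (* If 1 belongs to p, doubling is the edge relation; otherwise it is [merge_E], whose defect
     cancels the one of [G]. *)
  have [p1|p1] := boolP (p 1%N).
    by rewrite -(@ds_edge n.+1) //; apply: lG' => -[|[]] //=.
  have -> : G' p = G' (pcons true (pcons false (p \o succn \o succn))).
    by apply: lG' => -[|[|]] //= _; exact/negbTE.
  have -> : G' (pcons false (p \o succn)) =
      G' (pcons false (pcons false (p \o succn \o succn))).
    by apply: lG' => -[|[|]] //= _; exact/negbTE.
  by rewrite /G' merge_E // /h' [nat_of_bool _]/=; lra.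
have Sh : Sp n.+1 (fun q => G' (pcons false q)).
  by apply: IH => //; [exact: local_pcons|exact: ds_suspension].
apply: (Sp_ext _ (Sp_lin 1 SD (Sp_E Sh))) => p.
by rewrite -G'E /G'; lra.
Qed.

End Generation.

(** * Euler's relation for vector configurations *)

Section Configuration.

Variables (F : realFieldType) (N D : nat) (V : 'M[F]_(N, D)).
Implicit Types (l : 'cV[F]_D) (Z P A : {set 'I_N}).

Definition ev l (i : 'I_N) : F := (V *m l) i 0.

Lemma evD l l' i : ev (l + l') i = ev l i + ev l' i.
Proof. by rewrite /ev mulmxDr mxE. Qed.

Lemma evZ a l i : ev (a *: l) i = a * ev l i.
Proof. by rewrite /ev -scalemxAr mxE. Qed.

Lemma ev_row l i : ev l i = (row i V *m l) 0 0.
Proof. by rewrite -row_mul mxE. Qed.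

Definition span_of Z : 'M[F]_D := (\sum_(i in Z) <<row i V>>)%MS.

(** Codimension of the space of functionals vanishing on [Z], hence of every nonempty open cell cut
    out of that space. *)
Definition rk Z : nat := \rank (span_of Z).

Lemma ev_span Z l : reflect (forall i, i \in Z -> ev l i = 0)
  (span_of Z *m l == 0).
Proof.
apply: (iffP eqP) => [|h].
  move=> /sub_kermxP /sumsmx_subP h i /h.
  by rewrite genmxE => /sub_kermxP; rewrite ev_row => ->; rewrite mxE.
apply/sub_kermxP/sumsmx_subP => i /h; rewrite genmxE ev_row => h0.
by apply/sub_kermxP/matrixP => a b; rewrite !ord1 h0 mxE.
Qed.

Lemma rk0 : rk set0 = 0%N.
Proof. by rewrite /rk /span_of big_set0 mxrank0. Qed.

Lemma span_ofU1 v Z : v \notin Z -> span_of (v |: Z) = (<<row v V>> + span_of Z)%MS.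
Proof. by move=> vZ; rewrite /span_of big_setU1. Qed.

Lemma rk_dep v Z : (row v V <= span_of Z)%MS -> rk (v |: Z) = rk Z.
Proof.
have [vZ _|vZ h] := boolP (v \in Z); first by rewrite (setUidPr _) ?sub1set.
by rewrite /rk span_ofU1 // (addsmx_idPr _) ?genmxE.
Qed.

Lemma dep_ev v Z l : (row v V <= span_of Z)%MS ->
  (forall i, i \in Z -> ev l i = 0) -> ev l v = 0.
Proof.
move=> /submxP[B e] /ev_span/eqP h.
by rewrite ev_row e -mulmxA h mulmx0 mxE.
Qed.

(** The columns of [cokermx] are functionals killing the span, and some column is nonzero on a row
    outside it; rescaling makes the value 1. *)
Lemma indep_ev v Z : ~~ (row v V <= span_of Z)%MS ->
  exists2 l, (forall i, i \in Z -> ev l i = 0) & ev l v = 1.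
Proof.
rewrite submxE => /rV0Pn[j].
set l := col j (cokermx (span_of Z)).
have -> : (row v V *m cokermx (span_of Z)) 0 j = ev l v.
  by rewrite ev_row /l [in RHS]colE [in RHS]mulmxA -[in RHS]colE [RHS]mxE.
move=> nz; exists ((ev l v)^-1 *: l); last by rewrite evZ mulVf.
move=> i iZ; rewrite evZ (_ : ev l i = 0) ?mulr0 //; move: i iZ.
by apply/ev_span; rewrite /l colE mulmxA mulmx_coker mul0mx.
Qed.

Lemma rk_indep v Z : ~~ (row v V <= span_of Z)%MS -> rk (v |: Z) = (rk Z).+1.
Proof.
move=> h; have vZ : v \notin Z.
  by apply: contra h => vZ; rewrite -(genmxE (row v V)) (sumsmx_sup v).
apply/eqP; rewrite /rk span_ofU1 // eqn_leq; apply/andP; split.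
  apply: leq_trans (leq_of_leqif (mxrank_adds_leqif _ _)) _.
  by rewrite mxrank_gen addnC -[X in (_ <= X)%N]addn1 leq_add2l rank_leq_row.
apply: rank_ltmx; rewrite ltmxE addsmxSr /=.
by apply: contra h; rewrite addsmx_sub genmxE => /andP[].
Qed.

Lemma rkS Z Z' : Z \subset Z' -> (rk Z <= rk Z')%N.
Proof.
move=> ZZ'; apply/mxrankS/sumsmx_subP => i iZ.
by rewrite (sumsmx_sup i) // (subsetP ZZ').
Qed.

Lemma perturb l u : exists2 eps, 0 < eps &
  forall i, ev l i != 0 -> eps * `|ev u i| < `|ev l i|.
Proof.
(* The sum of the ratios bounds each of them, and the added 1 makes the bound strict and positive.
   Indices with [ev l i = 0] contribute x / 0 = 0. *)
set S := \sum_i `|ev u i| / `|ev l i|.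
have S0 : 0 <= S by apply: sumr_ge0 => i _; rewrite divr_ge0.
have S1 : 0 < 1 + S by rewrite ltr_pwDl.
exists (1 + S)^-1 => [|i li]; first by rewrite invr_gt0.
have li0 : 0 < `|ev l i| by rewrite normr_gt0.
rewrite ltr_pdivrMl // mulrDl mul1r ltr_pwDl // mulrC -ler_pdivrMl // mulrC.
by rewrite /S (bigD1 i) //= lerDl sumr_ge0 // => j _; rewrite divr_ge0.
Qed.

Lemma perturb_sign l u : exists2 eps, 0 < eps &
  forall i, (0 < ev l i -> 0 < ev (l + eps *: u) i) /\
            (ev l i < 0 -> ev (l + eps *: u) i < 0).
Proof.
have [eps eps0 h] := perturb l u; exists eps => // i; rewrite evD evZ.
split=> s; have := h i; rewrite ?(lt_eqF s) ?(gt_eqF s) => /(_ isT);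
  rewrite ?(gtr0_norm s) ?(ltr0_norm s) => {}h; have := ler_norm (ev u i);
  have := ler_norm (- ev u i); rewrite normrN; nra.
Qed.

Definition realizable Z P A : bool :=
  `[< exists l, [/\ forall i, i \in Z -> ev l i = 0,
                    forall i, i \in P -> 0 < ev l i
                  & forall i, i \in A -> ev l i < 0] >].

(** Up to the global factor (-1)^D this is (-1)^dim of the open cell; an empty cell contributes
    0. *)
Definition cell_sign Z P A : int := (-1) ^+ rk Z * (realizable Z P A)%:R.

(* An open cell of dimension d cut by a hyperplane is either untouched or
   splits into two cells of dimension d and one of dimension d - 1. *)
Lemma cell_sign_cut v Z P A : cell_sign Z P A =
  cell_sign (v |: Z) P A + cell_sign Z (v |: P) A + cell_sign Z P (v |: A).
Proof.
rewrite /cell_sign; have [dep|indep] := boolP (row v V <= span_of Z)%MS.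
  rewrite (rk_dep dep) (_ : realizable (v |: Z) P A = realizable Z P A); last first.
    apply/asboolP/asboolP => -[l [lZ lP lA]]; exists l; split=> // i.
      by move=> iZ; apply: lZ; rewrite inE iZ orbT.
    by move=> /setU1P[->|/lZ //]; exact: dep_ev dep lZ.
  rewrite (_ : realizable Z (v |: P) A = false).
    rewrite (_ : realizable Z P (v |: A) = false); first by rewrite !mulr0 !addr0.
    apply/asboolP => -[l [lZ lP lA]].
    by have := lA v (setU11 _ _); rewrite (dep_ev dep lZ) ltxx.
  apply/asboolP => -[l [lZ lP lA]].
  by have := lP v (setU11 _ _); rewrite (dep_ev dep lZ) ltxx.
rewrite (rk_indep indep) exprS.
have [u uZ uv] := indep_ev indep.
(* A point on the wall [v] is pushed along [s *: u] to the side of sign s. The direction vanishes on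
   [Z], and a small step keeps all strict inequalities. *)
have splitP s : realizable (v |: Z) P A ->
    exists2 l, [/\ forall i, i \in Z -> ev l i = 0,
                    forall i, i \in P -> 0 < ev l i
                  & forall i, i \in A -> ev l i < 0]
    & exists2 eps, 0 < eps & ev l v = s * eps.
  move=> /asboolP[l [lZ lP lA]]; have [eps eps0 h] := perturb_sign l (s *: u).
  exists (l + eps *: (s *: u)); last first.
    by exists eps => //; rewrite evD !evZ uv lZ ?setU11 // add0r mulr1 mulrC.
  split=> i; first by move=> iZ; rewrite evD !evZ uZ // lZ ?setU1r // !mulr0 addr0.
    by move=> /lP /(proj1 (h i)).
  by move=> /lA /(proj2 (h i)).
have zp : realizable (v |: Z) P A -> realizable Z (v |: P) A.
  move=> /(splitP 1)[l [lZ lP lA] [eps eps0 lv]].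
  apply/asboolP; exists l; split=> // i /setU1P[->|/lP //].
  by rewrite lv mul1r.
have zn : realizable (v |: Z) P A -> realizable Z P (v |: A).
  move=> /(splitP (-1))[l [lZ lP lA] [eps eps0 lv]].
  apply/asboolP; exists l; split=> // i /setU1P[->|/lA //].
  by rewrite lv mulN1r oppr_lt0.
have pnz : realizable Z (v |: P) A -> realizable Z P (v |: A) ->
    realizable (v |: Z) P A.
  move=> /asboolP[l [lZ lP lA]] /asboolP[k [kZ kP kA]].
  have lv := lP v (setU11 _ _); have kv := kA v (setU11 _ _).
  (* Both coefficients are positive: this is the point where the segment between the two cells meets
     the wall [v], up to scaling. *)
  apply/asboolP; exists (- ev k v *: l + ev l v *: k); split=> i.
  - move=> /setU1P[->|iZ]; first by rewrite evD !evZ; lra.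
    by rewrite evD !evZ (lZ i) // (kZ i) // !mulr0 addr0.
  - move=> iP; have := lP i (setU1r _ iP); have := kP i iP.
    by rewrite evD !evZ; nra.
  - move=> iA; have := lA i iA; have := kA i (setU1r _ iA).
    by rewrite evD !evZ; nra.
have all : realizable Z P A = [|| realizable (v |: Z) P A,
    realizable Z (v |: P) A | realizable Z P (v |: A)].
  apply/idP/idP; last first.
    move=> /or3P[] /asboolP[l [lZ lP lA]]; apply/asboolP; exists l; split=> // i iX;
    by [apply: lZ; apply: setU1r|apply: lP; apply: setU1r|apply: lA; apply: setU1r].
  move=> /asboolP[l [lZ lP lA]]; have [lv|lv|lv] := ltgtP (ev l v) 0.
  - apply/or3P/Or33/asboolP; exists l; split=> // i /setU1P[->//|]; exact: lA.
  - apply/or3P/Or32/asboolP; exists l; split=> // i /setU1P[->//|]; exact: lP.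
  - apply/or3P/Or31/asboolP; exists l; split=> // i /setU1P[->//|]; exact: lZ.
move: zp zn pnz all; case: (realizable (v |: Z) P A).
  by move=> /(_ isT) -> /(_ isT) -> _ ->; rewrite !mulr1 mulN1r addNr add0r.
move=> _ _; case: (realizable Z (v |: P) A); case: (realizable Z P (v |: A));
  move=> // h -> /=; try (by have := h isT isT);
  by rewrite ?mulr0 ?mulr1 ?addr0 ?add0r.
Qed.

(* The half-open cone {A >= 0, B < 0} has Euler characteristic 0.  In the
   induction, {v >= 0} is the complement of {v < 0}. *)
Lemma sum_cells_eq0 Z0 A B l0 : A != set0 ->
  (forall i, i \in Z0 -> ev l0 i = 0) ->
  (forall i, i \in A :|: B -> 0 < ev l0 i) ->
  \sum_(Z : {set 'I_N} | Z \subset A) cell_sign (Z0 :|: Z) (A :\: Z) B = 0.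
Proof.
move=> A0 l0Z; have [n] := ubnP #|A|; elim: n A B A0 => // n IH A B A0.
rewrite ltnS => An l0AB; have /set0Pn[v vA] := A0.
rewrite (bigID (fun Z : {set 'I_N} => v \in Z)) /=.
rewrite (reindex_onto (fun Z => v |: Z) (fun Z => Z :\ v)) /=; last first.
  by move=> Z /andP[_ vZ]; rewrite setD1K.
have eqA Z : (((v |: Z) \subset A) && (v \in v |: Z)) && ((v |: Z) :\ v == Z) =
    (Z \subset A :\ v).
  rewrite setU11 andbT subUset sub1set vA /= subsetD1; congr (_ && _).
  apply/eqP/idP => [<-|vZ]; first by rewrite setD11.
  by rewrite setU1K.
have eqA' (Z : {set 'I_N}) : (Z \subset A) && (v \notin Z) = (Z \subset A :\ v).
  by rewrite subsetD1.
rewrite (eq_bigl _ _ eqA) (eq_bigl _ _ eqA') -big_split /=.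
have eqs (Z : {set 'I_N}) : Z \subset A :\ v ->
    cell_sign (Z0 :|: (v |: Z)) (A :\: (v |: Z)) B + cell_sign (Z0 :|: Z) (A :\: Z) B
  = cell_sign (Z0 :|: Z) ((A :\ v) :\: Z) B - cell_sign (Z0 :|: Z) ((A :\ v) :\: Z) (v |: B).
  rewrite subsetD1 => /andP[ZA vZ].
  rewrite (cell_sign_cut v (Z0 :|: Z) ((A :\ v) :\: Z) B).
  have -> : A :\: (v |: Z) = A :\ v :\: Z by rewrite setDDl.
  have -> : v |: (A :\ v :\: Z) = A :\: Z.
    apply/setP => i; rewrite !inE; case: eqP => [->|] //=.
    by rewrite vZ vA.
  by rewrite setUCA; lra.
rewrite (eq_bigr _ eqs) sumrB.
(* For [A] reduced to [v], both remaining cells contain [- l0] and have the same rank, so they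
   cancel. *)
have [A10|A1] := eqVneq (A :\ v) set0.
  rewrite A10 (eq_bigl (pred1 set0)) ?big_pred1_eq; last by move=> Z; rewrite subset0.
  rewrite (eq_bigl (pred1 set0)) ?big_pred1_eq; last by move=> Z; rewrite subset0.
  rewrite /cell_sign (_ : realizable _ _ _ = true); last first.
    apply/asboolP; exists (-1 *: l0); split=> i; rewrite ?inE ?orbF //= evZ.
      by move=> /l0Z->; rewrite mulr0.
    by move=> iB; rewrite mulN1r oppr_lt0 l0AB // inE iB orbT.
  rewrite (_ : realizable _ _ _ = true) ?subrr //.
  apply/asboolP; exists (-1 *: l0); split=> i; rewrite ?inE ?orbF //= evZ.
    by move=> /l0Z->; rewrite mulr0.
  move=> iB; rewrite mulN1r oppr_lt0 l0AB // inE.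
  by case/orP: iB => [/eqP->|->]; rewrite ?vA ?orbT.
have lt : (#|A :\ v| < n)%N by move: An; rewrite (cardsD1 v A) vA.
rewrite !IH ?subrr // => i; rewrite !inE => h; apply: l0AB; rewrite inE; move: h.
  by case: eqP => [->|_] /=; rewrite ?vA //.
by move=> /orP[/andP[_ ->]|->]; rewrite ?orbT.
Qed.

Definition zero_sets : {set {set 'I_N}} :=
  [set Z : {set 'I_N} | `[< exists l, (forall i, 0 <= ev l i) /\
                         forall i, (i \in Z) = (ev l i == 0) >]].

Lemma zero_setsP Z : reflect (exists l, (forall i, 0 <= ev l i) /\
    forall i, (i \in Z) = (ev l i == 0)) (Z \in zero_sets).
Proof. by rewrite inE; exact: asboolP. Qed.

Lemma zero_sets_setT : setT \in zero_sets.
Proof.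
apply/zero_setsP; exists 0; have e i : ev 0 i = 0 by rewrite /ev mulmx0 mxE.
by split=> i; rewrite e ?inE ?eqxx.
Qed.

(** A face of a face is a face: add a small multiple of [l] to a functional exposing [Z]. Off [Z] it
    stays positive, and on [Z] only the multiple of [l] is left. *)
Lemma zero_sets_lift Z l : Z \in zero_sets ->
  (forall i, i \in Z -> 0 <= ev l i) -> [set i in Z | ev l i == 0] \in zero_sets.
Proof.
move=> /zero_setsP[k [k0 kZ]] lZ; have [eps eps0 h] := perturb_sign k l.
have pos i : i \notin Z -> 0 < ev (k + eps *: l) i.
  by move=> iZ; apply: (proj1 (h i)); rewrite lt_def -kZ iZ k0.
have evZE i : i \in Z -> ev (k + eps *: l) i = eps * ev l i.
  by move=> iZ; rewrite evD evZ; move: iZ; rewrite kZ => /eqP->; rewrite add0r.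
apply/zero_setsP; exists (k + eps *: l); split=> i.
  have [iZ|/pos/ltW //] := boolP (i \in Z).
  by rewrite evZE // mulr_ge0 ?lZ // ltW.
rewrite inE; have [iZ|/pos/gt_eqF -> //] := boolP (i \in Z).
by rewrite evZE // mulf_eq0 (gt_eqF eps0).
Qed.

(** Zero sets are flats: a functional exposing [Z] also vanishes on everything in its span. *)
Lemma notin_span i Z : Z \in zero_sets -> i \notin Z ->
  ~~ (row i V <= span_of Z)%MS.
Proof.
move=> /zero_setsP[l [l0 lZ]] iZ; apply/negP => /dep_ev -/(_ l) h.
by move: iZ; rewrite lZ h ?eqxx // => j; rewrite lZ => /eqP.
Qed.

Lemma rk_proper Z1 Z2 : Z1 \in zero_sets -> Z1 \proper Z2 -> (rk Z1 < rk Z2)%N.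
Proof.
move=> Z1L /properP[Z12 [i iZ2 iZ1]].
rewrite -(rk_indep (notin_span Z1L iZ1)); apply: rkS.
by rewrite subUset sub1set iZ2.
Qed.

(** A ratio test. Let [l] expose [Z1], and let [u] vanish on [Z1] and [i1] but be positive somewhere
    on [Z2]. Subtract the largest multiple of [u] keeping [l] nonnegative on [Z2]: the minimizing
    index [j] becomes a new zero, while the value at [i1] stays positive, so the zero set lies
    strictly between. *)
Lemma zero_sets_interpolate Z1 Z2 : Z1 \in zero_sets -> Z2 \in zero_sets ->
  Z1 \proper Z2 -> ((rk Z1).+1 < rk Z2)%N ->
  exists2 Z, Z \in zero_sets & (Z1 \proper Z) && (Z \proper Z2).
Proof.
move=> Z1L Z2L /properP[Z12 [i1 i1Z2 i1Z1]] lt.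
rewrite -(rk_indep (notin_span Z1L i1Z1)) in lt.
have [i2 i2Z2 /indep_ev[u uZ ui2]] : exists2 i, i \in Z2 &
    ~~ (row i V <= span_of (i1 |: Z1))%MS.
  have [/exists_inP //|] := boolP [exists i in Z2,
    ~~ (row i V <= span_of (i1 |: Z1))%MS].
  rewrite negb_exists_in => /forall_inP h.
  move: lt; rewrite ltnNge mxrankS //; apply/sumsmx_subP => i iZ2.
  by rewrite genmxE; have := h i iZ2; rewrite negbK.
have /zero_setsP[l [l0 lZ1]] := Z1L.
pose Q i := (i \in Z2) && (0 < ev u i).
have Qi2 : Q i2 by rewrite /Q i2Z2 ui2 ltr01.
pose j := [arg min_(i < i2 | Q i) (ev l i / ev u i)]%O.
have [/andP[jZ2 uj] jmin] : Q j /\ forall i, Q i -> ev l j / ev u j <= ev l i / ev u i.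
  by rewrite /j; case: arg_minP.
set t := ev l j / ev u j in jmin.
have t0 : 0 <= t by rewrite divr_ge0 // ltW.
pose k := l + (- t) *: u.
have kE i : ev k i = ev l i - t * ev u i by rewrite evD evZ mulNr.
have k0 i : i \in Z2 -> 0 <= ev k i.
  move=> iZ2; rewrite kE subr_ge0; have [u0|u0] := ltP 0 (ev u i).
    by rewrite -ler_pdivlMr // jmin // /Q iZ2.
  by rewrite (le_trans _ (l0 i)) // mulr_ge0_le0.
exists [set i in Z2 | ev k i == 0]; first exact: zero_sets_lift.
apply/andP; split; apply/properP; split.
- apply/subsetP => i iZ1; rewrite inE (subsetP Z12) //= kE uZ ?setU1r //.
  by rewrite mulr0 subr0 -lZ1.
- exists j; first by rewrite inE jZ2 kE /t divfK ?subrr ?eqxx ?gt_eqF.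
  by apply: contraL uj => jZ1; rewrite uZ ?ltxx // setU1r.
- by apply/subsetP => i; rewrite inE => /andP[].
- by exists i1 => //; rewrite inE i1Z2 kE uZ ?setU11 // mulr0 subr0 -lZ1.
Qed.

(** Take a proper subface of maximal rank; a gap of two or more could be interpolated. The empty set
    ensures that there is a proper subface at all. *)
Lemma zero_sets_graded Z : set0 \in zero_sets -> Z \in zero_sets -> (0 < rk Z)%N ->
  exists Z1, [/\ Z1 \in zero_sets, Z1 \proper Z & rk Z = (rk Z1).+1].
Proof.
move=> L0 ZL rZ; pose Q Z' := (Z' \in zero_sets) && (Z' \proper Z).
have Q0 : Q set0.
  rewrite /Q L0 proper0; apply: contraTneq rZ => ->; by rewrite rk0.
pose Z1 := [arg max_(Z' > set0 | Q Z') rk Z'].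
have [/andP[Z1L Z1Z] Z1max] : Q Z1 /\ forall Z', Q Z' -> (rk Z' <= rk Z1)%N.
  by rewrite /Z1; case: arg_maxnP.
exists Z1; split=> //; apply/eqP; rewrite eqn_leq rk_proper // andbT leqNgt.
apply/negP => /(zero_sets_interpolate Z1L ZL Z1Z)[Z' Z'L /andP[h1 h2]].
by have := rk_proper Z1L h1; rewrite ltnNge Z1max // /Q Z'L.
Qed.

(** The faces between [Z1] and [Z2] are the cells of the cone of functionals vanishing on [Z1] and
    nonnegative on [Z2]. A functional exposing [Z1] serves as the interior point [l0]. *)
Lemma zero_sets_euler Z1 Z2 : Z1 \in zero_sets -> Z2 \in zero_sets ->
  Z1 \proper Z2 ->
  \sum_(Z in zero_sets | (Z1 \subset Z) && (Z \subset Z2)) (-1) ^+ rk Z = 0 :> int.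
Proof.
move=> Z1L Z2L Z12; have /properP[sZ12 [i iZ2 iZ1]] := Z12.
have /zero_setsP[l [l0 lZ1]] := Z1L.
have A0 : Z2 :\: Z1 != set0 by apply/set0Pn; exists i; rewrite inE iZ1.
have h1 j : j \in Z1 -> ev l j = 0 by rewrite lZ1 => /eqP.
have h2 j : j \in (Z2 :\: Z1) :|: set0 -> 0 < ev l j.
  by rewrite setU0 inE => /andP[jZ1 _]; rewrite lt_def -lZ1 jZ1 l0.
rewrite -[RHS](sum_cells_eq0 A0 h1 h2) {h1 h2}.
rewrite [RHS](reindex_onto (fun Z => Z :\: Z1) (fun Z => Z1 :|: Z)) /=; last first.
  move=> Z; rewrite subsetD => /andP[_ dis].
  by apply/setP => j; rewrite !inE; case: (boolP (j \in Z1)) => //= jZ1;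
     rewrite (disjointFl dis).
rewrite big_mkcond [RHS]big_mkcond; apply: eq_bigr => Z _.
have UD : Z1 :|: (Z :\: Z1) = Z1 :|: Z.
  by apply/setP => j; rewrite !inE; case: (j \in Z1).
have -> : (Z :\: Z1 \subset Z2 :\: Z1) && (Z1 :|: (Z :\: Z1) == Z) =
    (Z1 \subset Z) && (Z \subset Z2).
  apply/andP/andP => -[].
    move=> h /eqP<-; rewrite subsetUl subUset sZ12; split=> //.
    by apply: subset_trans h _; exact: subsetDl.
  move=> h1 h2; rewrite setSD //; split=> //.
  by rewrite UD (setUidPr h1).
have [/andP[h1 h2]|] := boolP ((Z1 \subset Z) && _); last by rewrite andbF.
rewrite andbT /cell_sign UD (setUidPr h1).
suff -> : realizable Z (Z2 :\: Z1 :\: (Z :\: Z1)) set0 = (Z \in zero_sets).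
  by case: ifP; rewrite ?mulr1 ?mulr0.
apply/asboolP/idP => [[k [kZ kP _]]|/zero_setsP[k [k0 kZ]]]; last first.
  exists k; split=> j; rewrite ?inE //; first by rewrite kZ => /eqP.
  move=> h; rewrite lt_def k0 andbT -kZ; move: h.
  by case: (boolP (j \in Z1)) => // _ /andP[].
have kZ2 j : j \in Z2 -> j \notin Z -> 0 < ev k j.
  move=> jZ2 jZ; apply: kP.
  have jZ1 : j \notin Z1 by apply: contra jZ; apply/subsetP.
  by rewrite !inE jZ2 (negbTE jZ) (negbTE jZ1).
(* [k] is controlled on [Z2] only; since [Z2] is itself a face, [zero_sets_lift] makes up for the
   other points. *)
suff -> : Z = [set j in Z2 | ev k j == 0].
  apply: zero_sets_lift => // j jZ2.
  by have [/kZ->//|/(kZ2 _ jZ2)/ltW] := boolP (j \in Z).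
apply/setP => j; rewrite inE; have [jZ2|jZ2] := boolP (j \in Z2); last first.
  by apply/negbTE; apply: contra jZ2; apply/subsetP.
by have [/kZ->|/(kZ2 _ jZ2)/gt_eqF ->] := boolP (j \in Z); rewrite ?eqxx.
Qed.

End Configuration.

(** * Chains in Eulerian face lattices *)

(* Used in both directions, this identifies two rank functions without
   computing either of them. *)
Lemma rank_simulation (T1 T2 : Type) (D1 : T1 -> Prop) (lt1 : T1 -> T1 -> Prop)
    (r1 : T1 -> nat) (r2 : T2 -> nat) (rel : T1 -> T2 -> Prop) :
  (forall x, D1 x -> (0 < r1 x)%N ->
     exists y, [/\ D1 y, lt1 y x & r1 x = (r1 y).+1]) ->
  (forall x x' y, D1 x -> D1 y -> rel x x' -> lt1 y x ->
     exists2 y', rel y y' & (r2 y' < r2 x')%N) ->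
  forall x x', D1 x -> rel x x' -> (r1 x <= r2 x')%N.
Proof.
move=> graded sim x x'; have [n] := ubnP (r1 x).
elim: n x x' => // n IH x x'; rewrite ltnS => xn Dx xx'.
case: (posnP (r1 x)) => [->//|/(graded x Dx)[y [Dy yx e]]].
have [y' yy' lt] := sim x x' y Dx Dy xx' yx.
by rewrite e (leq_ltn_trans _ lt) // IH //; rewrite -e.
Qed.

(** A face is the set of indices of the generating points on it. The rank is the dimension plus one,
    so that the empty face has rank 0. *)
Record face_lattice (I : finType) (L : {set {set I}}) (r : {set I} -> nat) : Prop :=
  FaceLattice {
    fl0 : set0 \in L;
    flT : setT \in L;
    fl_rank0 : r set0 = 0%N;
    fl_proper : forall Z W, Z \in L -> W \in L -> Z \proper W -> (r Z < r W)%N;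
    fl_graded : forall Z, Z \in L -> (0 < r Z)%N ->
      exists W, [/\ W \in L, W \proper Z & r Z = (r W).+1] }.

Definition eulerian (I : finType) (L : {set {set I}}) (r : {set I} -> nat) : Prop :=
  forall Z W, Z \in L -> W \in L -> Z \proper W ->
    \sum_(Y in L | (Z \subset Y) && (Y \subset W)) (-1) ^+ r Y = 0 :> int.

(** Inclusions are weak, so repeating a rank, prefixing rank 0 to a chain from [set0] or appending
    the top rank does not change the count. *)
Fixpoint chain_count (I : finType) (L : {set {set I}}) (r : {set I} -> nat)
    (Z : {set I}) (s : seq nat) : nat :=
  if s is a :: s' then
    (\sum_(W in L | (Z \subset W) && (r W == a)) chain_count L r W s')%N
  else 1%N.

Arguments chain_count {I} L r Z s : simpl never.

Definition ranks (n : nat) (p : pred nat) : seq nat :=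
  [seq i.+1 | i <- iota 0 n & p i].

Definition flag_function (I : finType) (L : {set {set I}}) (r : {set I} -> nat)
    (n : nat) (p : pred nat) : int :=
  (chain_count L r set0 (ranks n p))%:R.

Section Counting.

Variables (I : finType) (L : {set {set I}}) (r : {set I} -> nat).
Hypothesis FL : face_lattice L r.
Implicit Types (Z W Y : {set I}) (s t : seq nat).

Local Notation cnt := (chain_count L r).

Lemma fl_leq Z W : Z \in L -> W \in L -> Z \subset W -> (r Z <= r W)%N.
Proof.
move=> ZL WL; rewrite subEproper => /predU1P[->//|/(fl_proper FL ZL WL)].
exact: ltnW.
Qed.

Lemma fl_eq Z W : Z \in L -> W \in L -> Z \subset W -> (r W <= r Z)%N -> Z = W.
Proof.
move=> ZL WL; rewrite subEproper => /predU1P[//|/(fl_proper FL ZL WL)].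
by rewrite ltnNge => /negbTE->.
Qed.

Lemma fl_rank_eq0 Z : Z \in L -> (r Z == 0%N) = (Z == set0).
Proof.
move=> ZL; apply/eqP/eqP => [rZ|->]; last exact: fl_rank0 FL.
by apply/esym/fl_eq => //; rewrite ?rZ ?sub0set ?(fl0 FL).
Qed.

Lemma cnt_cons Z a s : cnt Z (a :: s) =
  (\sum_(W in L | (Z \subset W) && (r W == a)) cnt W s)%N.
Proof. by []. Qed.

Lemma cnt_bot s : cnt set0 (0%N :: s) = cnt set0 s.
Proof.
rewrite cnt_cons (big_pred1 set0) // => W /=; rewrite sub0set /=.
have [WL|/negbTE WL] := boolP (W \in L); first exact: fl_rank_eq0.
by apply/esym; apply: contraFF WL => /eqP->; exact: fl0 FL.
Qed.

Lemma cnt_stay Z s : Z \in L -> cnt Z (r Z :: s) = cnt Z s.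
Proof.
move=> ZL; rewrite cnt_cons (big_pred1 Z) // => W /=.
apply/idP/eqP => [/and3P[WL ZW /eqP rW]|->]; last by rewrite ZL subxx eqxx.
by apply/esym/fl_eq => //; rewrite rW.
Qed.

Lemma cnt_top Z s : cnt Z (rcons s (r setT)) = cnt Z s.
Proof.
elim: s Z => [|a s IH] Z; last by apply: eq_bigr => W _; exact: IH.
rewrite [rcons _ _]/= cnt_cons (big_pred1 setT) // => W /=.
apply/idP/eqP => [/and3P[WL ZW /eqP rW]|->]; last by rewrite (flT FL) subsetT eqxx.
by apply: fl_eq => //; rewrite ?subsetT ?(flT FL) ?rW.
Qed.

Lemma cnt_dup Z s a t : cnt Z (s ++ a :: a :: t) = cnt Z (s ++ a :: t).
Proof.
elim: s Z => [|b s IH] Z /=; last by apply: eq_bigr => W _; exact: IH.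
by apply: eq_bigr => W /and3P[WL _ /eqP<-]; exact: cnt_stay.
Qed.

Hypothesis EU : eulerian L r.

(** Euler's relation with its two end terms moved to the right. The exponent [r Y + lo.+1] has the
    parity of the difference and avoids truncated subtraction. *)
Lemma euler_open Z W lo k : Z \in L -> W \in L -> Z \subset W ->
    r Z = lo -> r W = k -> (lo < k)%N ->
  \sum_(Y in L | [&& Z \subset Y, Y \subset W & (lo < r Y < k)%N])
    (-1) ^+ (r Y + lo.+1) = 1 - (-1) ^+ (k - lo.+1) :> int.
Proof.
move=> ZL WL ZW rZ rW lok.
have pZW : Z \proper W.
  by rewrite properEneq ZW andbT; apply: contraTneq lok => e; rewrite -rZ -rW e ltnn.
have := EU ZL WL pZW.
rewrite (bigD1 Z) /=; last by rewrite ZL subxx ZW.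
rewrite (bigD1 W) /=; last by rewrite WL subxx ZW eq_sym (proper_neq pZW).
rewrite (eq_bigl (fun Y => (Y \in L) && [&& Z \subset Y, Y \subset W & (lo < r Y < k)%N])).
  rewrite rZ rW => e; under eq_bigr do rewrite exprD.
  rewrite -mulr_suml exprS.
  have -> : (-1) ^+ (k - lo.+1) = - ((-1) ^+ k * (-1) ^+ lo) :> int.
    by rewrite -{2}(subnK lok) exprD exprS mulN1r mulrN mulNr opprK -mulrA -expr2 sqrr_sign mulr1.
  set S := \sum_(_ | _) _ in e *.
  move: (sqrr_sign int lo) e; rewrite expr2.
  move: S ((-1) ^+ lo : int) ((-1) ^+ k : int) => S x y xx /eqP.
  rewrite addrA addr_eq0 => /eqP e; have {e}-> : S = - (x + y) by rewrite e opprK.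
  by rewrite mulN1r mulrNN mulrDl xx opprK.
move=> Y /=; case: (boolP (Y \in L)) => //= YL.
case: (boolP (Z \subset Y)) => //= ZY; case: (boolP (Y \subset W)) => //= YW.
rewrite -rZ -rW; apply/andP/andP => -[].
  move=> YZ YneW; split.
    by apply: (fl_proper FL) => //; rewrite properEneq eq_sym YZ.
  by apply: (fl_proper FL) => //; rewrite properEneq YneW.
by move=> h1 h2; split; [apply: contraTneq h1|apply: contraTneq h2] => ->; rewrite ltnn.
Qed.

Lemma sum_by_rank (P : pred {set I}) (F : nat -> {set I} -> int) lo k :
  \sum_(lo <= j < k) \sum_(Y in L | P Y && (r Y == j.+1)) F j Y =
  \sum_(Y in L | P Y && (lo < r Y < k.+1)%N) F (r Y).-1 Y.
Proof.
rewrite (exchange_big_dep (fun Y => (Y \in L) && P Y)) /=; last first.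
  by move=> j Y _ /and3P[-> ->].
rewrite big_mkcond [RHS]big_mkcond; apply: eq_bigr => Y _.
case: (Y \in L); case: (P Y); rewrite /= ?big_pred0_eq //.
case rY: (r Y) => [|a]; first by rewrite big_pred0.
under eq_bigl => j do rewrite eqSS eq_sym.
by rewrite big_nat1_eq.
Qed.

(** Fix the face [W] of rank [k.+1] first: what remains of the sum over j is the alternating count
    of the open interval between [Z] and [W]. *)
Lemma cnt_ds_base Z lo k t : Z \in L -> r Z = lo -> (lo <= k)%N ->
  \sum_(lo <= j < k) (-1) ^+ (j - lo) * (cnt Z [:: j.+1, k.+1 & t])%:R =
  (1 - (-1) ^+ (k - lo)) * (cnt Z (k.+1 :: t))%:R :> int.
Proof.
move=> ZL rZ lok.
under eq_bigr => j _ do rewrite cnt_cons natr_sum mulr_sumr.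
rewrite sum_by_rank.
under eq_bigr => Y _ do rewrite cnt_cons natr_sum mulr_sumr.
rewrite cnt_cons natr_sum mulr_sumr.
have e (W : {set I}) : (W \in L) && ((Z \subset W) && (r W == k.+1)) ->
   (1 - (-1) ^+ (k - lo)) * (cnt W t)%:R =
   \sum_(Y in L | [&& Z \subset Y, Y \subset W & (lo < r Y < k.+1)%N])
     (-1) ^+ ((r Y).-1 - lo) * (cnt W t)%:R :> int.
  move=> /and3P[WL ZW /eqP rW]; rewrite -mulr_suml; congr (_ * _).
  rewrite -subSS -(@euler_open Z W lo k.+1) // ?ltnS //.
  apply: eq_bigr => Y /andP[YL /and3P[_ _ /andP[h _]]].
  rewrite -signr_odd -[RHS]signr_odd; congr (_ ^+ _); lia.
rewrite [RHS](eq_bigr _ e) [RHS](exchange_big_dep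
  (fun Y => [&& Y \in L, Z \subset Y & (lo < r Y < k.+1)%N])) /=; last first.
  by move=> W Y _ /and4P[-> -> _ ->].
apply: eq_big => [Y|Y /and3P[YL ZY lk]]; first by rewrite andbA.
apply: eq_bigl => W; rewrite YL ZY lk andbT /=.
case: (boolP (Y \subset W)) => [YW|]; last by rewrite !andbF.
by rewrite (subset_trans ZY YW) andbT.
Qed.

Lemma cnt_ds s Z lo k t : Z \in L -> last (r Z) s = lo -> (lo <= k)%N ->
  \sum_(lo <= j < k) (-1) ^+ (j - lo) * (cnt Z (s ++ [:: j.+1, k.+1 & t]))%:R =
  (1 - (-1) ^+ (k - lo)) * (cnt Z (s ++ k.+1 :: t))%:R :> int.
Proof.
elim: s Z => [|a s IH] Z ZL rZ lok; first exact: cnt_ds_base.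
have cntE u : cnt Z ((a :: s) ++ u) =
  (\sum_(W in L | (Z \subset W) && (r W == a)) cnt W (s ++ u))%N by [].
rewrite cntE natr_sum mulr_sumr.
under eq_bigr => j _ do rewrite cntE natr_sum mulr_sumr.
rewrite exchange_big; apply: eq_bigr => W /and3P[WL _ /eqP rW] /=.
by apply: IH => //; rewrite rW.
Qed.

Lemma flag_function_ds n : r setT = n.+1 ->
  dehn_sommerville n (flag_function L r n).
Proof.
move=> rT p lo k /andP[lok kn] hlo hk hp.
pose s := ranks lo p; pose t := [seq i.+1 | i <- iota k (n - k) & p i].
have io : iota 0 n = iota 0 lo ++ iota lo (k - lo) ++ iota k (n - k).
  by rewrite -{1}(subnKC kn) iotaD add0n -{1}(subnKC lok) iotaD add0n catA.
have eS : ranks n p = s ++ t.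
  rewrite /ranks io !filter_cat !map_cat; congr (_ ++ _).
  rewrite (eq_in_filter (a2 := pred0)) ?filter_pred0 // => i.
  by rewrite mem_iota subnKC // => /hp/negbTE.
have eSj j : (lo <= j < k)%N -> ranks n (adjoin p j) = s ++ j.+1 :: t.
  move=> jlk; rewrite /ranks io !filter_cat !map_cat.
  congr (_ ++ _).
    congr map; apply: eq_in_filter => i; rewrite mem_iota add0n /adjoin => /andP[_ ilo].
    by have /negbTE-> : i != j by lia.
  rewrite -cat1s; congr (_ ++ _); last first.
    congr map; apply: eq_in_filter => i; rewrite mem_iota /adjoin => /andP[ki _].
    by have /negbTE-> : i != j by lia.
  rewrite (eq_in_filter (a2 := pred1 j)) => [|i].
    by rewrite filter_pred1_uniq ?iota_uniq // mem_iota subnKC.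
  by rewrite mem_iota subnKC // /adjoin => /hp/negbTE->; rewrite orbF.
(* Appending the rank of the whole polytope makes k = n an ordinary element of the chain. At the
   other end, the index -1 is the empty face from which all chains start. *)
pose t' := rcons t n.+1.
have e1 : cnt set0 (ranks n p) = cnt set0 (s ++ t').
  by rewrite eS -[LHS]cnt_top rcons_cat rT.
have e2 j : (lo <= j < k)%N ->
    cnt set0 (ranks n (adjoin p j)) = cnt set0 (s ++ j.+1 :: t').
  by move=> h; rewrite eSj // -[LHS]cnt_top rcons_cat rT.
have [t'' et'] : exists t'', t' = k.+1 :: t''.
  rewrite /t' /t; move: hk; have [->|/negbTE nk /= pk] := eqVneq k n.
    by rewrite subnn; exists [::].
  have -> : (n - k = (n - k).-1.+1)%N by move/eqP: nk => nk; lia.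
  by rewrite /= pk; eexists.
rewrite /flag_function -/cnt e1 et' -(@cnt_ds _ _ lo) ?(fl0 FL) //.
  apply: eq_big_nat => j h; by rewrite e2 // et'.
rewrite (fl_rank0 FL) /s /ranks; case: (lo) hlo => [//|m]; change (p m -> last 0%N (ranks m.+1 p) = m.+1) => pm.
by rewrite /ranks -{1}[m.+1]addn1 iotaD filter_cat map_cat /= pm cats1 last_rcons.
Qed.
End Counting.

(** * Pyramids and prisms *)

Section Shift.

Variables (I : finType) (L : {set {set I}}) (r : {set I} -> nat) (n : nat).
Hypothesis FL : face_lattice L r.
Hypothesis rT : r setT = n.+1.
Implicit Types (Z W Y : {set I}) (s t : seq nat) (p : pred nat).

Local Notation cnt := (chain_count L r).
Local Notation h := (flag_function L r n).

(** Chains in the pyramid starting from the base face [Z]: the first k faces lie in the base, the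
    others are pyramids over faces of one rank less. *)
Definition shift_count Z s : nat :=
  (\sum_(k < (size s).+1) cnt Z (take k s ++ map predn (drop k s)))%N.

Lemma shift_count_cons Z a s : shift_count Z (a :: s) =
  (cnt Z (a.-1 :: map predn s) +
   \sum_(W in L | (Z \subset W) && (r W == a)) shift_count W s)%N.
Proof.
rewrite /shift_count big_ord_recl; congr addn.
by rewrite exchange_big.
Qed.

(** Passes from the place where a chain leaves the base, as in [shift_count], to the dimension a of
    its last base face, as in [cone_op]. *)
Lemma sum_filter_split (Phi : seq nat -> seq nat -> int) p s :
  \sum_(k < size (filter p s))
    Phi (take k.+1 (filter p s)) (drop k.+1 (filter p s)) =
  \sum_(k < size s) (p (nth 0%N s k))%:R *
    Phi (filter p (take k.+1 s)) (filter p (drop k.+1 s)).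
Proof.
elim: s Phi => [|x s IH] Phi; first by rewrite !big_ord0.
rewrite [RHS]big_ord_recl /= take0 drop0.
case: ifP => px /=; last by rewrite mul0r add0r IH.
by rewrite big_ord_recl /= take0 drop0 mul1r (IH (fun u v => Phi (x :: u) v)).
Qed.

Lemma iota_succ a m : iota a.+1 m = map succn (iota a m).
Proof. by rewrite (iotaDl 1 a m). Qed.

Lemma count_ranks_pred p :
  cnt set0 (map predn (ranks n.+1 p)) = cnt set0 (ranks n (p \o succn)).
Proof.
rewrite /ranks /= iota_succ filter_map /=.
rewrite -map_comp; case: (p 0%N) => /=.
  rewrite cnt_bot // -!map_comp; congr (cnt _ _); exact: eq_map.
rewrite -!map_comp; congr (cnt _ _); exact: eq_map.
Qed.

(** The last base face has rank a + 1. If a + 1 is in [p], the next face is a pyramid over a base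
    face of this same rank, and the repetition is dropped, as in [pmerge]. For a = n the base face
    is the whole base, and its rank is dropped as well. *)
Lemma count_ranks_merge p a : (a <= n)%N -> p a ->
  cnt set0 ([seq i.+1 | i <- iota 0 a.+1 & p i] ++
            [seq i | i <- iota a.+1 (n - a) & p i]) =
  cnt set0 (ranks n (pmerge a p)).
Proof.
move=> an pa; rewrite -addn1 iotaD filter_cat map_cat /= pa /=.
have low m : (m <= a)%N -> [seq i <- iota 0 m | pmerge a p i] = [seq i <- iota 0 m | p i].
  move=> ma; apply: eq_in_filter => i; rewrite mem_iota add0n /pmerge => /andP[_ im].
  have ia := leq_trans im ma.
  by rewrite (ltnW ia) leqNgt ia orbF.
move: an; rewrite leq_eqVlt => /predU1P[ean|an].
  by rewrite -ean subnn /= cats0 cats1 ean -rT cnt_top // /ranks -ean low.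
have [m ->] : exists m, n = (a + m.+1)%N by exists (n - a).-1; lia.
rewrite addKn /ranks iotaD add0n filter_cat map_cat low // -catA.
rewrite addn1 iota_succ /=.
have pma : pmerge a p a by rewrite /pmerge leqnn pa.
rewrite pma iota_succ !filter_map !map_id /=.
have -> : [seq i <- iota a m | preim succn (fun i => pmerge a p i) i] =
  [seq i <- iota a m | p i.+2].
  apply: eq_in_filter => i; rewrite mem_iota /pmerge /= => /andP[ai _].
  by rewrite ltnNge ai /= ltnW.
by case: ifP => // _; rewrite cnt_dup.
Qed.

Lemma shift_count_ranks p :
  (shift_count set0 (ranks n.+1 p))%:R =
  h (p \o succn) + \sum_(a < n.+1) (p a)%:R * h (pmerge a p).
Proof.
rewrite /shift_count big_ord_recl take0 drop0 natrD; congr (_ + _).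
  by rewrite cat0s count_ranks_pred.
rewrite natr_sum /ranks size_map.
under eq_bigr => i _ do rewrite /= -map_take -map_drop -map_comp /=.
have := sum_filter_split (fun u v => (cnt set0 (map succn u ++
   [seq (i.+1).-1 | i <- v]))%:R) p (iota 0 n.+1).
move=> ->; rewrite size_iota; apply: eq_bigr => a _.
have an : (a <= n)%N by rewrite -ltnS.
rewrite nth_iota // add0n; case: (boolP (p a)) => pa; rewrite ?mul0r // !mul1r.
rewrite take_iota drop_iota (minn_idPl _) // add0n subSS /h /flag_function.
by rewrite -count_ranks_merge.
Qed.

End Shift.

Lemma sum_setU (J : finType) (A B : {set J}) (P : pred J) (F : J -> nat) :
  [disjoint A & B] ->
  (\sum_(X in A :|: B | P X) F X =
   \sum_(X in A | P X) F X + \sum_(X in B | P X) F X)%N.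
Proof.
move=> dAB; rewrite !big_mkcondr -bigU //.
by apply: eq_bigl => X; rewrite !inE.
Qed.

Lemma sum_imset (I J : finType) (f : I -> J) (A : {set I}) (P : pred J)
    (F : J -> nat) : {in A &, injective f} ->
  (\sum_(X in f @: A | P X) F X = \sum_(Z in A | P (f Z)) F (f Z))%N.
Proof. by move=> inj; rewrite big_mkcondr big_imset // -big_mkcondr. Qed.

Section Pyramid.

Variables (I J : finType) (L : {set {set I}}) (r : {set I} -> nat).
Variables (L' : {set {set J}}) (r' : {set J} -> nat).
Hypothesis FL : face_lattice L r.
Hypothesis FL' : face_lattice L' r'.
(* [enc false Z] is the face Z of the base and [enc true Z] the pyramid over it. *)
Variable enc : bool -> {set I} -> {set J}.
Hypothesis enc_sub : forall e Z f W,
  (enc e Z \subset enc f W) = (e ==> f) && (Z \subset W).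
Hypothesis encP : forall W, reflect (exists e, exists2 Z, Z \in L & W = enc e Z)
  (W \in L').

Lemma enc_inj e Z f W : enc e Z = enc f W -> e = f /\ Z = W.
Proof.
move=> E; have := enc_sub e Z f W; have := enc_sub f W e Z.
rewrite E subxx => /esym/andP[fe WZ] /esym/andP[ef ZW].
by split; [case: e f ef fe {E WZ ZW} => [] []|apply/eqP; rewrite eqEsubset ZW].
Qed.

Lemma enc_in e Z : Z \in L -> enc e Z \in L'.
Proof. by move=> ZL; apply/encP; exists e, Z. Qed.

Lemma enc_set0 : enc false set0 = set0.
Proof.
have [e [Z _ E]] := encP _ (fl0 FL').
by apply/eqP; rewrite -subset0 E enc_sub sub0set.
Qed.

Lemma enc_rank_mono e Z f W : Z \in L -> W \in L ->
  enc e Z \proper enc f W -> (r Z + e < r W + f)%N.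
Proof.
move=> ZL WL; rewrite properE !enc_sub => /andP[/andP[ef ZW]].
have := fl_leq FL ZL WL ZW.
have [->|ZneW] := eqVneq Z W; first by rewrite subxx andbT; case: e f ef => [] [] // _ _ _; rewrite addn0 addn1.
have := fl_proper FL ZL WL; rewrite properEneq ZneW ZW => /(_ isT).
by case: e f ef => [] []; lia.
Qed.

Lemma enc_rank e Z : Z \in L -> r' (enc e Z) = (r Z + e)%N.
Proof.
move=> ZL; apply/eqP; rewrite eqn_leq; apply/andP; split.
  pose rel (X : {set J}) (c : bool * {set I}) := c.2 \in L /\ X = enc c.1 c.2.
  apply: (@rank_simulation _ _ (fun X => X \in L') (fun X Y => X \proper Y) r'
    (fun c : bool * {set I} => (r c.2 + c.1)%N) rel _ _ (enc e Z) (e, Z)) => //.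
  - by move=> X XL /(fl_graded FL' XL).
  - move=> X [f W] Y XL /encP[f' [W' W'L ->]] [/= WL ->] lt.
    by exists (f', W') => //; apply: enc_rank_mono.
  - exact: enc_in.
pose rel (c : bool * {set I}) X := X = enc c.1 c.2.
apply: (@rank_simulation _ _ (fun c => c.2 \in L)
  (fun c d => enc c.1 c.2 \proper enc d.1 d.2)
  (fun c => (r c.2 + c.1)%N) r' rel _ _ (e, Z)) => //.
(* Directly below the pyramid over [W] lies [W] itself. *)
- move=> [[] W] /= WL.
    by rewrite addn1 => _; exists (false, W); rewrite addn0 properE !enc_sub subxx.
  rewrite addn0 => /(fl_graded FL WL)[Y [YL YW rY]]; exists (false, Y).
  by rewrite /= addn0 properE !enc_sub /= -properE.
- move=> [f W] X [f' W'] /= WL W'L -> lt; exists (enc f' W') => //.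
  by apply: (fl_proper FL') => //; exact: enc_in.
Qed.

Lemma sum_pyramid (F : {set J} -> nat) (P : pred {set J}) :
  (\sum_(X in L' | P X) F X =
   \sum_(Z in L | P (enc false Z)) F (enc false Z) +
   \sum_(Z in L | P (enc true Z)) F (enc true Z))%N.
Proof.
have -> : L' = enc false @: L :|: enc true @: L.
  apply/setP => X; rewrite inE; apply/encP/orP => [[[] [Z ZL ->]]|].
  - by right; apply: imset_f.
  - by left; apply: imset_f.
  - by move=> [] /imsetP[Z ZL ->]; [exists false, Z|exists true, Z].
rewrite sum_setU; last first.
  rewrite disjoint_subset; apply/subsetP => X /imsetP[Z ZL ->].
  by rewrite inE; apply/imsetP => -[W WL /enc_inj[]].
by rewrite !sum_imset // => Z W _ _ /enc_inj[].
Qed.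

Local Notation cnt := (chain_count L r).
Local Notation cnt' := (chain_count L' r').

(** Every face above a pyramid is a pyramid. Positive entries keep [predn] faithful, as it would
    confuse the ranks 0 and 1. *)
Lemma cnt_cone Z s : Z \in L -> all (leq 1) s ->
  cnt' (enc true Z) s = cnt Z (map predn s).
Proof.
elim: s Z => [//|a s IH] Z ZL /= /andP[a0 s0].
rewrite [LHS]sum_pyramid big_pred0 ?add0n => [|W]; last first.
  by rewrite enc_sub andbF.
apply: eq_big => [W|W /and3P[WL _ _]]; last exact: IH.
case: (boolP (W \in L)) => //= WL; rewrite enc_sub enc_rank //=.
by case: a a0 => // a _; rewrite addn1.
Qed.

Lemma cnt_base Z s : Z \in L -> all (leq 1) s ->
  cnt' (enc false Z) s = shift_count L r Z s.
Proof.
elim: s Z => [|a s IH] Z ZL; first by rewrite /shift_count big_ord1.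
move=> /= /andP[a0 s0]; rewrite shift_count_cons [LHS]sum_pyramid addnC.
congr addn; apply: eq_big => [W|W /and3P[WL _ _]].
- case: (boolP (W \in L)) => //= WL; rewrite enc_sub enc_rank //=.
  by case: a a0 => // a _; rewrite addn1.
- exact: cnt_cone.
- case: (boolP (W \in L)) => //= WL; rewrite enc_sub enc_rank //=.
  by rewrite addn0.
- exact: IH.
Qed.

Lemma flag_function_pyramid n p : r setT = n.+1 ->
  flag_function L' r' n.+1 p = cone_op n (flag_function L r n) p.
Proof.
move=> rT; rewrite /cone_op -(shift_count_ranks FL rT) /flag_function -enc_set0.
rewrite cnt_base ?(fl0 FL) //.
by apply/allP => i /mapP[j _ ->].
Qed.

End Pyramid.

Section Prism.

Variables (I J : finType) (L : {set {set I}}) (r : {set I} -> nat).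
Variables (L' : {set {set J}}) (r' : {set J} -> nat).
Hypothesis FL : face_lattice L r.
Hypothesis FL' : face_lattice L' r'.
(* [pr (Some b) Z] is the copy of the face Z in the bottom or top facet and
   [pr None Z] is the prism over Z. *)
Variable pr : option bool -> {set I} -> {set J}.
Hypothesis pr0 : forall k, pr k set0 = set0.
Hypothesis pr_sub : forall k Z l W, Z != set0 ->
  (pr k Z \subset pr l W) = ((l == None) || (k == l)) && (Z \subset W).
Hypothesis prP : forall W, reflect (exists k, exists2 Z, Z \in L & W = pr k Z)
  (W \in L').

Let rc (c : option bool * {set I}) : nat := (r c.2 + (c.1 == None))%N.
(** The empty face has three codes. The code [(None, set0)] would receive rank 1 under [rc] and is
    excluded; sums over faces list the empty face separately. *)
Let valid (c : option bool * {set I}) : Prop :=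
  c.2 \in L /\ ((c.2 != set0) || (c.1 != None)).

Lemma pr_in k Z : Z \in L -> pr k Z \in L'.
Proof. by move=> ZL; apply/prP; exists k, Z. Qed.

Lemma pr_eq0 k Z : (pr k Z == set0) = (Z == set0).
Proof.
have [->|Z0] := eqVneq Z set0; first by rewrite pr0 eqxx.
rewrite -subset0 -(pr0 k) pr_sub // eqxx orbT /= subset0.
exact: negbTE.
Qed.

Lemma pr_inj k Z l W : Z != set0 -> W != set0 -> pr k Z = pr l W -> k = l /\ Z = W.
Proof.
move=> Z0 W0 E; have := pr_sub k l W Z0; have := pr_sub l k Z W0.
rewrite E subxx => /esym/andP[lk WZ] /esym/andP[kl ZW].
split; last by apply/eqP; rewrite eqEsubset ZW.
by case: k l {E} lk kl => [[]|] [[]|].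
Qed.

Lemma pr_rank_mono c d : valid c -> valid d ->
  pr c.1 c.2 \proper pr d.1 d.2 -> (rc c < rc d)%N.
Proof.
case: c d => [k Z] [l W] [/= ZL vZ] [/= WL vW]; rewrite /rc /=.
have [Z0|Z0] := eqVneq Z set0.
  rewrite Z0 pr0 proper0 pr_eq0 (fl_rank0 FL) => W0.
  move: vZ; rewrite Z0 eqxx /= => /negbTE->; rewrite ltn_addr //.
  by rewrite lt0n (fl_rank_eq0 FL).
rewrite properE pr_sub // => /andP[/andP[kl ZW]].
have W0 : W != set0 by apply: contraNneq Z0 => W0; rewrite -subset0 -W0.
rewrite pr_sub //; have := fl_leq FL ZL WL ZW.
have [->|ZneW] := eqVneq Z W.
  by rewrite subxx andbT; case: k l kl {vZ vW} => [[]|] [[]|] // _ _ _;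
     rewrite addn0 addn1.
have := fl_proper FL ZL WL; rewrite properEneq ZneW ZW => /(_ isT).
by case: k l kl {vZ vW} => [?|] [?|] //= _; lia.
Qed.

Lemma pr_valid W : W \in L' -> exists2 c, valid c & W = pr c.1 c.2.
Proof.
move=> /prP[k [Z ZL ->]]; have [Z0|Z0] := eqVneq Z set0.
  by exists (Some true, set0); [rewrite /valid /= (fl0 FL) orbT|rewrite Z0 !pr0].
by exists (k, Z); rewrite // /valid /= Z0.
Qed.

Lemma pr_rank k Z : Z \in L -> (Z != set0) || (k != None) ->
  r' (pr k Z) = (r Z + (k == None))%N.
Proof.
move=> ZL vZ; apply/eqP; rewrite eqn_leq; apply/andP; split.
  pose rel (X : {set J}) c := valid c /\ X = pr c.1 c.2.
  apply: (@rank_simulation _ _ (fun X => X \in L') (fun X Y => X \proper Y) r'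
    rc rel _ _ (pr k Z) (k, Z)) => //.
  - by move=> X XL /(fl_graded FL' XL).
  - move=> X d Y XL /pr_valid[c vc ->] [vd ->] lt.
    by exists c => //; exact: pr_rank_mono.
  - exact: pr_in.
pose rel c (X : {set J}) := X = pr c.1 c.2.
apply: (@rank_simulation _ _ valid (fun c d => pr c.1 c.2 \proper pr d.1 d.2)
  rc r' rel _ _ (k, Z)) => //.
- move=> [[b|] W] [/= WL vW]; rewrite /rc /= ?addn0 ?addn1.
    move=> /(fl_graded FL WL)[Y [YL YW rY]]; exists (Some b, Y).
    rewrite /valid /= YL orbT addn0; split=> //.
    have [Y0|Y0] := eqVneq Y set0.
      rewrite Y0 pr0 proper0 pr_eq0; apply: contraTneq YW => ->.
      by rewrite properE sub0set andbF.
    rewrite properE pr_sub // eqxx orbT (proper_sub YW) /=.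
    have W0 : W != set0 by apply: contraTneq YW => ->; rewrite properE sub0set andbF.
    by rewrite pr_sub // eqxx orbT /=; case/andP: YW.
  rewrite orbF in vW => _; exists (Some true, W).
  rewrite /valid /= addn0 WL vW; split=> //.
  by rewrite properE !pr_sub // subxx.
- move=> c X d [cL _] [dL _] -> lt; exists (pr d.1 d.2) => //.
  by apply: (fl_proper FL') => //; exact: pr_in.
Qed.

Lemma sum_prism (F : {set J} -> nat) (P : pred {set J}) :
  (\sum_(X in L' | P X) F X = P set0 * F set0 +
   (\sum_(Z in L :\ set0 | P (pr (Some false) Z)) F (pr (Some false) Z) +
    \sum_(Z in L :\ set0 | P (pr (Some true) Z)) F (pr (Some true) Z) +
    \sum_(Z in L :\ set0 | P (pr None Z)) F (pr None Z)))%N.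
Proof.
have inj k : {in L :\ set0 &, injective (pr k)}.
  by move=> Z W; rewrite !inE => /andP[Z0 _] /andP[W0 _] /(pr_inj Z0 W0)[].
have dis k l : k != l -> [disjoint pr k @: (L :\ set0) & pr l @: (L :\ set0)].
  move=> kl; rewrite disjoint_subset; apply/subsetP => X /imsetP[Z].
  move=> /setD1P[Z0 _] ->; rewrite inE; apply/imsetP => -[W].
  by move=> /setD1P[W0 _] /(pr_inj Z0 W0)[e _]; rewrite e eqxx in kl.
have -> : L' = [set set0] :|: (pr (Some false) @: (L :\ set0) :|:
    pr (Some true) @: (L :\ set0) :|: pr None @: (L :\ set0)).
  apply/setP => X; apply/prP/idP => [[k [Z ZL ->]]|].
    rewrite !inE pr_eq0; have [//|Z0 /=] := eqVneq Z set0.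
    have Zin : Z \in L :\ set0 by rewrite !inE Z0.
    by case: k => [[]|]; rewrite !imset_f ?orbT.
  rewrite inE => /orP[/set1P->|]; first by exists None, set0; rewrite ?pr0 ?(fl0 FL).
  rewrite !inE => /orP[/orP[]|] /imsetP[Z /setD1P[_ ZL] ->];
    [by exists (Some false), Z|by exists (Some true), Z|by exists None, Z].
rewrite sum_setU; last first.
  rewrite disjoint_subset; apply/subsetP => X /set1P->; rewrite !inE !negb_or.
  by rewrite -andbA; apply/and3P; split; apply/imsetP => -[Z /setD1P[Z0 _]];
    move=> /esym/eqP; rewrite pr_eq0 (negbTE Z0).
congr addn; first by rewrite big_mkcondr big_set1; case: ifP; rewrite ?mul1n ?mul0n.
rewrite sum_setU; last by rewrite -setI_eq0 setIUl setU_eq0 !setI_eq0 !dis.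
by rewrite sum_setU ?dis // !sum_imset.
Qed.

Local Notation cnt := (chain_count L r).
Local Notation cnt' := (chain_count L' r').

Lemma sum_above Z (P : pred {set I}) (F : {set I} -> nat) : Z != set0 ->
  (\sum_(W in L :\ set0 | (Z \subset W) && P W) F W =
   \sum_(W in L | (Z \subset W) && P W) F W)%N.
Proof.
move=> Z0; apply: eq_bigl => W; rewrite !inE.
case: (boolP (Z \subset W)) => ZW; rewrite ?andbF //=.
by have -> : W != set0 by apply: contraNneq Z0 => W0; rewrite -subset0 -W0.
Qed.

Lemma cnt_prism_over Z s : Z \in L -> Z != set0 ->
  cnt' (pr None Z) s = cnt Z (map predn s).
Proof.
elim: s Z => [//|a s IH] Z ZL Z0; rewrite [LHS]sum_prism.
rewrite subset0 pr_eq0 (negbTE Z0) mul0n add0n.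
rewrite big_pred0 => [|W]; last by rewrite pr_sub // andbF.
rewrite big_pred0 => [|W]; last by rewrite pr_sub // andbF.
rewrite !add0n -[RHS]sum_above //.
apply: eq_big => [W|W /and3P[/setD1P[W0 WL] _ _]]; last exact: IH.
rewrite !inE; case: (eqVneq W set0) => //= W0; case: (boolP (W \in L)) => //= WL.
rewrite pr_sub // pr_rank ?W0 //=; congr (_ && _).
have : (0 < r W)%N by rewrite lt0n (fl_rank_eq0 FL).
by case: a => [|a]; rewrite addn1 //; case: (r W).
Qed.

Lemma cnt_prism_base b Z s : Z \in L -> Z != set0 ->
  cnt' (pr (Some b) Z) s = shift_count L r Z s.
Proof.
elim: s Z => [|a s IH] Z ZL Z0; first by rewrite /shift_count big_ord1.
rewrite shift_count_cons [LHS]sum_prism subset0 pr_eq0 (negbTE Z0) mul0n add0n.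
rewrite addnC; congr addn.
  rewrite -[RHS]sum_above //; apply: eq_big => [W|W /and3P[/setD1P[W0 WL] _ _]].
    rewrite !inE; case: (eqVneq W set0) => //= W0; case: (boolP (W \in L)) => //= WL.
    rewrite pr_sub // pr_rank ?W0 //=; congr (_ && _).
    have : (0 < r W)%N by rewrite lt0n (fl_rank_eq0 FL).
    by case: a => [|a]; rewrite addn1 //; case: (r W).
  exact: cnt_prism_over.
have other c : c != b -> (\sum_(W in L :\ set0 | (pr (Some b) Z \subset pr (Some c) W)
    && (r' (pr (Some c) W) == a)) cnt' (pr (Some c) W) s = 0)%N.
  rewrite eq_sym -(inj_eq Some_inj) => /negbTE cb; rewrite big_pred0 // => W.
  by rewrite pr_sub // cb andbF.
have this : (\sum_(W in L :\ set0 | (pr (Some b) Z \subset pr (Some b) W)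
    && (r' (pr (Some b) W) == a)) cnt' (pr (Some b) W) s =
  \sum_(W in L | (Z \subset W) && (r W == a)) shift_count L r W s)%N.
  rewrite -[RHS]sum_above //; apply: eq_big => [W|W /and3P[/setD1P[W0 WL] _ _]].
    rewrite !inE; case: (eqVneq W set0) => //= W0; case: (boolP (W \in L)) => //= WL.
    by rewrite pr_sub // pr_rank ?W0 //= addn0 eqxx.
  exact: IH.
by case: b other this IH => other this IH; rewrite this other // ?addn0.
Qed.

(** [shift_count] includes the chains in which every face is raised. Doubling is right for the
    others; a chain of prisms only counts once, and not at all if it starts with a vertex, a = 0.
    Terms are placed so as to avoid subtraction in [nat]. *)
Lemma cnt_prism_set0 a s :
  (cnt' set0 (a.+1 :: s) + 2 * cnt set0 (map predn (a.+1 :: s)) =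
   2 * shift_count L r set0 (a.+1 :: s) +
   (0 < a) * cnt set0 (map predn (a.+1 :: s)))%N.
Proof.
rewrite shift_count_cons [cnt' _ _]sum_prism sub0set (fl_rank0 FL') mul0n add0n.
have base b : (\sum_(W in L :\ set0 | (set0 \subset pr (Some b) W)
    && (r' (pr (Some b) W) == a.+1)) cnt' (pr (Some b) W) s =
  \sum_(W in L | (set0 \subset W) && (r W == a.+1)) shift_count L r W s)%N.
  apply: eq_big => [W|W /and3P[/setD1P[W0 WL] _ _]]; last exact: cnt_prism_base.
  rewrite !inE !sub0set; have [->|W0] := eqVneq W set0.
    by rewrite (fl_rank0 FL) andbF.
  by case: (boolP (W \in L)) => //= WL; rewrite pr_rank ?W0 //= addn0.
rewrite !base.
have -> : (\sum_(W in L :\ set0 | (set0 \subset pr None W)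
    && (r' (pr None W) == a.+1)) cnt' (pr None W) s =
  (0 < a) * cnt set0 (map predn (a.+1 :: s)))%N.
  case: a {base} => [|a].
    rewrite mul0n big_pred0 // => W; rewrite !inE sub0set.
    have [//|W0] := eqVneq W set0; case: (boolP (W \in L)) => //= WL.
    by rewrite pr_rank ?W0 //= addn1 eqSS (fl_rank_eq0 FL) // (negbTE W0).
  rewrite mul1n; apply: eq_big => [W|W /and3P[/setD1P[W0 WL] _ _]]; last exact: cnt_prism_over.
  rewrite !inE !sub0set; have [->|W0] := eqVneq W set0.
    by rewrite (fl_rank0 FL) andbF.
  by case: (boolP (W \in L)) => //= WL; rewrite pr_rank ?W0 //= addn1.
rewrite [map _ _]/= succnK; set x := (_ * _)%N; move: x.
set y := cnt set0 _; move: y; set z := (\sum_(W in L | _) _)%N; move: z => z y x; lia.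
Qed.

Lemma flag_function_prism n p : r setT = n.+1 ->
  flag_function L' r' n.+1 p = prism_op n (flag_function L r n) p.
Proof.
move=> rT; have e := shift_count_ranks FL rT p.
have e0 : (cnt set0 (map predn (ranks n.+1 p)))%:R =
  flag_function L r n (p \o succn) by rewrite count_ranks_pred.
rewrite /prism_op; set S := \sum_(_ < _) _ in e *.
have -> : S = (shift_count L r set0 (ranks n.+1 p))%:R - flag_function L r n (p \o succn).
  by rewrite e; lra.
rewrite -e0 /flag_function.
case E: (ranks n.+1 p) => [|[|a] s].
- have -> : p 0%N = false by move: E; rewrite /ranks /=; case: (p 0%N).
  by rewrite /shift_count big_ord1 /= mul1r subrr mulr0 addr0.
- have z : 0%N \in ranks n.+1 p by rewrite E mem_head.
  by case/mapP: z.
have -> : ~~ p 0%N = (0 < a)%N.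
  move: E; rewrite /ranks /=; case: (boolP (p 0%N)) => [_ [<-]//|p0 E].
  have : a.+1 \in [seq i.+1 | i <- iota 1 n & p i] by rewrite E mem_head.
  by move=> /mapP[i]; rewrite mem_filter mem_iota => /andP[_ /andP[i0 _]] [->].
have := cnt_prism_set0 a s => /(congr1 (fun k : nat => k%:R : int)).
rewrite natrD [X in _ = X]natrD !natrM => e'; apply: (addIr (2%:R * (cnt set0 (map predn (a.+1 :: s)))%:R)).
by rewrite e'; lra.
Qed.

End Prism.

(** * Coefficients of flag polynomials *)

(* The inverse of [flag_composition n]: the set {n - w_1, n - w_1 - w_2, ...}
   listed in increasing order. *)
Fixpoint partial_differences (n : nat) (w : seq nat) : seq nat :=
  if w is x :: w' then rcons (partial_differences (n - x) w') (n - x)%N else [::].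

Local Notation pd := partial_differences.
Local Notation pos := (filter (leq 1)).

Lemma pd_cat n u v : pd n (u ++ v) = pd (n - sumn u) v ++ pd n u.
Proof.
elim: u n => [|x u IH] n /=; first by rewrite subn0 cats0.
by rewrite IH subnDA rcons_cat.
Qed.

Lemma head_pd n w : head n (pd n w) = (n - sumn w)%N.
Proof.
elim: w n => [|x w IH] n /=; first by rewrite subn0.
by rewrite subnDA -IH; case: (pd (n - x) w).
Qed.

Lemma size_pd n w : size (pd n w) = size w.
Proof. by elim: w n => //= x w IH n; rewrite size_rcons IH. Qed.

Lemma flag_composition_rcons n s x :
  flag_composition n (rcons s x) = (n - x)%N :: flag_composition x s.
Proof.
case: s => [//|a s] /=; rewrite -[rcons (rcons s x) n]cats1 pairmap_cat /=.
by rewrite cats1 rev_rcons last_rcons.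
Qed.

Lemma pdK n w : (sumn w <= n)%N -> flag_composition n (pd n w) = w.
Proof.
elim: w n => [//|x w IH] n /= h; rewrite flag_composition_rcons IH; last by lia.
by rewrite subKn // (leq_trans _ h) ?leq_addr.
Qed.

Lemma sorted_rcons_prefix (s : seq nat) x n :
  sorted ltn (rcons (rcons s x) n) -> sorted ltn (rcons s x).
Proof. by rewrite -[rcons (rcons s x) n]cats1 => /cat_sorted2[]. Qed.

Lemma sorted_rcons_last (s : seq nat) x n :
  sorted ltn (rcons (rcons s x) n) -> (x < n)%N.
Proof. by rewrite -2!cats1 -catA => /cat_sorted2[_] /= /andP[]. Qed.

Lemma flag_compositionK n s : sorted ltn (rcons s n) ->
  pd n (flag_composition n s) = s.
Proof.
elim/last_ind: s n => [//|s x IH] n sn.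
have xn := sorted_rcons_last sn.
by rewrite flag_composition_rcons /= subKn ?IH ?(ltnW xn) // (sorted_rcons_prefix sn).
Qed.

Lemma pd_leq n w x : x \in pd n w -> (n - sumn w <= x <= n)%N.
Proof.
elim: w n => [//|y w IH] n /=; rewrite mem_rcons inE => /predU1P[->|/IH]; lia.
Qed.

Lemma sorted_pd n w : is_composition w -> (sumn w <= n)%N ->
  sorted ltn (rcons (pd n w) n).
Proof.
elim: w n => [//|x w IH] n /= /andP[x0 w0] h.
have h' : (sumn w <= n - x)%N by lia.
move: (IH _ w0 h'); case: (pd _ w) => [|a s] /=; first by rewrite andbT; lia.
rewrite !rcons_path !last_rcons => -> /=; lia.
Qed.

(** A vanishing part repeats the element produced just before it; at the front this is n, hence the
    n on both sides. *)
Lemma mem_pd_pos n w x : (x \in n :: pd n (pos w)) = (x \in n :: pd n w).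
Proof.
elim: w n => [//|y w IH] n /=; case: (posnP y) => [->|y0] /=.
  rewrite subn0 IH !inE mem_rcons inE; by case: eqP.
have := IH (n - y)%N; rewrite !inE !mem_rcons !inE => ->.
by [].
Qed.

Lemma sumn_pos w : sumn (pos w) = sumn w.
Proof. by elim: w => //= -[|x] w IH //=; rewrite IH. Qed.

Lemma is_composition_pos w : is_composition (pos w).
Proof. exact: filter_all. Qed.

Lemma is_composition_flag n s : sorted ltn (rcons s n) ->
  is_composition (flag_composition n s).
Proof.
elim/last_ind: s n => [//|s x IH] n; rewrite flag_composition_rcons /=.
move=> h; rewrite subn_gt0 (sorted_rcons_last h) /=; apply: IH.
exact: sorted_rcons_prefix h.
Qed.

Lemma sumn_flag_composition n s : sorted ltn (rcons s n) ->
  (sumn (flag_composition n s) <= n)%N.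
Proof.
elim/last_ind: s n => [//|s x IH] n; rewrite flag_composition_rcons /= => h.
have := IH x; rewrite (sorted_rcons_prefix h) => /(_ isT).
by have := sorted_rcons_last h; lia.
Qed.

Lemma sorted_ord_filter n (p : pred 'I_n) :
  sorted ltn [seq val i | i <- enum 'I_n & p i].
Proof.
rewrite sorted_map; apply: sorted_filter; first by move=> ? ? ?; exact: ltn_trans.
have : sorted ltn [seq val i | i <- enum 'I_n].
  by rewrite val_enum_ord iota_ltn_sorted.
by rewrite sorted_map.
Qed.

Section Elements.

Variable n : nat.
Implicit Types (S : {set 'I_n}) (w : seq nat).

Lemma sorted_elements S : sorted ltn (elements S).
Proof.
by rewrite /elements {1}/enum_mem -enumT; exact: sorted_ord_filter.
Qed.

Lemma mem_elements S (i : 'I_n) : ((i : nat) \in elements S) = (i \in S).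
Proof. by rewrite mem_map ?mem_enum //; exact: val_inj. Qed.

Lemma elements_lt S x : x \in elements S -> (x < n)%N.
Proof. by move=> /mapP[i _ ->]; exact: ltn_ord. Qed.

Lemma sorted_elements_rcons S : sorted ltn (rcons (elements S) n).
Proof.
have := sorted_elements S; have := @elements_lt S.
case: (elements S) => [//|a s] h /= sa; rewrite rcons_path sa /= h //.
exact: mem_last.
Qed.

Lemma elements_eq S s : sorted ltn s -> {in s, forall x, (x < n)%N} ->
  (forall i : 'I_n, ((i : nat) \in s) = (i \in S)) -> elements S = s.
Proof.
move=> ss sn sS; apply: (irr_sorted_eq ltn_trans ltnn (sorted_elements S) ss) => x.
apply/idP/idP => [xS|xs].
  by have := elements_lt xS => xn; move: xS; rewrite -[x]/(val (Ordinal xn)) mem_elements sS.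
by have := sn x xs => xn; move: xs; rewrite -[x]/(val (Ordinal xn)) mem_elements sS.
Qed.

Lemma elements_pred (p : pred nat) :
  elements [set i : 'I_n | p i] = [seq i <- iota 0 n | p i].
Proof.
apply: elements_eq => [|x|i].
- exact: (sorted_filter ltn_trans _ (iota_ltn_sorted _ _)).
- by rewrite mem_filter mem_iota add0n => /and3P[].
- by rewrite mem_filter mem_iota add0n in_set ltn_ord !andbT.
Qed.

(* Vanishing parts of w only repeat elements or contribute n, which is dropped. *)
Definition support_set w : {set 'I_n} := [set i : 'I_n | (i : nat) \in pd n w].

Lemma elements_support_set w : (sumn w <= n)%N ->
  elements (support_set w) = pd n (pos w).
Proof.
move=> wn; have srt := sorted_pd (is_composition_pos w).
rewrite sumn_pos in srt; have {}srt := srt _ wn.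
have lt x : x \in pd n (pos w) -> (x < n)%N.
  move: srt; rewrite (sorted_pairwise ltn_trans) pairwise_rcons => /andP[/allP h _].
  exact: h.
apply: elements_eq => // [|i].
  by move: srt; rewrite -cats1 => /cat_sorted2[].
rewrite inE; have := mem_pd_pos n w i.
by rewrite !inE (ltn_eqF (ltn_ord i)).
Qed.

End Elements.

Section Coefficients.

Variable m : nat.
Implicit Types (mon : 'X_{1..m}) (w : seq nat).

Lemma mdeg_sumn mon : mdeg mon = sumn mon.
Proof. by rewrite /mdeg sumnE. Qed.

Lemma mnm_seq mon : mon = [seq mon i | i <- enum 'I_m] :> seq nat.
Proof.
apply: (@eq_from_nth _ 0%N); first by rewrite size_map size_enum_ord size_tuple.
move=> i; rewrite size_tuple => im.
by rewrite (nth_map (Ordinal im)) ?size_enum_ord // (mnm_nth 0%N) nth_enum_ord.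
Qed.

Let supp mon : seq 'I_m := [seq i <- enum 'I_m | (0 < mon i)%N].

Lemma pos_mnm mon : pos mon = [seq mon i | i <- supp mon].
Proof. by rewrite {1}mnm_seq filter_map. Qed.

Lemma sorted_supp mon : sorted ltn [seq val i | i <- supp mon].
Proof.
exact: sorted_ord_filter.
Qed.

Let weight (w : seq nat) (l : (size w).-tuple 'I_m) : 'X_{1..m} :=
  (\sum_(i < size w) (U_(tnth l i) *+ nth 0%N w i))%MM.

Lemma weightE w (l : (size w).-tuple 'I_m) j :
  weight l j = (\sum_(i < size w) (tnth l i == j) * nth 0 w i)%N.
Proof.
by rewrite /weight mnm_sumE; apply: eq_bigr => i _; rewrite mulmnE mnm1E.
Qed.

Lemma weight_tnth w (l : (size w).-tuple 'I_m) i : uniq l ->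
  weight l (tnth l i) = nth 0%N w i.
Proof.
move=> /tuple_uniqP inj; rewrite weightE (bigD1 i) //= eqxx mul1n big1 ?addn0 //.
by move=> k ki; rewrite (inj_eq inj) (negbTE ki).
Qed.

Lemma weight_notin w (l : (size w).-tuple 'I_m) j : j \notin l -> weight l j = 0%N.
Proof.
move=> jl; rewrite weightE big1 // => i _.
by case: eqP => // e; rewrite -e mem_tnth in jl.
Qed.

(** An exponent vector determines its increasing index tuple, namely its support, and the parts,
    namely its nonzero exponents. So the monomials of one quasi-symmetric monomial are distinct and
    have coefficient 1. *)
Lemma weight_eq w (l : (size w).-tuple 'I_m) mon : is_composition w ->
    sorted ltn [seq val i | i <- l] ->
  (weight l == mon) = (w == pos mon) && (tval l == supp mon).
Proof.
move=> w0 sl; have ul : uniq l.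
  by rewrite -(map_inj_uniq val_inj) (sorted_uniq ltn_trans ltnn).
apply/eqP/andP => [<-|[/eqP ew /eqP el]].
  have el : tval l = supp (weight l).
    apply: (inj_map val_inj).
    apply: (irr_sorted_eq ltn_trans ltnn sl (sorted_supp _)) => x.
    apply/mapP/mapP => -[j jl ->]; exists j => //.
      rewrite mem_filter mem_enum andbT; have /tnthP[i ->] := jl.
      by rewrite weight_tnth // (allP w0) // mem_nth.
    by move: jl; rewrite mem_filter => /andP[+ _]; apply: contraLR => /weight_notin->.
  split; last exact/eqP.
  rewrite pos_mnm -el; apply/eqP/(@eq_from_nth _ 0%N); first by rewrite size_map size_tuple.
  move=> i iw; rewrite -[i]/(val (Ordinal iw)) -(weight_tnth _ ul).
  by rewrite (nth_map (tnth l (Ordinal iw))) ?size_tuple // -tnth_nth.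
apply/mnmP => j; have [|jl] := boolP (j \in l).
  move=> /tnthP[i ->]; rewrite weight_tnth // {1}ew pos_mnm -el.
  by rewrite (nth_map (tnth l i)) ?size_tuple // -tnth_nth.
rewrite weight_notin //; move: jl; rewrite -[j \in l]/(j \in tval l).
by rewrite el mem_filter mem_enum andbT lt0n negbK => /eqP.
Qed.

Lemma mcoeff_qsym w mon : is_composition w ->
  (qsym_monomial m w)@_mon = (w == pos mon)%:R.
Proof.
move=> w0; rewrite /qsym_monomial raddf_sum /=.
rewrite (eq_bigr (fun l : (size w).-tuple 'I_m => ((w == pos mon) && (tval l == supp mon))%:R)); last first.
  by move=> l sl; rewrite mprodXnE mcoeffX -weight_eq.
have [ew|_] := eqVneq w (pos mon); last by rewrite big1.
have sz : size (supp mon) == size w by rewrite ew pos_mnm size_map.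
rewrite (bigD1 (Tuple sz)) ?sorted_supp //= eqxx big1 ?addr0 // => l /andP[_ ne].
by rewrite -val_eqE in ne; rewrite (negbTE ne).
Qed.

End Coefficients.

Section FlagPolynomial.

Variables (m n : nat).
Hypothesis nm : (n <= m)%N.
Implicit Types (S : {set 'I_n}) (g : {set 'I_n} -> int).

Lemma elements0 : elements (set0 : {set 'I_n}) = [::].
Proof. by rewrite /elements enum_set0. Qed.

Lemma elements_nil S : elements S = [::] -> S = set0.
Proof.
move=> h; apply/setP => i; by rewrite inE -mem_elements h.
Qed.

(** The default n in [head] and the value 1 of the empty monomial let the empty set join the sum; n
    <= m keeps every [S] below the cutoff. *)
Lemma flag_polynomialE g : flag_polynomial m g =
  \sum_(S : {set 'I_n}) ((qsym_monomial m (flag_composition n (elements S)))%:P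
    * 'X^(head n (elements S))) *~ g S.
Proof.
rewrite /flag_polynomial (minn_idPr nm) (bigD1 set0) //=; congr (_ + _).
  rewrite elements0 /= /qsym_monomial (big_pred1 [tuple]) => [|l].
    by rewrite big_ord0 mul1r.
  by rewrite !tuple0.
rewrite (exchange_big_dep predT) //= [RHS]big_mkcond; apply: eq_bigr => S _ /=.
under eq_bigl do rewrite eq_sym.
rewrite big_nat1_eq ltnS lt0n cards_eq0 -[(#|S| <= n)%N]/(#|S| <= n)%N.
have -> : (#|S| <= n)%N by rewrite -[X in (_ <= X)%N]card_ord max_card.
case: eqVneq => //= S0; congr (_ * 'X^_ *~ _).
by case E: (elements S) => //; rewrite (elements_nil E) eqxx in S0.
Qed.

Lemma coef_flag_polynomial g b (mon : 'X_{1..m}) :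
  ((flag_polynomial m g)`_b)@_mon =
  if (b + mdeg mon == n)%N then g (support_set n mon) else 0.
Proof.
rewrite flag_polynomialE coef_sum raddf_sum /=.
have term S : ((((qsym_monomial m (flag_composition n (elements S)))%:P
    * 'X^(head n (elements S))) *~ g S)`_b)@_mon =
  if (head n (elements S) == b) && (flag_composition n (elements S) == pos mon)
  then g S else 0.
  rewrite coefMrz raddfMz /= coefCM coefXn eq_sym.
  case: eqVneq => _; last by rewrite mulr0 raddf0 mul0rz.
  rewrite mulr1 mcoeff_qsym ?is_composition_flag ?sorted_elements_rcons //.
  by case: eqP => _; rewrite ?mul0rz // intz.
rewrite (eq_bigr _ (fun S _ => term S)) -big_mkcond /= mdeg_sumn.
have E S : flag_composition n (elements S) = pos mon -> elements S = pd n (pos mon).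
  by move=> <-; rewrite flag_compositionK // sorted_elements_rcons.
have deg S : flag_composition n (elements S) = pos mon ->
    (sumn mon <= n)%N /\ (head n (elements S) + sumn mon = n)%N.
  move=> e; have := head_pd n (pos mon); rewrite -(E S e) sumn_pos => hd.
  suff h : (sumn mon <= n)%N by split=> //; rewrite hd subnK.
  by rewrite -sumn_pos -e sumn_flag_composition ?sorted_elements_rcons.
case: eqP => [bn|bn]; last first.
  rewrite big_pred0 // => S; apply/negP => /andP[/eqP hb /eqP e].
  by case: bn; rewrite -hb; exact: (deg S e).2.
have mn : (sumn mon <= n)%N by rewrite -bn leq_addl.
rewrite (big_pred1 (support_set n mon)) // => S /=.
apply/andP/eqP => [[_ /eqP e]|->].
  by apply/setP => i; rewrite -[LHS]mem_elements (E S e) -elements_support_set // mem_elements.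
rewrite elements_support_set // head_pd pdK sumn_pos //; split=> //.
by rewrite -[X in (X - _)%N]bn addnK.
Qed.

End FlagPolynomial.

Lemma eq_big_nonzero (T : eqType) (V : nmodType) (s1 s2 : seq T) (F : T -> V) :
  uniq s1 -> uniq s2 -> (forall x, F x != 0 -> (x \in s1) && (x \in s2)) ->
  \sum_(x <- s1) F x = \sum_(x <- s2) F x.
Proof.
move=> u1 u2 h.
have red s : \sum_(x <- s) F x = \sum_(x <- [seq x <- s | F x != 0]) F x.
  rewrite big_filter [RHS]big_mkcond; apply: eq_bigr => x _.
  by case: eqP => // ->.
rewrite red [RHS]red; apply/perm_big/uniq_perm; rewrite ?filter_uniq // => x.
rewrite !mem_filter; case: (boolP (F x != 0)) => // /h /andP[-> ->].
by [].
Qed.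

(** * Coefficients after substitution *)

Section Substitution.

Variable m : nat.
Implicit Types (G : {poly {mpoly int[m]}}) (M mon : 'X_{1..m}).

Lemma substE a (t : 'I_m -> {poly {mpoly int[m]}}) G :
  subst a t G = \sum_(b < size G) \sum_(mon <- msupp G`_b)
    ((G`_b)@_mon)%:~R * ((\prod_i t i ^+ mon i) * a ^+ b).
Proof.
rewrite /subst /map_poly horner_poly; apply: eq_bigr => b _.
by rewrite /mmap mulr_suml; apply: eq_bigr => mon _; rewrite -mulrA.
Qed.

(** The substitutions at hand send a monomial to a signed monomial or to 0, so a coefficient of the
    image is a signed sum over the finitely many preimages, listed by [r]. *)
Lemma coef_subst a (t : 'I_m -> {poly {mpoly int[m]}})
    (sgn : nat -> 'X_{1..m} -> int) (beta : nat -> 'X_{1..m} -> nat)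
    (mu : nat -> 'X_{1..m} -> 'X_{1..m}) G B M (r : seq (nat * 'X_{1..m})) :
  (forall b mon, (\prod_i t i ^+ mon i) * a ^+ b =
     ((sgn b mon)%:~R * 'X_[mu b mon])%:P * 'X^(beta b mon)) ->
  uniq r ->
  (forall b mon, ((b, mon) \in r) =
     [&& sgn b mon != 0, beta b mon == B & mu b mon == M]) ->
  ((subst a t G)`_B)@_M = \sum_(x <- r) sgn x.1 x.2 * (G`_x.1)@_x.2.
Proof.
move=> H ur rE.
pose F (x : nat * 'X_{1..m}) : int :=
  if (beta x.1 x.2 == B) && (mu x.1 x.2 == M) then sgn x.1 x.2 * (G`_x.1)@_x.2 else 0.
have term b mon : ((((G`_b)@_mon)%:~R * ((\prod_i t i ^+ mon i) * a ^+ b))`_B)@_M =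
    F (b, mon).
  rewrite H /F /= mulrA -(rmorph_int (@polyC _)) -rmorphM /= mulrA -intrM.
  rewrite coefCM coefXn eq_sym; case: eqP => _ /=; last by rewrite mulr0 mcoeff0.
  rewrite mulr1 mulrzl raddfMz /= mcoeffX.
  by case: eqP => _; rewrite ?mul0rz ?intz // mulrC.
rewrite substE coef_sum raddf_sum /=.
under eq_bigr => b _.
  rewrite coef_sum raddf_sum /=.
  under eq_bigr => mon _ do rewrite term.
  over.
rewrite -(big_mkord xpredT (fun b => \sum_(mon <- msupp G`_b) F (b, mon))) /=.
rewrite /index_iota subn0 -(big_allpairs_dep (h := fun b mon => (b, mon)) (r2 := fun b => msupp G`_b) (F := F)).
have -> : \sum_(x <- r) sgn x.1 x.2 * (G`_x.1)@_x.2 = \sum_(x <- r) F x.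
  by apply: eq_big_seq => -[b mon]; rewrite rE /F /= => /and3P[_ -> ->].
apply: eq_big_nonzero => //.
  apply: allpairs_uniq_dep => [|b _|]; [exact: iota_uniq|exact: msupp_uniq|].
  by move=> [b mon] [b' mon'] _ _ /= [-> ->].
move=> [b mon]; rewrite /F /= rE; case: ifP => _; last by rewrite eqxx.
rewrite mulf_eq0 negb_or => /andP[-> c0]; rewrite !andbT.
apply/allpairsPdep; exists b, mon; split=> //.
  rewrite mem_iota add0n /=; case: (ltnP b (size G)) => // /(nth_default 0) e.
  by rewrite e mcoeff0 eqxx in c0.
by rewrite mcoeff_msupp.
Qed.

Definition mset mon (q : 'I_m) (a : nat) : 'X_{1..m} :=
  [multinom if l == q then a else mon l | l < m].

Lemma msetE mon q a l : mset mon q a l = if l == q then a else mon l.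
Proof. by rewrite mnmE. Qed.

Lemma prod_mset mon q a : 'X_[mset mon q a] =
  'X_q ^+ a * \prod_(l | l != q) 'X_l ^+ mon l :> {mpoly int[m]}.
Proof.
rewrite mpolyXE_id (bigD1 q) //= msetE eqxx; congr (_ * _).
by apply: eq_bigr => l /negbTE lq; rewrite msetE lq.
Qed.

Lemma prod_tvar (P : pred 'I_m) mon :
  \prod_(l | P l) tvar l ^+ mon l = (\prod_(l | P l) 'X_l ^+ mon l)%:P.
Proof. by rewrite rmorph_prod; apply: eq_bigr => l _; rewrite /tvar rmorphXn. Qed.

Definition merge_exponents (q q' : 'I_m) mon : 'X_{1..m} :=
  mset (mset mon q (mon q + mon q')) q' 0.

Definition split_exponent (q q' : 'I_m) M k : 'X_{1..m} :=
  mset (mset M q (M q - k)) q' k.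

Section Sign.

Variables q q' : 'I_m.
Hypothesis qq' : q != q'.

Lemma prod_sign mon :
  \prod_l (if l == q' then - tvar q else tvar l) ^+ mon l =
  (((-1) ^+ mon q')%:~R * 'X_[merge_exponents q q' mon])%:P :> {poly {mpoly int[m]}}.
Proof.
have -> : 'X_[merge_exponents q q' mon] = 'X_q ^+ (mon q + mon q') *
    \prod_(l | (l != q') && (l != q)) 'X_l ^+ mon l :> {mpoly int[m]}.
  rewrite /merge_exponents prod_mset expr0 mul1r (bigD1 q) //= msetE eqxx.
  by congr (_ * _); apply: eq_bigr => l /andP[_ /negbTE lq]; rewrite msetE lq.
rewrite (bigD1 q') //= eqxx (bigD1 q) //= (negbTE qq').
rewrite (eq_bigr (fun l => tvar l ^+ mon l)) ?prod_tvar; last first.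
  by move=> l /andP[/negbTE ->].
rewrite /tvar (exprNn ('X_q)%:P) !rmorphM /= !rmorphXn /= !rmorphN1 exprD -!mulrA.
by rewrite (mulrCA (_ ^+ mon q)).
Qed.

Lemma coef_subst_sign G B M : M q' = 0%N ->
  ((subst 'X (fun l => if l == q' then - tvar q else tvar l) G)`_B)@_M =
  \sum_(k < (M q).+1) (-1) ^+ k * (G`_B)@_(split_exponent q q' M k).
Proof.
move=> Mq'.
rewrite (@coef_subst _ _ (fun _ mon => (-1) ^+ mon q') (fun b _ => b)
  (fun _ => merge_exponents q q') _ _ _
  [seq (B, split_exponent q q' M k) | k <- iota 0 (M q).+1]).
- rewrite big_map -(big_mkord xpredT (fun k => (-1) ^+ k *
    (G`_B)@_(split_exponent q q' M k))) /index_iota subn0.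
  by apply: eq_bigr => k _ /=; rewrite msetE eqxx.
- by move=> b mon; rewrite prod_sign.
- rewrite map_inj_uniq ?iota_uniq // => k k' /(congr1 (fun x : nat * 'X_{1..m} => x.2 q')) /=.
  by rewrite !msetE eqxx.
move=> b mon; rewrite signr_eq0 [~~ _]/= andTb; apply/mapP/andP => [[k]|].
  rewrite mem_iota add0n ltnS => kM [-> ->]; split=> //.
  apply/eqP/mnmP => l; rewrite !msetE eqxx (negbTE qq') eqxx subnK //.
  by case: eqP => [->//|_]; case: eqP => [->|].
move=> [/eqP -> /eqP <-]; exists (mon q').
  by rewrite mem_iota !msetE (negbTE qq') eqxx /= ltnS leq_addl.
congr pair; apply/mnmP => l; rewrite !msetE (negbTE qq') eqxx addnK.
by case: eqP => [->//|_]; case: eqP => [->|].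
Qed.

Lemma prod_zero mon :
  \prod_l (if (l == q) || (l == q') then 0 else tvar l) ^+ mon l =
  (((mon q == 0%N) && (mon q' == 0%N) : nat)%:~R * 'X_[mon])%:P :> {poly {mpoly int[m]}}.
Proof.
have -> : 'X_[mon] = 'X_q' ^+ mon q' * ('X_q ^+ mon q *
    \prod_(l | (l != q') && (l != q)) 'X_l ^+ mon l) :> {mpoly int[m]}.
  by rewrite mpolyXE_id (bigD1 q') //= (bigD1 q).
rewrite (bigD1 q') //= eqxx orbT (bigD1 q) //= eqxx orTb !expr0n.
rewrite (eq_bigr (fun l => tvar l ^+ mon l)) ?prod_tvar; last first.
  by move=> l /andP[/negbTE -> /negbTE ->].
case: eqP => [->|_]; last by rewrite andbF !mul0r rmorph0.
case: eqP => [->|_]; last by rewrite !(mul0r, mulr0) rmorph0.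
by rewrite !expr0 !mul1r.
Qed.

Lemma coef_subst_zero G B M :
  ((subst 'X (fun l => if (l == q) || (l == q') then 0 else tvar l) G)`_B)@_M =
  if (M q == 0%N) && (M q' == 0%N) then (G`_B)@_M else 0.
Proof.
rewrite (@coef_subst _ _ (fun _ mon => ((mon q == 0%N) && (mon q' == 0%N) : nat)%:Z)
  (fun b _ => b) (fun _ mon => mon) _ _ _
  (if (M q == 0%N) && (M q' == 0%N) then [:: (B, M)] else [::])).
- case: ifP => MM; last by rewrite big_nil.
  by rewrite big_seq1 /= MM mul1r.
- by move=> b mon; rewrite prod_zero.
- by case: ifP.
move=> b mon; apply/idP/and3P => [|[+ /eqP -> /eqP <-]].
  by case: ifP => // MM; rewrite inE => /eqP[-> ->]; rewrite MM.
by case: (_ && _); rewrite ?inE.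
Qed.

(** Neither side involves the variable of index [q'], and the sides agree on monomials free of [q]
    as well. What is left are the monomials in [q] but not [q'], absent on the right. *)
Lemma sign_equation_coef G :
  subst 'X (fun l => if l == q' then - tvar q else tvar l) G =
  subst 'X (fun l => if (l == q) || (l == q') then 0 else tvar l) G <->
  forall B M, M q' = 0%N -> (0 < M q)%N ->
    \sum_(k < (M q).+1) (-1) ^+ k * (G`_B)@_(split_exponent q q' M k) = 0.
Proof.
split=> [E B M Mq' Mq|H].
  by rewrite -coef_subst_sign // E coef_subst_zero Mq' (gtn_eqF Mq).
apply/polyP => B; apply/mpolyP => M; rewrite [RHS]coef_subst_zero.
have [Mq'|Mq'] := eqVneq (M q') 0%N; last first.
  rewrite andbF (@coef_subst _ _ (fun _ mon => (-1) ^+ mon q') (fun b _ => b)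
    (fun _ => merge_exponents q q') _ _ _ [::]) ?big_nil // => b mon.
    by rewrite prod_sign.
  rewrite in_nil; apply/esym/negP => /and3P[_ _ /eqP e].
  by rewrite -e msetE eqxx in Mq'.
rewrite coef_subst_sign // andbT; have [Mq|Mq] := posnP (M q); last first.
  by rewrite H // (gtn_eqF Mq).
rewrite Mq big_ord1 expr0 mul1r; congr (_@__).
apply/mnmP => l; rewrite !msetE Mq; case: eqP => [->//|_].
by case: eqP => [->|].
Qed.

End Sign.

Section Euler.

Variable q : 'I_m.

Lemma prod_last (f : {poly {mpoly int[m]}}) mon :
  \prod_l (if l == q then f else tvar l) ^+ mon l =
  f ^+ mon q * ('X_[mset mon q 0])%:P.
Proof.
rewrite (bigD1 q) //= eqxx prod_mset expr0 mul1r -prod_tvar; congr (_ * _).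
by apply: eq_bigr => l /negbTE->.
Qed.

(** On the left the exponent e of the last variable is absorbed by alpha, so alpha^B collects
    alpha^(B - e) t_q^e, with the sign of (- alpha)^(B - e). Monomials in the last variable occur on
    neither side. *)
Lemma euler_equation_coef G :
  subst (- 'X) (fun l => if l == q then 'X else tvar l) G =
  subst 'X (fun l => if l == q then 0 else tvar l) G <->
  forall B M, M q = 0%N ->
    \sum_(e < B.+1) (-1) ^+ (B - e) * (G`_(B - e))@_(mset M q e) = (G`_B)@_M.
Proof.
have cr B M : ((subst 'X (fun l => if l == q then 0 else tvar l) G)`_B)@_M =
    if M q == 0%N then (G`_B)@_M else 0.
  rewrite (@coef_subst _ _ (fun _ mon => (mon q == 0%N : nat)%:Z)
    (fun b _ => b) (fun _ mon => mon) _ _ _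
    (if M q == 0%N then [:: (B, M)] else [::])).
  - case: ifP => MM; last by rewrite big_nil.
    by rewrite big_seq1 /= MM mul1r.
  - move=> b mon; rewrite prod_last expr0n; case: eqP => [e|_]; last by rewrite !mul0r.
    congr (_ * _); rewrite !mul1r; congr ('X_[_])%:P; apply/mnmP => l.
    by rewrite msetE; case: eqP => // ->.
  - by case: ifP.
  move=> b mon; apply/idP/and3P => [|[+ /eqP -> /eqP <-]].
    by case: ifP => // MM; rewrite inE => /eqP[-> ->]; rewrite MM.
  by case: (mon q == 0%N); rewrite ?inE.
have tE b mon : (\prod_l (if l == q then 'X else tvar l) ^+ mon l) * (- 'X) ^+ b =
    (((-1) ^+ b)%:~R * 'X_[mset mon q 0])%:P * 'X^(b + mon q) :> {poly {mpoly int[m]}}.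
  rewrite prod_last (exprNn 'X) exprD !rmorphM /= !rmorphXn /= !rmorphN1.
  by rewrite [LHS]mulrC ['X^(mon q) * _]mulrC mulrACA.
have cl B M : M q = 0%N ->
    ((subst (- 'X) (fun l => if l == q then 'X else tvar l) G)`_B)@_M =
    \sum_(e < B.+1) (-1) ^+ (B - e) * (G`_(B - e))@_(mset M q e).
  move=> Mq; rewrite (@coef_subst _ _ (fun b _ => (-1) ^+ b)
    (fun b mon => (b + mon q)%N) (fun _ mon => mset mon q 0) _ _ _
    [seq ((B - e)%N, mset M q e) | e <- iota 0 B.+1]) //.
  - by rewrite big_map -(big_mkord xpredT (fun e => (-1) ^+ (B - e) *
      (G`_(B - e))@_(mset M q e))) /index_iota subn0.
  - rewrite map_inj_uniq ?iota_uniq // => e e' /(congr1 (fun x : nat * 'X_{1..m} => x.2 q)) /=.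
    by rewrite !msetE eqxx.
  move=> b mon; rewrite signr_eq0 [~~ _]/= andTb; apply/mapP/andP => [[e]|].
    rewrite mem_iota add0n ltnS => eB [-> ->]; rewrite msetE eqxx subnK //; split=> //.
    by apply/eqP/mnmP => l; rewrite !msetE; case: eqP => // ->.
  move=> [/eqP <- /eqP <-]; exists (mon q); first by rewrite mem_iota ltnS leq_addl.
  rewrite addnK; congr pair; apply/mnmP => l; rewrite !msetE.
  by case: eqP => // ->.
split=> [E B M Mq|H]; first by rewrite -cl // E cr Mq.
apply/polyP => B; apply/mpolyP => M; rewrite [RHS]cr.
have [Mq|Mq] := eqVneq (M q) 0%N; first by rewrite cl // H.
rewrite (@coef_subst _ _ _ _ _ _ _ _ [::] tE) ?big_nil // => b mon.
rewrite in_nil; apply/esym/negP => /and3P[_ _ /eqP e].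
by rewrite -e msetE eqxx in Mq.
Qed.

End Euler.

End Substitution.

(** * From the equations to the relations and back *)

Lemma ds_interval n (G : pred nat -> int) (p : pred nat) a b :
  determined_below n G -> (a < b <= n)%N -> p a -> (b == n) || p b ->
  \sum_(a.+1 <= j < b) (-1) ^+ (j - a.+1) * G (adjoin p j) =
    (1 - (-1) ^+ (b - a.+1)) * G p <->
  \sum_(k < (b - a).+1) (-1) ^+ k * G (adjoin p (a + k)%N) = 0.
Proof.
move=> lG /andP[ab bn] pa pb.
have [d E] : exists d, b = (a + d.+1)%N by exists (b - a.+1)%N; lia.
(* The extreme terms adjoin a and b, which are already present or equal to the invisible n. They are
   both [G p] up to sign and make up the right side of the relation. *)
subst b; rewrite addKn big_ord_recl big_ord_recr /= addn0 expr0 mul1r.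
have -> : G (adjoin p a) = G p by apply: lG => i _; rewrite /adjoin; case: eqP => [->|].
have -> : G (adjoin p (a + bump 0 d)) = G p.
  apply: lG => i; rewrite /adjoin /bump /= add1n; case: eqP => [->|//].
  by move=> lt; case/orP: pb => [/eqP e|-> //]; rewrite e ltnn in lt.
have -> : (a + d.+1 = d + a.+1)%N by lia.
have shift (F : nat -> int) :
    \sum_(a.+1 <= j < d + a.+1) F j = \sum_(i < d) F (i + a.+1)%N.
  by rewrite -{1}[a.+1]add0n big_addn addnK big_mkord.
rewrite addnK shift.
have -> : \sum_(i < d) (-1) ^+ bump 0 i * G (adjoin p (a + bump 0 i)) =
    - \sum_(i < d) (-1) ^+ (i + a.+1 - a.+1) * G (adjoin p (i + a.+1)%N).
  rewrite -sumrN; apply: eq_bigr => i _; rewrite /bump /= add1n addnK exprS mulN1r mulNr.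
  by rewrite !addnS [(a + i)%N]addnC.
rewrite exprS mulN1r.
move: (\sum_(_ < _) _) (G p) ((-1) ^+ d) => S x s.
split=> h; lra.
Qed.

(** The lower end is -1, which can be adjoined to no set; so only the upper end term is absorbed and
    [G p] remains on the right. *)
Lemma ds_initial n (G : pred nat -> int) (p : pred nat) b :
  determined_below n G -> (b <= n)%N -> (b == n) || p b ->
  \sum_(0 <= j < b) (-1) ^+ (j - 0) * G (adjoin p j) = (1 - (-1) ^+ (b - 0)) * G p <->
  \sum_(k < b.+1) (-1) ^+ k * G (adjoin p k) = G p.
Proof.
move=> lG bn pb; rewrite big_ord_recr /= big_mkord.
have -> : G (adjoin p b) = G p.
  apply: lG => i; rewrite /adjoin; case: eqP => [->|//] lt.
  by case/orP: pb => [/eqP e|-> //]; rewrite e ltnn in lt.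
rewrite (eq_bigr (fun j : 'I_b => (-1) ^+ j * G (adjoin p j))) ?subn0; last first.
  by move=> j _; rewrite subn0.
move: (\sum_(_ < _) _) (G p) ((-1) ^+ b) => S x s.
split=> h; lra.
Qed.

Definition set_function (n : nat) (g : {set 'I_n} -> int) (p : pred nat) : int :=
  g [set i : 'I_n | p i].

Lemma set_function_local n (g : {set 'I_n} -> int) : determined_below n (set_function g).
Proof.
by move=> p q pq; rewrite /set_function; congr g; apply/setP => i; rewrite !inE pq.
Qed.

Lemma mem_hi n u : ((n - sumn u == n) || ((n - sumn u)%N \in pd n u))%N.
Proof.
rewrite -head_pd; case: (pd n u) => [|x s] /=; first by rewrite eqxx.
by rewrite mem_head orbT.
Qed.

Section Equations.

Variables (m n : nat).
Hypothesis nm : (n <= m)%N.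
Variable g : {set 'I_n} -> int.

Let G := set_function g.
Let lG : determined_below n G := @set_function_local n g.

Lemma coef_flagE b (mon : 'X_{1..m}) :
  ((flag_polynomial m g)`_b)@_mon =
  if (b + sumn mon == n)%N then G (mem (pd n mon)) else 0.
Proof. by rewrite coef_flag_polynomial // mdeg_sumn. Qed.

Lemma split_exponent_seq (q q' : 'I_m) (M : 'X_{1..m}) k : val q' = q.+1 ->
  split_exponent q q' M k =
  take q M ++ [:: (M q - k)%N, k & drop q.+2 M] :> seq nat.
Proof.
move=> qq'; have q'm : (q.+1 < m)%N by rewrite -qq' ltn_ord.
apply: (@eq_from_nth _ 0%N).
  by rewrite size_tuple size_cat /= size_take size_drop !size_tuple ltn_ord /=; lia.
move=> i; rewrite size_tuple => im.
rewrite -(mnm_nth 0%N _ (Ordinal im)) !msetE (mnm_nth 0%N M (Ordinal im)).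
rewrite nth_cat size_take size_tuple ltn_ord -!val_eqE /= qq' {im}.
case: ltngtP => iq.
- by rewrite nth_take // ltn_eqF //; lia.
- have [j ->] : exists j, i = (q + j.+1)%N by exists (i - q.+1)%N; lia.
  rewrite addKn /= addnS eqSS; case: j => [|j]; first by rewrite addn0 eqxx.
  by rewrite /= nth_drop gtn_eqF ?addSn ?addnS ?addSn // ltnS leq_addr.
- by rewrite iq subnn ltn_eqF.
Qed.

(** Moving k units of exponent from one variable to the next leaves all partial sums unchanged
    except the one in between: a single element runs from n - |u| - N up to n - |u|. *)
Lemma pd_split u v N k : (k <= N)%N ->
  pd n (u ++ [:: (N - k)%N, k & v]) =
  pd (n - sumn u - N) v ++ [:: (n - sumn u - N)%N, (n - sumn u - (N - k))%N & pd n u].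
Proof.
move=> kN; rewrite pd_cat /= -!cats1 -!catA /=.
by have -> : (n - sumn u - (N - k) - k = n - sumn u - N)%N by lia.
Qed.

Lemma pd_split0 u v N : pd n (u ++ [:: N, 0%N & v]) =
  pd (n - sumn u - N) v ++ [:: (n - sumn u - N)%N, (n - sumn u - N)%N & pd n u].
Proof. by have := @pd_split u v N 0 isT; rewrite subn0. Qed.

Lemma G_split u v N k : (k <= N)%N -> (sumn u + N <= n)%N ->
  G (mem (pd n (u ++ [:: (N - k)%N, k & v]))) =
  G (adjoin (mem (pd n (u ++ [:: N, 0%N & v]))) (n - sumn u - N + k)).
Proof.
move=> kN h; apply: lG => i il; rewrite /adjoin /= pd_split //.
rewrite pd_split0 !mem_cat !inE.
have -> : (n - sumn u - (N - k) = n - sumn u - N + k)%N by lia.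
case: (i == _ + k)%N; case: (i \in pd _ v); case: (i == _ - N)%N => //=.
Qed.

Lemma sum_split u v N : (sumn u + N <= n)%N -> (0 < N)%N ->
  \sum_(k < N.+1) (-1) ^+ k * G (mem (pd n (u ++ [:: (N - k)%N, nat_of_ord k & v]))) = 0 <->
  \sum_((n - sumn u - N).+1 <= j < n - sumn u) (-1) ^+ (j - (n - sumn u - N).+1) *
     G (adjoin (mem (pd n (u ++ [:: N, 0%N & v]))) j) =
  (1 - (-1) ^+ (n - sumn u - (n - sumn u - N).+1)) *
     G (mem (pd n (u ++ [:: N, 0%N & v]))).
Proof.
move=> h N0; rewrite (@ds_interval n) //.
- have -> : (n - sumn u - (n - sumn u - N) = N)%N by lia.
  under eq_bigr => k _ do rewrite G_split // -1?ltnS //.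
  by [].
- lia.
- by rewrite /= pd_split0 mem_cat !inE eqxx orbT.
- have := mem_hi n u; rewrite /= pd_split0.
  by rewrite mem_cat !inE => /orP[->//|->]; rewrite !orbT.
Qed.

Lemma ds_sign_equations : dehn_sommerville n G -> sign_equations (flag_polynomial m g).
Proof.
move=> ds q q' qq'.
have nqq' : q != q' by rewrite -val_eqE qq' neq_ltn ltnSn.
apply/(sign_equation_coef nqq') => B M Mq' Mq.
set u := take q M; set v := drop q.+2 M; set N := M q in Mq *.
have MS k : split_exponent q q' M k = u ++ [:: (N - k)%N, k & v] :> seq nat.
  exact: split_exponent_seq.
have sumS k : (k <= N)%N -> sumn (split_exponent q q' M k) = (sumn u + N + sumn v)%N.
  by move=> kN; rewrite MS sumn_cat /=; lia.
under eq_bigr => k _ do rewrite coef_flagE sumS -1?ltnS // MS.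
case: eqP => [e|_]; last by rewrite big1 // => k _; rewrite mulr0.
apply/sum_split => //; first by lia.
have E0 := pd_split0 u v N.
apply: ds.
- lia.
- by rewrite /= E0 mem_cat !inE eqxx !orbT.
- have := mem_hi n u; rewrite /= E0 mem_cat !inE => /orP[->//|->].
  by rewrite !orbT.
move=> x /andP[x1 x2]; rewrite /= E0 mem_cat !inE !negb_or.
apply/and4P; split; try (by apply/eqP; lia).
  by apply/negP => /pd_leq; lia.
by apply/negP => /pd_leq; lia.
Qed.

Lemma eq_subst a t t' (H : {poly {mpoly int[m]}}) : t =1 t' -> subst a t H = subst a t' H.
Proof.
move=> tt'; rewrite !substE; apply: eq_bigr => b _; apply: eq_bigr => mon _.
by congr (_ * (_ * _)); apply: eq_bigr => i _; rewrite tt'.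
Qed.

Lemma euler_equationE (q : 'I_m) (H : {poly {mpoly int[m]}}) : q.+1 = m ->
  euler_equation H <-> forall B (M : 'X_{1..m}), M q = 0%N ->
    \sum_(e < B.+1) (-1) ^+ (B - e) * (H`_(B - e))@_(mset M q e) = (H`_B)@_M.
Proof.
move=> qm; rewrite -euler_equation_coef /euler_equation.
have E l : (l.+1 == m) = (l == q :> nat) by rewrite -{1}qm eqSS.
rewrite (@eq_subst (- 'X) _ (fun l => if l == q then 'X else tvar l)) => [|l].
  by rewrite (@eq_subst 'X _ (fun l => if l == q then 0 else tvar l)) // => l; rewrite E.
by rewrite E.
Qed.

Lemma euler_sum u B : (B + sumn u = n)%N ->
  \sum_(e < B.+1) (-1) ^+ (B - e) * G (mem (pd n (u ++ [:: nat_of_ord e]))) =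
    G (mem (pd n (u ++ [:: 0%N]))) <->
  \sum_(0 <= j < B) (-1) ^+ (j - 0) * G (adjoin (mem (pd n u)) j) =
    (1 - (-1) ^+ (B - 0)) * G (mem (pd n u)).
Proof.
move=> Bu; have uB : (n - sumn u = B)%N by rewrite -Bu addnK.
have Bn : (B == n) || (B \in pd n u) by rewrite -{1 2}uB mem_hi.
have GE e : (e <= B)%N -> G (mem (pd n (u ++ [:: e]))) = G (adjoin (mem (pd n u)) (B - e)).
  move=> eB; apply: lG => i _; rewrite /adjoin /= pd_cat /= uB inE.
  by [].
rewrite (@ds_initial n) //; last by rewrite -Bu leq_addr.
rewrite GE // subn0.
have -> : G (adjoin (mem (pd n u)) B) = G (mem (pd n u)).
  apply: lG => i; rewrite /adjoin; case: eqP => [->|//] lt.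
  by case/orP: Bn => [/eqP e|/= -> //]; rewrite e ltnn in lt.
(* The exponent e of the last variable corresponds to the adjoined element B - e. *)
rewrite (reindex_inj rev_ord_inj) /=.
under eq_bigr => e _.
  rewrite GE ?subSS ?leq_subr // subKn -1?ltnS //.
  over.
by [].
Qed.

Lemma mset_last (q : 'I_m) (M : 'X_{1..m}) e : q.+1 = m ->
  mset M q e = take q M ++ [:: e] :> seq nat.
Proof.
move=> qm; apply: (@eq_from_nth _ 0%N).
  by rewrite size_tuple size_cat /= size_take !size_tuple ltn_ord addn1.
move=> i; rewrite size_tuple => im.
rewrite -(mnm_nth 0%N _ (Ordinal im)) !msetE (mnm_nth 0%N M (Ordinal im)).
rewrite nth_cat size_take size_tuple ltn_ord -!val_eqE /=.
have iq : (i <= q)%N by rewrite -ltnS qm.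
case: ltngtP iq => // [iq _|-> _]; first by rewrite nth_take.
by rewrite subnn.
Qed.

Lemma ds_euler_equation : (0 < m)%N -> dehn_sommerville n G ->
  euler_equation (flag_polynomial m g).
Proof.
move=> m0 ds; have qm : (m.-1 < m)%N by rewrite prednK.
have qE : (Ordinal qm).+1 = m by rewrite /= prednK.
apply/(euler_equationE _ qE) => B M Mq; set u := take (Ordinal qm) M.
have M0 : M = u ++ [:: 0%N] :> seq nat.
  rewrite -(mset_last M 0 qE); congr (_ : seq nat).
  congr multinom_val; apply/mnmP => l; rewrite msetE.
  by case: eqP => // ->.
under eq_bigr => e _ do rewrite coef_flagE mset_last // sumn_cat /= addn0
  (addnC (sumn _)) addnA subnK -1?ltnS // -/u.
rewrite coef_flagE M0 sumn_cat /= !addn0.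
case: (eqVneq (B + sumn u)%N n) => [e|ne]; last first.
  by rewrite big1 // => e _; rewrite mulr0.
apply/euler_sum => //; have uB : (n - sumn u = B)%N by rewrite -e addnK.
apply: ds => //; first by rewrite -e leq_addr.
  by have := mem_hi n u; rewrite uB.
by move=> x /andP[_ xB]; apply/negP => /= /pd_leq; rewrite uB; lia.
Qed.

Lemma seq_mnm (l : seq nat) : (size l <= m)%N ->
  [multinom nth 0%N l i | i < m] = l ++ nseq (m - size l) 0%N :> seq nat.
Proof.
move=> lm; apply: (@eq_from_nth _ 0%N).
  by rewrite size_tuple size_cat size_nseq subnKC.
move=> i; rewrite size_tuple => im.
rewrite -(mnm_nth 0%N _ (Ordinal im)) mnmE nth_cat /=.
by case: ltnP => // il; rewrite nth_nseq if_same nth_default.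
Qed.

Lemma pos_nseq0 k : pos (nseq k 0%N) = [::].
Proof. by elim: k. Qed.

Lemma mem_pd_eq w w' i : pos w = pos w' -> (i < n)%N -> (i \in pd n w) = (i \in pd n w').
Proof.
move=> e lt; have := mem_pd_pos n w i; rewrite e mem_pd_pos !inE.
by rewrite (ltn_eqF lt) /= => ->.
Qed.

Lemma size_filter_iota (p : pred nat) a k : (size [seq i <- iota a k | p i] <= k)%N.
Proof. by rewrite size_filter -{2}(size_iota a k) count_size. Qed.

Lemma sorted_filter_iota (p : pred nat) a k :
  sorted ltn (rcons [seq i <- iota a k | p i] (a + k)%N).
Proof.
have : sorted ltn (rcons (iota a k) (a + k)%N).
  by have := iota_ltn_sorted a k.+1; rewrite -addn1 iotaD cats1.
rewrite !(sorted_pairwise ltn_trans) !pairwise_rcons => /andP[/allP h1 h2].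
rewrite pairwise_filter // andbT; apply/allP => i.
by rewrite mem_filter => /andP[_ /h1].
Qed.

(** Each relation is read off at one monomial, whose exponents are the successive gaps of [p] from n
    downwards, padded with zeros. Across the interval in question the gap is followed by a zero
    exponent, on which the substitution acts. *)
Lemma equations_ds : (0 < m)%N -> sign_equations (flag_polynomial m g) ->
  euler_equation (flag_polynomial m g) -> dehn_sommerville n G.
Proof.
move=> m0 se ee p [|a] k /andP[lk kn] hlo hk hp.
  have [->|k0] := posnP k; first by rewrite big_nil subnn expr0 subrr mul0r.
  pose s := [seq i <- iota k (n - k) | p i].
  have ss : sorted ltn (rcons s n) by have := sorted_filter_iota p k (n - k); rewrite subnKC.
  pose w := flag_composition n s.
  have sw : size w = size s by rewrite -(flag_compositionK ss) size_pd.
  have wn : (n - sumn w = k)%N.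
    rewrite -head_pd (flag_compositionK ss) /s; move: hk.
    have [->|kn'] := eqVneq k n; first by rewrite subnn.
    have -> : (n - k = (n - k).-1.+1)%N by lia.
    by move=> /= ->.
  have wn' : (k + sumn w = n)%N.
    by have := sumn_flag_composition ss; rewrite -/w; lia.
  have qm : (m.-1 < m)%N by rewrite prednK.
  have qE : (Ordinal qm).+1 = m by rewrite /= prednK.
  (* As k > 0, fewer than n gaps lie above k, so the last variable is free. *)
  have szw : (size w < m)%N.
    by rewrite sw; have := size_filter_iota p k (n - k); rewrite -/s; lia.
  pose M := [multinom nth 0%N w i | i < m].
  have MS : M = w ++ nseq (m - size w) 0%N :> seq nat by apply: seq_mnm; exact: ltnW.
  set u := take (Ordinal qm) M.
  have Mq : M (Ordinal qm) = 0%N by rewrite mnmE nth_default //= -ltnS prednK.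
  have M0 : M = u ++ [:: 0%N] :> seq nat.
    rewrite -(mset_last M 0 qE); congr multinom_val; apply/mnmP => l; rewrite msetE.
    by case: eqP => // ->.
  have sumu : sumn u = sumn w.
    by have := congr1 sumn M0; rewrite MS !sumn_cat sumn_nseq mul0n /= !addn0.
  have posu : pos u = pos w.
    by have := congr1 pos M0; rewrite MS !filter_cat pos_nseq0 !cats0.
  have := (euler_equationE _ qE).1 ee k M Mq.
  under eq_bigr => e _ do rewrite coef_flagE mset_last // sumn_cat /= addn0
    (addnC (sumn _)) addnA subnK -1?ltnS // -/u sumu wn' eqxx.
  rewrite coef_flagE M0 sumn_cat /= !addn0 sumu wn' eqxx.
  rewrite euler_sum ?sumu //.
  have memu i : (i < n)%N -> (i \in pd n u) = p i.
    move=> lt; rewrite (@mem_pd_eq u w) // (flag_compositionK ss) mem_filter mem_iota.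
    rewrite subnKC // lt andbT; case: (leqP k i) => ki; first by rewrite andbT.
    by rewrite andbF; apply/esym/negbTE/hp.
  have -> : G (mem (pd n u)) = G p by apply: lG.
  rewrite (eq_bigr (fun j => (-1) ^+ (j - 0) * G (adjoin p j))) // => j _.
  by congr (_ * _); apply: lG => i lt; rewrite /adjoin /= memu.
have [ek|ak] := eqVneq a.+1 k; first by rewrite ek big_geq // subnn expr0 subrr mul0r.
have {ak}lk : (a.+1 < k)%N by rewrite ltn_neqAle ak.
pose s1 := [seq i <- iota 0 a | p i].
pose s2 := [seq i <- iota k (n - k) | p i].
have ss1 : sorted ltn (rcons s1 a) by exact: sorted_filter_iota.
have ss2 : sorted ltn (rcons s2 n) by have := sorted_filter_iota p k (n - k); rewrite subnKC.
pose u := flag_composition n s2; pose v := flag_composition a s1.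
have su : size u = size s2 by rewrite -(flag_compositionK ss2) size_pd.
have sv : size v = size s1 by rewrite -(flag_compositionK ss1) size_pd.
have un : (n - sumn u = k)%N.
  rewrite -head_pd (flag_compositionK ss2) /s2; move: hk.
  have [->|kn'] := eqVneq k n; first by rewrite subnn.
  have -> : (n - k = (n - k).-1.+1)%N by lia.
  by move=> /= ->.
have un' : (k + sumn u = n)%N.
  by have := sumn_flag_composition ss2; rewrite -/u; lia.
have va : (sumn v <= a)%N := sumn_flag_composition ss1.
pose l := u ++ [:: (k - a)%N, 0%N & v].
(* Now k >= a + 2, so at least one index strictly between a and k is missing from [p]; this makes
   room for the extra zero exponent within n <= m variables. *)
have lm : (size l <= m)%N.
  rewrite size_cat /= su sv; have := size_filter_iota p 0 a.
  by have := size_filter_iota p k (n - k); rewrite -/s1 -/s2; lia.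
pose M := [multinom nth 0%N l i | i < m].
have MS : M = u ++ [:: (k - a)%N, 0%N & v ++ nseq (m - size l) 0%N] :> seq nat.
  by rewrite seq_mnm // -catA.
have q'm : ((size u).+1 < m)%N by move: lm; rewrite size_cat /=; lia.
pose q := Ordinal (ltnW q'm); pose q' := Ordinal q'm.
have nqq' : q != q' by rewrite -val_eqE neq_ltn ltnSn.
have Mq : M q = (k - a)%N by rewrite mnmE /l nth_cat ltnn subnn.
have Mq' : M q' = 0%N by rewrite mnmE /l nth_cat ltnNge leqnSn /= subSn // subnn.
have tk : take q M = u by rewrite MS take_size_cat.
have dr : drop q.+2 M = v ++ nseq (m - size l) 0%N.
  by rewrite MS -[q.+2]/(2 + size u)%N -drop_drop drop_size_cat //= drop0.
set v' := v ++ nseq (m - size l) 0%N in MS dr.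
have sv' : sumn v' = sumn v by rewrite sumn_cat sumn_nseq mul0n addn0.
have ka : (0 < k - a)%N by lia.
(* This power of alpha completes the total degree to n. *)
have := (sign_equation_coef nqq' (flag_polynomial m g)).1 (se q q' erefl) (a - sumn v)%N M Mq'.
rewrite Mq => /(_ ka).
have sumS j : (j <= k - a)%N ->
    (a - sumn v + sumn (split_exponent q q' M j) == n)%N.
  by move=> jk; rewrite split_exponent_seq // tk dr Mq sumn_cat /= sv'; lia.
under eq_bigr => j _ do
  rewrite coef_flagE sumS -1?ltnS // split_exponent_seq // tk dr Mq.
rewrite sum_split //; last by lia.
have -> : (n - sumn u - (k - a) = a)%N by lia.
rewrite un.
have memu i : (i < n)%N -> (i \in pd n (u ++ [:: (k - a)%N, 0%N & v'])) = p i.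
  move=> lt; rewrite (@mem_pd_eq _ l) //; last first.
    by rewrite /l /v' !filter_cat /= filter_cat pos_nseq0 cats0.
  rewrite pd_split0 mem_cat !inE un (_ : k - (k - a) = a)%N; last by lia.
  rewrite !flag_compositionK // !mem_filter !mem_iota subnKC // lt andbT add0n.
  have [ia|ia|->] := ltngtP i a; rewrite ?orbT //=.
  - by rewrite andbT (_ : (k <= i)%N = false) ?andbF ?orbF //; lia.
  - rewrite andbF /=; case: (leqP k i) => ki; first by rewrite andbT.
    by rewrite andbF; apply/esym/negbTE/hp; rewrite ia.
have -> : G (mem (pd n (u ++ [:: (k - a)%N, 0%N & v']))) = G p by apply: lG.
rewrite (eq_bigr (fun j => (-1) ^+ (j - a.+1) * G (adjoin p j))) // => j _.
by congr (_ * _); apply: lG => i lt; rewrite /adjoin /= memu.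
Qed.

End Equations.

Lemma sum_nat_ord n lo k (F : nat -> int) : (k <= n)%N ->
  \sum_(lo <= j < k) F j = \sum_(j < n | (lo <= j < k)%N) F j.
Proof.
move=> kn; rewrite (big_nat_widen _ _ _ _ _ kn) big_geq_mkord.
by apply: eq_bigl => j; rewrite andbC.
Qed.

Lemma bayer_billera_sum n (g : {set 'I_n} -> int) (S : {set 'I_n}) (p : pred nat) lo k :
  (forall i : 'I_n, p i = (i \in S)) -> (lo <= k <= n)%N ->
  (\sum_(j < n | (lo%:Z - 1 < (val j)%:Z < k%:Z)%R)
      (-1) ^+ absz ((val j)%:Z - (lo%:Z - 1) - 1)%R * g (j |: S) =
    (1 - (-1) ^+ absz (k%:Z - (lo%:Z - 1) - 1)%R) * g S) <->
  \sum_(lo <= j < k) (-1) ^+ (j - lo) * set_function g (adjoin p j) =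
  (1 - (-1) ^+ (k - lo)) * set_function g p.
Proof.
move=> pS /andP[lk kn]; rewrite (sum_nat_ord _ _ kn).
have -> : set_function g p = g S.
  by congr g; apply/setP => i; rewrite inE pS.
have -> : absz (k%:Z - (lo%:Z - 1) - 1)%R = (k - lo)%N by lia.
rewrite (eq_big (fun j : 'I_n => (lo <= j < k)%N)
   (fun j : 'I_n => (-1) ^+ (j - lo) * set_function g (adjoin p j))) //.
  by move=> j /=; lia.
move=> j /= jlk; congr (_ ^+ _ * _); first by lia.
by congr g; apply/setP => i; rewrite !inE /adjoin pS.
Qed.

Lemma bayer_billera_ds n (g : {set 'I_n} -> int) :
  bayer_billera g <-> dehn_sommerville n (set_function g).
Proof.
split=> [bb p lo k /andP[lk kn] hlo hk hp|ds S i k iS kS ik hS].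
  have [elk|nlk] := eqVneq lo k; first by rewrite elk big_geq // subnn expr0 subrr mul0r.
  pose S := [set x : 'I_n | p x].
  apply/(@bayer_billera_sum n g S) => //; [by move=> i; rewrite inE|by rewrite lk|].
  apply: bb.
  - case: lo hlo lk {nlk hp} => [_ _|a /= pa ak]; first exact: Or31.
    by apply: Or33; exists (Ordinal (leq_trans ak kn)); rewrite ?inE //=; lia.
  - case: (ltngtP k n) kn hk => // [lt _ /= pk|-> _ _]; last exact: Or32.
    by apply: Or33; exists (Ordinal lt); rewrite ?inE.
  - lia.
  - move=> a; rewrite inE => pa; apply/negP => /= h.
    have : ~~ p a by apply: hp; lia.
    by rewrite pa.
have [k' ek kn] : exists2 k', k = k'%:Z & (k' <= n)%N.
  case: kS => [ek|ek|[a _ ek]]; last first.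
  - by exists (val a) => //; exact: ltnW (ltn_ord a).
  - by exists n.
  case: iS => [ei|ei|[a _ /= ei]]; lia.
have [lo el lk] : exists2 lo, i = lo%:Z - 1 & (lo <= k')%N.
  case: iS => [ei|ei|[a _ /= ei]].
  - by exists 0%N; [lia|].
  - by exists n.+1; lia.
  - by exists a.+1; lia.
subst i k; pose p : pred nat := fun x => x \in elements S.
have pS (a : 'I_n) : p a = (a \in S) by exact: mem_elements.
apply/(bayer_billera_sum g pS); first by rewrite lk.
apply: ds; rewrite ?lk //.
- case: lo iS lk {ik hS} => //= a [e|e|[b bS /= e]] lk; try by lia.
  have -> : a = b by lia.
  by rewrite pS.
- case: kS => [|e|[b bS /= e]]; first by lia.
    have -> : k' = n by lia.
    by rewrite eqxx.
  have -> : k' = b by lia.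
  by rewrite pS bS orbT.
move=> x xlk; apply/negP => xS.
have xn := elements_lt xS.
have := hS (Ordinal xn); rewrite -pS => /(_ xS) /negP; apply => /=; lia.
Qed.

(** * Homogeneous quasi-symmetric polynomials as flag polynomials *)

Section QuasiSymmetric.

Variables (m n : nat).
Hypothesis nm : (n <= m)%N.

Lemma flag_polynomial_qsym (g : {set 'I_n} -> int) : Qsym_alpha (flag_polynomial m g).
Proof.
move=> b; exists [seq (if b == head n (elements A) then g A else 0,
  flag_composition n (elements A)) | A <- enum {: {set 'I_n}}].
split; first by apply/allP => cw /mapP[S _ ->]; rewrite is_composition_flag ?sorted_elements_rcons.
rewrite big_map big_enum /= flag_polynomialE // coef_sum; apply: eq_bigr => S _.
rewrite coefMrz coefCM coefXn.
case: eqP => _; last by rewrite mulr0 mul0rz scale0r.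
by rewrite mulr1 -scaler_int intz.
Qed.

Lemma flag_polynomial_homogeneous (g : {set 'I_n} -> int) :
  homogeneous_of_degree n (flag_polynomial m g).
Proof.
move=> b mon; rewrite coef_flag_polynomial //.
by case: (eqVneq (b + mdeg mon)%N n) => // _; rewrite eqxx.
Qed.

Lemma qsym_coef_pos (f : {mpoly int[m]}) (mon mon' : 'X_{1..m}) :
  Qsym f -> pos mon = pos mon' -> f@_mon = f@_mon'.
Proof.
move=> [s [/allP sc ->]] e; rewrite !raddf_sum /=; apply: eq_big_seq => cw cws.
by rewrite !mcoeffZ !mcoeff_qsym ?sc // e.
Qed.

(** By quasi-symmetry a coefficient depends only on the list of nonzero exponents, so g(S) may be
    read at the monomial that has them in the first variables. *)
Lemma qsym_flag_polynomial (H : {poly {mpoly int[m]}}) :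
  Qsym_alpha H -> homogeneous_of_degree n H ->
  exists g : {set 'I_n} -> int, H = flag_polynomial m g.
Proof.
move=> qH hH.
exists (fun S => (H`_(head n (elements S)))@_
  [multinom nth 0%N (flag_composition n (elements S)) i | i < m]).
apply/polyP => b; apply/mpolyP => mon; rewrite coef_flag_polynomial //.
case: eqP => [e|ne]; last first.
  by apply/eqP; apply: contraT => /hH.
rewrite mdeg_sumn in e.
have sn : (sumn mon <= n)%N by rewrite -e leq_addl.
have eb : (n - sumn mon = b)%N by rewrite -e addnK.
rewrite elements_support_set // head_pd sumn_pos eb pdK ?sumn_pos //.
apply: qsym_coef_pos => //; rewrite seq_mnm; last first.
  by rewrite size_filter (leq_trans (count_size _ _)) // size_tuple.
by rewrite filter_cat pos_nseq0 cats0 filter_id.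
Qed.

End QuasiSymmetric.

From mathcomp Require Import finmap freeg classical_sets functions cardinality reals.
Local Open Scope classical_set_scope.

(** * Face lattices of polytopes *)

Lemma card_fset_set_seq (T : choiceType) (A : set T) (l : seq T) :
  uniq l -> (forall x, A x <-> x \in l) -> #|` fset_set A| = size l.
Proof.
move=> ul Al; have -> : A = [set` l] by apply/seteqP; split=> x /= /Al.
have fl : finite_set [set` l] by exact: finite_seq.
apply: perm_size; apply: uniq_perm => [||x]; [exact: fset_uniq|exact: ul|].
by rewrite [LHS]in_fset_set // mem_setE.
Qed.

Section Faces.

Variables (R : realType) (d N : nat) (v : 'I_N.+1 -> 'rV[R]_d).
Implicit Types (Z W : {set 'I_N.+1}).

(** An affine functional b - x c is linear on the vectors (v_i, 1); this brings faces under the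
    results on vector configurations. *)
Definition homogenization : 'M[R]_(N.+1, d + 1) :=
  \matrix_i row_mx (v i) (1 : 'rV[R]_1).

Local Notation V := homogenization.
Local Notation L := (zero_sets V).
Local Notation r := (rk V).

Definition dot (x : 'rV[R]_d) (c : 'cV[R]_d) : R := (x *m c) 0 0.

Lemma dot_sum (w : 'I_N.+1 -> R) c :
  dot (\sum_i w i *: v i) c = \sum_i w i * dot (v i) c.
Proof.
rewrite /dot mulmx_suml summxE; apply: eq_bigr => i _.
by rewrite -scalemxAl mxE.
Qed.

Lemma ev_homogenization c (b : R) i :
  ev V (col_mx (- c) (const_mx b)) i = b - dot (v i) c.
Proof.
rewrite ev_row rowK mul_row_col mxE mulmxN mxE addrC; congr (_ - _).
by rewrite mul1mx mxE.
Qed.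

Lemma face_setsP Z : reflect
  (exists c, exists b, (forall i, dot (v i) c <= b) /\
     forall i, (i \in Z) = (dot (v i) c == b)) (Z \in L).
Proof.
apply: (iffP (zero_setsP V Z)) => [[l [l0 lZ]]|[c [b [cb cZ]]]]; last first.
  exists (col_mx (- c) (const_mx b)); split=> i; rewrite ev_homogenization.
    by rewrite subr_ge0.
  by rewrite cZ subr_eq0 eq_sym.
pose c := - usubmx l; pose b := l (rshift d ord0) 0.
have E i : ev V l i = b - dot (v i) c.
  rewrite -ev_homogenization; congr (ev V _ i); rewrite opprK -[LHS]vsubmxK.
  congr col_mx; apply/matrixP => x y; rewrite !ord1 !mxE.
  by congr (l _ _); apply/val_inj.
exists c, b; split=> i; first by rewrite -subr_ge0 -E.
by rewrite lZ E subr_eq0 eq_sym.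
Qed.

Definition sub_conv Z : set 'rV[R]_d :=
  [set x | exists w : 'I_N.+1 -> R,
     [/\ forall i, 0 <= w i, forall i, i \notin Z -> w i = 0,
         \sum_i w i = 1 & x = \sum_i w i *: v i]].

Lemma sub_convT : sub_conv (finset.setT) = conv v.
Proof.
apply/seteqP; split=> x [w]; first by case=> w0 _ w1 ->; exists w.
by case=> w0 w1 ->; exists w; split=> // i; rewrite inE.
Qed.

Lemma sub_conv_vertex Z i : i \in Z -> sub_conv Z (v i).
Proof.
move=> iZ; exists (fun j => (j == i)%:R); split.
- by move=> j; rewrite ler0n.
- by move=> j jZ; rewrite (_ : (j == i) = false) //; apply: contraNF jZ => /eqP->.
- by rewrite (bigD1 i) //= eqxx big1 ?addr0 // => j /negbTE->.
- by rewrite (bigD1 i) //= eqxx scale1r big1 ?addr0 // => j /negbTE->; rewrite scale0r.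
Qed.

Lemma sub_convS Z W : Z \subset W -> sub_conv Z `<=` sub_conv W.
Proof.
move=> /fintype.subsetP ZW x [w [w0 wZ w1 ->]]; exists w; split=> // i iW.
by apply: wZ; apply: contra iW; exact: ZW.
Qed.

Lemma conv_dot_le c (b : R) x : (forall i, dot (v i) c <= b) -> conv v x -> dot x c <= b.
Proof.
move=> cb [w [w0 w1 ->]]; rewrite dot_sum -[b]mul1r -w1 mulr_suml ler_sum // => i _.
by rewrite ler_wpM2l.
Qed.

(** Where the bound is attained, the nonnegative terms w_i (b - v_i c) add up to 0, so all the
    weight sits on [Z]. *)
Lemma supporting_face c (b : R) Z : (forall i, dot (v i) c <= b) ->
    (forall i, (i \in Z) = (dot (v i) c == b)) ->
  conv v `&` [set x | dot x c = b] = sub_conv Z.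
Proof.
move=> cb cZ; apply/seteqP; split=> x.
  move=> [[w [w0 w1 ->]] /= e]; exists w; split=> // i iZ.
  have : \sum_i w i * (b - dot (v i) c) = 0.
    under eq_bigr do rewrite mulrBr.
    by rewrite sumrB -mulr_suml w1 mul1r -dot_sum e subrr.
  move/eqP; rewrite psumr_eq0 => [/allP/(_ i)|j _]; last first.
    by rewrite mulr_ge0 // subr_ge0.
  rewrite mem_index_enum /= mulf_eq0 subr_eq0 eq_sym (eq_sym b) -cZ (negbTE iZ) orbF.
  by move=> /(_ isT)/eqP.
move=> [w [w0 wZ w1 ->]]; split; first by exists w.
rewrite /= dot_sum -[RHS]mul1r -w1 mulr_suml; apply: eq_bigr => i _.
have [|/wZ->] := boolP (i \in Z); last by rewrite !mul0r.
by rewrite cZ => /eqP->.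
Qed.

Lemma is_faceP F : is_face (conv v) F <-> exists2 Z, Z \in L & F = sub_conv Z.
Proof.
split=> [[c [b [cb ->]]]|[Z /face_setsP[c [b [cb cZ]]] ->]]; last first.
  exists c, b; split; first by move=> x; exact: conv_dot_le.
  by rewrite -(supporting_face cb cZ).
have cb' i : dot (v i) c <= b.
  apply: cb; rewrite -sub_convT; apply: sub_conv_vertex; exact: finset.in_setT.
pose Z : {set 'I_N.+1} := [set i | dot (v i) c == b]%SET.
have cZ i : (i \in Z) = (dot (v i) c == b) by rewrite finset.in_set.
exists Z; last by rewrite -(supporting_face cb' cZ).
by apply/face_setsP; exists c, b.
Qed.

(** As a zero set, [W] contains every index whose point lies on its supporting hyperplane, even when
    points repeat or are not vertices. *)
Lemma sub_conv_le Z W : W \in L -> (sub_conv Z `<=` sub_conv W) <-> Z \subset W.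
Proof.
move=> WL; split; last exact: sub_convS.
move: WL => /face_setsP[c [b [cb cW]]] ZW; apply/fintype.subsetP => i iZ.
have : sub_conv W (v i) by apply: ZW; exact: sub_conv_vertex.
by rewrite -(supporting_face cb cW) cW => -[_ /= ->].
Qed.

Lemma sub_conv_inj : {in L &, injective sub_conv}.
Proof.
move=> Z W ZL WL e; apply/eqP; rewrite finset.eqEsubset.
by apply/andP; split; apply/sub_conv_le => //; rewrite e.
Qed.

(** For x in the hull, (x, 1) is a combination of the vectors (v_j, 1) with j in [Z]; the last
    coordinate is right because the weights add up to 1. *)
Lemma rank_le_rk k (X : 'M[R]_(k, d)) Z : affinely_independent X ->
  (forall i, sub_conv Z (row i X)) -> (k <= r Z)%N.
Proof.
move=> /eqP rX XZ; rewrite -[X in (X <= _)%N]rX; apply: mxrankS; apply/row_subP => i.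
have [w [_ wZ w1 e]] := XZ i.
have -> : row i (row_mx X (const_mx 1)) = \sum_j w j *: row j V.
  apply/rowP => j; rewrite summxE [LHS]mxE.
  case: (split_ordP j) => {}j ->; rewrite ?row_mxEl ?row_mxEr.
    have -> : X i j = row i X 0 j by rewrite mxE.
    by rewrite e summxE; apply: eq_bigr => l _; rewrite [RHS]mxE rowK row_mxEl [LHS]mxE.
  rewrite mxE -w1; apply: eq_bigr => l _.
  by rewrite [RHS]mxE rowK row_mxEr mxE !ord1 eqxx mulr1.
apply: summx_sub => j _; have [jZ|/wZ ->] := boolP (j \in Z); last by rewrite scale0r sub0mx.
by rewrite scalemx_sub // (sumsmx_sup j) // genmxE.
Qed.

Lemma exists_affine_basis Z : exists X : 'M[R]_(r Z, d),
  affinely_independent X /\ forall i, sub_conv Z (row i X).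
Proof.
pose A := \matrix_(i < #|Z|) row (enum_val i) V.
have rA : \rank A = r Z.
  apply/eqP; rewrite /rk eqn_leq; apply/andP; split; apply: mxrankS.
    apply/row_subP => i; rewrite rowK (sumsmx_sup (enum_val i)) ?enum_valP //.
    by rewrite genmxE.
  apply/sumsmx_subP => i iZ; rewrite genmxE.
  have -> : row i V = row (enum_rank_in iZ i) A by rewrite [RHS]rowK enum_rankK_in.
  exact: row_sub.
pose f := maxrankfun A.
pose X0 := \matrix_(i < \rank A) v (enum_val (f i)).
have X0P : affinely_independent X0 /\ forall i, sub_conv Z (row i X0).
  split; last by move=> i; rewrite rowK; apply: sub_conv_vertex; exact: enum_valP.
  rewrite /affinely_independent; have := maxrowsub_free A.
  congr (row_free _); apply/row_matrixP => i.
  rewrite row_row_mx row_rowsub !rowK; congr row_mx.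
  by apply/matrixP => x y; rewrite !ord1 !mxE.
by rewrite -rA; exists X0.
Qed.

Lemma aff_dim_sub_conv Z : aff_dim (sub_conv Z) = (r Z)%:Z - 1.
Proof.
rewrite /aff_dim; congr (Posz _ - 1); apply/eqP; rewrite eqn_leq; apply/andP; split.
  by apply/bigmax_leqP => k /asboolP[X [XI XZ]]; exact: rank_le_rk XI XZ.
have lt : (r Z < d.+2)%N.
  by rewrite ltnS -[d.+1]addn1 /rk rank_leq_col.
rewrite (bigD1 (Ordinal lt)) /= ?leq_maxl //.
by apply/asboolP; exact: exists_affine_basis.
Qed.

Lemma face_lattice_faces : face_lattice L r.
Proof.
have L0 : finset.set0 \in L.
  apply/face_setsP; exists 0, 1; have e i : dot (v i) 0 = 0 by rewrite /dot mulmx0 mxE.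
  by split=> i; rewrite e ?ler01 // finset.in_set0 eq_sym oner_eq0.
split=> //.
- exact: zero_sets_setT.
- exact: rk0.
- by move=> Z W ZL _; exact: rk_proper.
- by move=> Z ZL; exact: zero_sets_graded.
Qed.

Lemma eulerian_faces : eulerian L r.
Proof. by move=> Z W; exact: zero_sets_euler. Qed.

(** The duplicate-free list behind [chain_count]; its length gives the cardinality of the set of
    flags. *)
Fixpoint chains Z (s : seq nat) : seq (seq {set 'I_N.+1}) :=
  if s is a :: s' then
    [seq W :: c | W <- [seq W : {set 'I_N.+1} <- enum L | (Z \subset W) && (r W == a)], c <- chains W s']
  else [:: [::]].

Lemma size_chains Z s : size (chains Z s) = chain_count L r Z s.
Proof.
elim: s Z => [//|a s IH] Z; rewrite [chains _ _]/= size_allpairs_dep sumnE big_map.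
rewrite big_filter big_enum_cond; apply: eq_bigr => W _; exact: IH.
Qed.

Lemma uniq_chains Z s : uniq (chains Z s).
Proof.
elim: s Z => [//|a s IH] Z; rewrite [chains _ _]/=.
apply: allpairs_uniq_dep => [|W _|]; [by rewrite filter_uniq ?enum_uniq|exact: IH|].
by move=> [W c] [W' c'] _ _ /= [-> ->].
Qed.

Lemma mem_chains Z s c : (c \in chains Z s) =
  [&& all (mem L) c, path (fun X Y : {set 'I_N.+1} => X \subset Y) Z c & map r c == s].
Proof.
elim: s Z c => [|a s IH] Z c; first by case: c => [|W c] //=; rewrite !andbF.
rewrite [chains _ _]/=; apply/allpairsPdep/idP => [[W [c' [WL c's ->]]]|].
  move: WL; rewrite mem_filter mem_enum => /andP[/andP[ZW /eqP rW] WL].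
  by move: c's; rewrite IH => /and3P[h1 h2 /eqP h3] /=; rewrite WL ZW h1 h2 rW h3 eqxx.
case: c => [|W c]; first by rewrite andbF.
move=> /= /and3P[/andP[WL h1] /andP[ZW h2] /eqP[rW h3]].
exists W, c; split=> //; first by rewrite mem_filter mem_enum ZW rW eqxx.
by rewrite IH h1 h2 h3 eqxx.
Qed.

End Faces.

Section FlagNumbers.

Variables (R : realType) (P : polytope R) (N : nat).
Variable v : 'I_N.+1 -> 'rV[R]_(ambient P).
Hypothesis Pv : points P = conv v.

Local Notation L := (zero_sets (homogenization v)).
Local Notation r := (rk (homogenization v)).

Lemma facesP F : faces P F <-> exists2 Z, Z \in L & F = sub_conv v Z.
Proof. by rewrite /faces Pv is_faceP. Qed.

Lemma polytope_dim_rk : r finset.setT = (polytope_dim P).+1.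
Proof.
rewrite /polytope_dim Pv -sub_convT aff_dim_sub_conv.
have := sub_conv_vertex v (finset.in_setT ord0).
(* [polytope_dim] is an absolute value, so the dimension -1 has to be excluded; this is where a
   polytope having a generating point matters. *)
suff : (0 < r finset.setT)%N by lia.
have FL := face_lattice_faces v.
rewrite lt0n (fl_rank_eq0 FL) ?(flT FL) //.
by apply/finset.set0Pn; exists ord0; rewrite finset.in_setT.
Qed.

Lemma flag_chainsP s c : flag_chains P s c <->
  c \in map (map (sub_conv v)) (chains v finset.set0 (map succn s)).
Proof.
have dims zc : ([seq aff_dim F | F <- map (sub_conv v) zc] = [seq a%:Z | a <- s]) <->
    map r zc = map succn s.
  rewrite -map_comp; elim: zc s => [|Z zc IH] [|a s] //=.
  rewrite aff_dim_sub_conv; split=> [[e /IH->]|[e /IH->]]; congr (_ :: _); lia.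
have srt zc : all (mem L) zc ->
    sorted (fun F G => `[< F `<=` G >]) (map (sub_conv v) zc) =
    path (fun X Y : {set 'I_N.+1} => X \subset Y) finset.set0 zc.
  move=> zL; rewrite path_min_sorted; last by apply/allP => Z _; exact: finset.sub0set.
  rewrite sorted_map; apply: (@eq_in_sorted _ (mem L)) zL => Z W ZL WL /=.
  by apply/asboolP/idP => /sub_conv_le; apply.
split=> [[cF cd cs]|/mapP[zc]].
  have [zc zL ec] : exists2 zc, all (mem L) zc & c = map (sub_conv v) zc.
    elim: c cF {cd cs} => [|F c IH] cF; first by exists [::].
    have [|zc zL ->] := IH; first by move=> G Gc; apply: cF; rewrite inE Gc orbT.
    have /facesP[Z ZL ->] := cF F (mem_head _ _).
    by exists (Z :: zc); rewrite //= zL andbT.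
  rewrite ec; apply: map_f; rewrite mem_chains zL -srt // -ec cs /=.
  by apply/eqP/dims; rewrite -ec.
rewrite mem_chains => /and3P[zL zp /eqP zr] ->; split.
- move=> F /mapP[Z Zz ->]; apply/facesP; exists Z => //.
  exact: (allP zL).
- exact/dims.
- by rewrite srt.
Qed.

Lemma uniq_flag_chains s :
  uniq (map (map (sub_conv v)) (chains v finset.set0 (map succn s))).
Proof.
rewrite map_inj_in_uniq ?uniq_chains // => c c'.
rewrite !mem_chains => /and3P[+ _ _] /and3P[+ _ _].
elim: c c' => [|Z c IH] [|Z' c'] //= /andP[ZL cL] /andP[ZL' cL'] [e /IH->] //.
by rewrite (sub_conv_inj ZL ZL' e).
Qed.

Lemma flag_number_count s :
  flag_number P s = chain_count L r finset.set0 (map succn s).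
Proof.
rewrite /flag_number (card_fset_set_seq (uniq_flag_chains s) (flag_chainsP s)).
by rewrite size_map size_chains.
Qed.

End FlagNumbers.

(** * Dimension and flag numbers are combinatorial invariants *)

Section Invariance.

Variable R : realType.
Implicit Types P Q : polytope R.

Let rank d (F : set 'rV[R]_d) : nat := absz (aff_dim F + 1)%R.

Lemma rank_sub_conv d N (v : 'I_N.+1 -> 'rV[R]_d) Z :
  rank (sub_conv v Z) = rk (homogenization v) Z.
Proof. by rewrite /rank aff_dim_sub_conv; lia. Qed.

Lemma face_aff_dim P F : faces P F -> aff_dim F = (rank F)%:Z - 1.
Proof.
have [N [v Pv]] := polytopeP P.
by move=> /(facesP Pv)[Z _ ->]; rewrite rank_sub_conv aff_dim_sub_conv.
Qed.

Lemma face_rank_lt P F G : faces P F -> faces P G -> F `<=` G -> F <> G ->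
  (rank F < rank G)%N.
Proof.
have [N [v Pv]] := polytopeP P.
move=> /(facesP Pv)[Z ZL ->] /(facesP Pv)[W WL ->] /(sub_conv_le _ WL) ZW ne.
rewrite !rank_sub_conv; apply: (fl_proper (face_lattice_faces v)) => //.
by rewrite finset.properEneq ZW andbT; apply/eqP => e; rewrite e in ne.
Qed.

Lemma face_rank_graded P F : faces P F -> (0 < rank F)%N ->
  exists G, [/\ faces P G, G `<=` F /\ G <> F & rank F = (rank G).+1].
Proof.
have [N [v Pv]] := polytopeP P.
move=> /(facesP Pv)[Z ZL ->]; rewrite rank_sub_conv.
move=> /(fl_graded (face_lattice_faces v) ZL)[W [WL WZ rW]].
exists (sub_conv v W); rewrite rank_sub_conv; split=> //.
  by apply/(facesP Pv); exists W.
split; first by apply/(sub_conv_le _ ZL); exact: fintype.proper_sub.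
by move=> /(sub_conv_inj WL ZL) e; rewrite e fintype.properxx in WZ.
Qed.

Lemma points_face P : faces P (points P).
Proof.
have [N [v Pv]] := polytopeP P; apply/(facesP Pv).
exists finset.setT; first exact: (flT (face_lattice_faces v)).
by rewrite Pv sub_convT.
Qed.

Lemma face_sub_points P F : faces P F -> F `<=` points P.
Proof. by move=> [c [b [_ ->]]] x []. Qed.

Section Equivalent.

Variables (P Q : polytope R).
Variable phi : set 'rV[R]_(ambient P) -> set 'rV[R]_(ambient Q).
Hypothesis phi_bij : set_bij (faces P) (faces Q) phi.
Hypothesis phi_mono : forall F G, faces P F -> faces P G ->
  (F `<=` G <-> phi F `<=` phi G).

Lemma phi_face F : faces P F -> faces Q (phi F).
Proof. by have [h _ _] := phi_bij; exact: h. Qed.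

Lemma phi_inj F G : faces P F -> faces P G -> phi F = phi G -> F = G.
Proof. by have [_ h _] := phi_bij => PF PG; apply: h; rewrite inE. Qed.

(** The dimension is recovered from the order alone: chains of faces are carried by [phi] and by its
    inverse, and both face lattices are graded. *)
Lemma phi_aff_dim F : faces P F -> aff_dim (phi F) = aff_dim F.
Proof.
move=> PF; rewrite (face_aff_dim PF) (face_aff_dim (phi_face PF)); congr (Posz _ - 1).
apply/eqP; rewrite eqn_leq; apply/andP; split.
  pose rel (G : set 'rV[R]_(ambient Q)) F := faces P F /\ G = phi F.
  apply: (@rank_simulation _ _ (faces Q) (fun G H => G `<=` H /\ G <> H)
    (@rank _) (@rank _) rel _ _ (phi F) F) => //; last exact: phi_face.
    exact: face_rank_graded.
  move=> G F1 G' QG QG' [PF1 eG] [sG nG].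
  have [F' PF' eF'] : exists2 F', faces P F' & phi F' = G'.
    by have [_ _ h] := phi_bij; have [F' ? ?] := h G' QG'; exists F'.
  exists F'; first by split.
  apply: (face_rank_lt PF' PF1); first by apply: (phi_mono PF' PF1).2; rewrite eF' -eG.
  by move=> e; apply: nG; rewrite -eF' eG e.
pose rel F (G : set 'rV[R]_(ambient Q)) := G = phi F.
apply: (@rank_simulation _ _ (faces P) (fun G H => G `<=` H /\ G <> H)
  (@rank _) (@rank _) rel _ _ F (phi F)) => //; first exact: face_rank_graded.
move=> F1 G F' PF1 PF' -> [sF nF]; exists (phi F') => //.
apply: (face_rank_lt (phi_face PF') (phi_face PF1)); first exact: (phi_mono PF' PF1).1.
by move=> /(phi_inj PF' PF1).
Qed.

Lemma phi_points : phi (points P) = points Q.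
Proof.
apply/seteqP; split; first by apply: face_sub_points; exact: phi_face (points_face P).
have [_ _ /(_ _ (points_face Q))[F PF <-]] := phi_bij.
by apply: (phi_mono PF (points_face P)).1; exact: face_sub_points.
Qed.

Lemma phi_polytope_dim : polytope_dim P = polytope_dim Q.
Proof.
by rewrite /polytope_dim -phi_points phi_aff_dim //; exact: points_face.
Qed.

Lemma phi_flag_number s : flag_number P s = flag_number Q s.
Proof.
have [N [v Pv]] := polytopeP P.
set l := map (map (sub_conv v)) (chains v finset.set0 (map succn s)).
have lP c : flag_chains P s c <-> c \in l := flag_chainsP Pv s c.
have ul : uniq l := uniq_flag_chains v s.
have lF c : c \in l -> forall F, F \in c -> faces P F by move=> /lP[].
rewrite /flag_number (card_fset_set_seq ul lP) -(size_map (map phi)).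
apply/esym/card_fset_set_seq.
  rewrite map_inj_in_uniq // => c c' /lF hc /lF hc'.
  elim: c c' hc hc' => [|F c IH] [|F' c'] //= hc hc' [eF ec].
  congr (_ :: _).
    by apply: phi_inj => //; [apply: hc|apply: hc']; exact: mem_head.
  by apply: IH => // G Gc; [apply: hc|apply: hc']; rewrite inE Gc orbT.
have transfer c : (forall F, F \in c -> faces P F) ->
    [seq aff_dim F | F <- map phi c] = [seq aff_dim F | F <- c] /\
    sorted (fun F G => `[< F `<=` G >]) (map phi c) =
    sorted (fun F G => `[< F `<=` G >]) c.
  move=> hc; split.
    by rewrite -map_comp; apply/eq_in_map => F /hc PF /=; exact: phi_aff_dim.
  rewrite sorted_map; apply: (@eq_in_sorted _ (mem c)); last by apply/allP.
  move=> F G /hc PF /hc PG /=.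
  by apply/asboolP/asboolP => h; [exact: (phi_mono PF PG).2|exact: (phi_mono PF PG).1].
move=> c; split=> [[cF cd cs]|/mapP[c0 c0l ->]].
  have [c0 hc0 ec] : exists2 c0, (forall F, F \in c0 -> faces P F) & c = map phi c0.
    elim: c cF {cd cs} => [|G c IH] cF; first by exists [::].
    have [|c0 hc0 ->] := IH; first by move=> H Hc; apply: cF; rewrite inE Hc orbT.
    have [_ _ /(_ _ (cF G (mem_head _ _)))[F PF <-]] := phi_bij.
    by exists (F :: c0) => // H; rewrite inE => /predU1P[->//|/hc0].
  have [td ts] := transfer c0 hc0.
  by rewrite ec; apply: map_f; apply/lP; split=> //; rewrite -?td -?ts -ec.
have hc0 := lF _ c0l; have [td ts] := transfer c0 hc0.
have [_ cd cs] := (lP c0).2 c0l.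
split; [|by rewrite td|by rewrite ts].
by move=> F /mapP[G /hc0 PG ->]; exact: phi_face.
Qed.

End Equivalent.

Lemma comb_equivalent_dim P Q : comb_equivalent P Q -> polytope_dim P = polytope_dim Q.
Proof. by move=> [phi [bij mono]]; exact: phi_polytope_dim bij mono. Qed.

Lemma comb_equivalent_flag_number P Q s :
  comb_equivalent P Q -> flag_number P s = flag_number Q s.
Proof. by move=> [phi [bij mono]]; exact: phi_flag_number bij mono s. Qed.

End Invariance.

(** * Geometric pyramids and prisms *)

Section Constructions.

Variable R : realType.

Definition polytope_flags (n : nat) (P : polytope R) (p : pred nat) : int :=
  (flag_number P [seq i <- iota 0 n | p i])%:R.

Lemma polytope_flagsE n (P : polytope R) N (v : 'I_N.+1 -> 'rV[R]_(ambient P)) p :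
  points P = conv v -> polytope_flags n P p =
  flag_function (zero_sets (homogenization v)) (rk (homogenization v)) n p.
Proof. by move=> Pv; rewrite /polytope_flags (flag_number_count Pv). Qed.

Lemma polytope_flags_local n P : determined_below n (polytope_flags n P).
Proof.
move=> p q pq; rewrite /polytope_flags; congr (flag_number P _)%:R.
by apply: eq_in_filter => i; rewrite mem_iota => /pq.
Qed.

Lemma polytope_flags_ds P :
  dehn_sommerville (polytope_dim P) (polytope_flags (polytope_dim P) P).
Proof.
have [N [v Pv]] := polytopeP P.
have := flag_function_ds (face_lattice_faces v) (@eulerian_faces _ _ _ v)
  (polytope_dim_rk Pv).
move=> ds p lo k lk hlo hk hp; have := ds p lo k lk hlo hk hp.
by under eq_bigr do rewrite -(polytope_flagsE _ _ Pv); rewrite -(polytope_flagsE _ _ Pv).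
Qed.

Lemma dot_row_mx d (x : 'rV[R]_d) (a : R) (c : 'cV[R]_d) (s : R) :
  dot (row_mx x (const_mx a : 'rV_1)) (col_mx c (const_mx s)) = dot x c + a * s.
Proof.
rewrite /dot mul_row_col mxE; congr (_ + _).
by rewrite mxE big_ord1 !mxE.
Qed.

Lemma col_mxP d (c : 'cV[R]_(d + 1)) : exists c0 s, c = col_mx c0 (const_mx s).
Proof.
exists (usubmx c), (dsubmx c 0 0); rewrite -[LHS]vsubmxK; congr col_mx.
by apply/matrixP => i j; rewrite !ord1 !mxE.
Qed.

Lemma all_split M N (A : 'I_(M + N) -> Prop) :
  (forall i, A (lshift N i)) -> (forall j, A (rshift M j)) -> forall k, A k.
Proof. by move=> hl hr k; case: (split_ordP k) => i ->. Qed.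

Section Over.

Variables (d N : nat) (v : 'I_N.+1 -> 'rV[R]_d).

Definition pyramid_vertex (k : 'I_(N.+1 + 1)) : 'rV[R]_(d + 1) :=
  match fintype.split k with
  | inl i => row_mx (v i) (const_mx 0)
  | inr _ => row_mx 0 (const_mx 1)
  end.

Definition pyramid_face (e : bool) (Z : {set 'I_N.+1}) : {set 'I_(N.+1 + 1)} :=
  [set k | match fintype.split k with inl i => i \in Z | inr _ => e end]%SET.

Definition prism_vertex (k : 'I_(N.+1 + N.+1)) : 'rV[R]_(d + 1) :=
  match fintype.split k with
  | inl i => row_mx (v i) (const_mx 0)
  | inr i => row_mx (v i) (const_mx 1)
  end.

Definition prism_face (o : option bool) (Z : {set 'I_N.+1}) :
    {set 'I_(N.+1 + N.+1)} :=
  [set k | match fintype.split k with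
           | inl i => (o != Some true) && (i \in Z)
           | inr i => (o != Some false) && (i \in Z) end]%SET.

Lemma pyramid_face_l e Z i : (lshift 1 i \in pyramid_face e Z) = (i \in Z).
Proof. by rewrite finset.in_set -[lshift 1 i]/(unsplit (inl i)) unsplitK. Qed.

Lemma pyramid_face_r e Z i : (rshift N.+1 i \in pyramid_face e Z) = e.
Proof. by rewrite finset.in_set -[rshift _ i]/(unsplit (inr i)) unsplitK. Qed.

Lemma prism_face_l o Z i :
  (lshift N.+1 i \in prism_face o Z) = (o != Some true) && (i \in Z).
Proof. by rewrite finset.in_set -[lshift _ i]/(unsplit (inl i)) unsplitK. Qed.

Lemma prism_face_r o Z i :
  (rshift N.+1 i \in prism_face o Z) = (o != Some false) && (i \in Z).
Proof. by rewrite finset.in_set -[rshift _ i]/(unsplit (inr i)) unsplitK. Qed.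

Lemma dot_pyramid_l i c s :
  dot (pyramid_vertex (lshift 1 i)) (col_mx c (const_mx s)) = dot (v i) c.
Proof.
by rewrite /pyramid_vertex -[lshift 1 i]/(unsplit (inl i)) unsplitK dot_row_mx mul0r addr0.
Qed.

Lemma dot_pyramid_r i c s :
  dot (pyramid_vertex (rshift N.+1 i)) (col_mx c (const_mx s)) = s.
Proof.
rewrite /pyramid_vertex -[rshift _ i]/(unsplit (inr i)) unsplitK dot_row_mx mul1r.
by rewrite /dot mul0mx mxE add0r.
Qed.

Lemma dot_prism_l i c s :
  dot (prism_vertex (lshift N.+1 i)) (col_mx c (const_mx s)) = dot (v i) c.
Proof.
by rewrite /prism_vertex -[lshift _ i]/(unsplit (inl i)) unsplitK dot_row_mx mul0r addr0.
Qed.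

Lemma dot_prism_r i c s :
  dot (prism_vertex (rshift N.+1 i)) (col_mx c (const_mx s)) = dot (v i) c + s.
Proof.
by rewrite /prism_vertex -[rshift _ i]/(unsplit (inr i)) unsplitK dot_row_mx mul1r.
Qed.

Lemma pyramid_face_sub e Z f W :
  (pyramid_face e Z \subset pyramid_face f W) = (e ==> f) && (Z \subset W).
Proof.
apply/fintype.subsetP/andP => [h|[/implyP ef /fintype.subsetP ZW]].
  split; first by apply/implyP => He; have := h (rshift _ ord0); rewrite !pyramid_face_r; apply.
  by apply/fintype.subsetP => i; have := h (lshift _ i); rewrite !pyramid_face_l.
by apply: all_split => i; rewrite ?pyramid_face_l ?pyramid_face_r; [exact: ZW|exact: ef].
Qed.

(** The coefficient s of the height does not affect the base and is the value at the apex. So the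
    base face is arbitrary, and the apex joins it exactly when s = b; [b - 1] is a choice leaving it
    out. *)
Lemma pyramid_faceP W : reflect
  (exists e, exists2 Z, Z \in zero_sets (homogenization v) & W = pyramid_face e Z)
  (W \in zero_sets (homogenization (pyramid_vertex : 'I_(N + 1).+1 -> _))).
Proof.
apply: (iffP (@face_setsP _ _ (N + 1) pyramid_vertex W)).
  move=> [c' [b [cb cW]]]; have [c [s ec]] := col_mxP c'; rewrite ec in cb cW.
  exists (s == b), [set i | dot (v i) c == b]%SET.
    apply/face_setsP; exists c, b; split=> i; last by rewrite finset.in_set.
    by have := cb (lshift 1 i); rewrite dot_pyramid_l.
  apply/finset.setP; apply: (@all_split N.+1 1) => i.
    by rewrite pyramid_face_l finset.in_set cW dot_pyramid_l.
  by rewrite pyramid_face_r cW dot_pyramid_r.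
move=> [e [Z /face_setsP[c [b [cb cZ]]] ->]].
exists (col_mx c (const_mx (if e then b else b - 1))), b; split.
  by apply: (@all_split N.+1 1) => i; rewrite ?dot_pyramid_l ?dot_pyramid_r //; case: e; lra.
apply: (@all_split N.+1 1) => i.
  by rewrite pyramid_face_l dot_pyramid_l.
rewrite pyramid_face_r dot_pyramid_r; case: e; first by rewrite eqxx.
by rewrite lt_eqF //; lra.
Qed.

Lemma prism_face0 o : prism_face o finset.set0 = finset.set0.
Proof.
apply/finset.setP; apply: (@all_split N.+1 N.+1) => i;
  by rewrite ?prism_face_l ?prism_face_r !finset.in_set0 andbF.
Qed.

Lemma prism_face_sub o Z o' W : Z != finset.set0 ->
  (prism_face o Z \subset prism_face o' W) =
  ((o' == None) || (o == o')) && (Z \subset W).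
Proof.
move=> /finset.set0Pn[i0 i0Z].
apply/fintype.subsetP/andP => [h|[oo' /fintype.subsetP ZW]].
  have hl i : i \in Z -> o != Some true -> (o' != Some true) && (i \in W).
    by move=> iZ ot; have := h (lshift _ i); rewrite !prism_face_l iZ ot; apply.
  have hr i : i \in Z -> o != Some false -> (o' != Some false) && (i \in W).
    by move=> iZ ot; have := h (rshift _ i); rewrite !prism_face_r iZ ot; apply.
  split.
    have := hl _ i0Z; have := hr _ i0Z.
    by case: o o' {h hl hr} => [[]|] [[]|] //= a b;
      first [by have := a isT | by have := b isT].
  apply/fintype.subsetP => i iZ; have := hl i iZ; have := hr i iZ.
  by case: o {h hl hr} => [[]|] /= a b; [case/andP: (a isT)|case/andP: (b isT)|case/andP: (b isT)].
by apply: all_split => i; rewrite ?prism_face_l ?prism_face_r => /andP[a /ZW ->];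
  rewrite andbT; move: a oo'; case: o o' => [[]|] [[]|].
Qed.

(** The top copy of a point has the value of the bottom copy plus s. Hence the bound is reached only
    below if s < 0, only above if s > 0, and on both copies if s = 0. *)
Lemma prism_faceP W : reflect
  (exists o, exists2 Z, Z \in zero_sets (homogenization v) & W = prism_face o Z)
  (W \in zero_sets (homogenization (prism_vertex : 'I_(N + N.+1).+1 -> _))).
Proof.
apply: (iffP (@face_setsP _ _ (N + N.+1) prism_vertex W)).
  move=> [c' [b [cb cW]]]; have [c [s ec]] := col_mxP c'; rewrite ec in cb cW.
  have cl i : dot (v i) c <= b by have := cb (lshift N.+1 i); rewrite dot_prism_l.
  have cr i : dot (v i) c <= b - s.
    by have := cb (rshift N.+1 i); rewrite dot_prism_r lerBrDr.
  have Wl i : (lshift N.+1 i \in W) = (dot (v i) c == b) by rewrite cW dot_prism_l.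
  have Wr i : (rshift N.+1 i \in W) = (dot (v i) c == b - s).
    by rewrite cW dot_prism_r eq_sym -subr_eq eq_sym.
  have [s0|s0|s0] := ltgtP s 0.
  - exists (Some false), [set i | dot (v i) c == b]%SET.
      by apply/face_setsP; exists c, b; split=> i //; rewrite finset.in_set.
    apply/finset.setP; apply: (@all_split N.+1 N.+1) => i.
      by rewrite prism_face_l finset.in_set Wl.
    by rewrite prism_face_r Wr /= lt_eqF //; have := cl i; lra.
  - exists (Some true), [set i | dot (v i) c == b - s]%SET.
      by apply/face_setsP; exists c, (b - s); split=> i //; rewrite finset.in_set.
    apply/finset.setP; apply: (@all_split N.+1 N.+1) => i.
      by rewrite prism_face_l Wl /= lt_eqF //; have := cr i; lra.
    by rewrite prism_face_r finset.in_set Wr.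
  exists None, [set i | dot (v i) c == b]%SET.
    by apply/face_setsP; exists c, b; split=> i //; rewrite finset.in_set.
  apply/finset.setP; apply: (@all_split N.+1 N.+1) => i.
    by rewrite prism_face_l finset.in_set Wl.
  by rewrite prism_face_r finset.in_set Wr s0 subr0.
move=> [o [Z /face_setsP[c [b [cb cZ]]] ->]].
pose s : R := match o with None => 0 | Some true => 1 | Some false => -1 end.
(* With s = 1 the values on the top copy rise by 1, and the bound must follow. *)
pose b' : R := match o with Some true => b + 1 | _ => b end.
exists (col_mx c (const_mx s)), b'; split.
  apply: (@all_split N.+1 N.+1) => i; rewrite ?dot_prism_l ?dot_prism_r;
  by have := cb i; rewrite /s /b'; case: (o) => [[]|]; lra.
apply: (@all_split N.+1 N.+1) => i.
  rewrite prism_face_l dot_prism_l cZ /b'; have := cb i.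
  by case: (o) => [[]|] //= h; rewrite lt_eqF //; lra.
rewrite prism_face_r dot_prism_r cZ /b' /s; have := cb i.
case: (o) => [[]|] //= h; last by rewrite addr0.
  by apply/eqP/eqP => e; lra.
by rewrite lt_eqF //; lra.
Qed.

End Over.
End Constructions.

(** * The image of the group of polytopes *)

Section Span.

Variable R : realType.

Lemma exists_pyramid (P : polytope R) : exists Q : polytope R,
  polytope_dim Q = (polytope_dim P).+1 /\
  forall p, polytope_flags (polytope_dim P).+1 Q p =
    cone_op (polytope_dim P) (polytope_flags (polytope_dim P) P) p.
Proof.
have [N [v Pv]] := polytopeP P.
pose v' : 'I_(N + 1).+1 -> _ := pyramid_vertex v.
have Qv' : exists (N' : nat) (u : 'I_N'.+1 -> 'rV[R]_(ambient P + 1)), conv v' = conv u.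
  by exists (N + 1)%N, v'.
have FL := face_lattice_faces v; have FL' := face_lattice_faces v'.
have rT := polytope_dim_rk Pv.
have encP W := pyramid_faceP v W.
have dimQ : polytope_dim (Polytope Qv') = (polytope_dim P).+1.
  apply: succn_inj; rewrite -(@polytope_dim_rk _ (Polytope Qv') _ v' erefl).
  have e : rk (homogenization v') (pyramid_face true finset.setT) = (polytope_dim P).+2.
    by rewrite (enc_rank FL FL' (@pyramid_face_sub N) encP true (flT FL)) rT addn1.
  rewrite -e.
  congr (rk _ _); apply/finset.setP; apply: (@all_split N.+1 1) => i.
    by rewrite pyramid_face_l !finset.in_setT.
  by rewrite pyramid_face_r finset.in_setT.
exists (Polytope Qv'); split=> // p.
rewrite (@polytope_flagsE _ _ (Polytope Qv') _ v' _ erefl).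
rewrite (flag_function_pyramid FL FL' (@pyramid_face_sub N) encP _ rT).
rewrite /cone_op (polytope_flagsE _ _ Pv); congr (_ + _).
by apply: eq_bigr => a _; rewrite (polytope_flagsE _ _ Pv).
Qed.

Lemma exists_prism (P : polytope R) : exists Q : polytope R,
  polytope_dim Q = (polytope_dim P).+1 /\
  forall p, polytope_flags (polytope_dim P).+1 Q p =
    prism_op (polytope_dim P) (polytope_flags (polytope_dim P) P) p.
Proof.
have [N [v Pv]] := polytopeP P.
pose v' : 'I_(N + N.+1).+1 -> _ := prism_vertex v.
have Qv' : exists (N' : nat) (u : 'I_N'.+1 -> 'rV[R]_(ambient P + 1)), conv v' = conv u.
  by exists (N + N.+1)%N, v'.
have FL := face_lattice_faces v; have FL' := face_lattice_faces v'.
have rT := polytope_dim_rk Pv.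
have encP W := prism_faceP v W.
have dimQ : polytope_dim (Polytope Qv') = (polytope_dim P).+1.
  apply: succn_inj; rewrite -(@polytope_dim_rk _ (Polytope Qv') _ v' erefl).
  have T0 : finset.setT != finset.set0 :> {set 'I_N.+1}.
    by apply/finset.set0Pn; exists ord0; rewrite finset.in_setT.
  have e : rk (homogenization v') (prism_face None finset.setT) = (polytope_dim P).+2.
    rewrite (pr_rank FL FL' (@prism_face0 N) (@prism_face_sub N) encP (flT FL)) ?T0 //.
    by rewrite rT addn1.
  rewrite -e.
  congr (rk _ _); apply/finset.setP; apply: (@all_split N.+1 N.+1) => i.
    by rewrite prism_face_l !finset.in_setT.
  by rewrite prism_face_r !finset.in_setT.
exists (Polytope Qv'); split=> // p.
rewrite (@polytope_flagsE _ _ (Polytope Qv') _ v' _ erefl).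
rewrite (flag_function_prism FL FL' (@prism_face0 N) (@prism_face_sub N) encP _ rT).
rewrite /prism_op (polytope_flagsE _ _ Pv); congr (_ + 2 * _).
by apply: eq_bigr => a _; rewrite (polytope_flagsE _ _ Pv).
Qed.

Lemma exists_point : exists P : polytope R, polytope_dim P = 0%N.
Proof.
pose v (i : 'I_1) : 'rV[R]_0 := 0.
have Pv : exists (N : nat) (u : 'I_N.+1 -> 'rV[R]_0), conv v = conv u by exists 0%N, v.
exists (Polytope Pv); apply/eqP; rewrite -leqn0 -ltnS.
rewrite -(@polytope_dim_rk _ (Polytope Pv) _ v erefl).
exact: rank_leq_col.
Qed.

(** The concrete span for which [ds_generated] is proved in the abstract. It uses polytopes, not
    their classes, so that pyramids and prisms apply directly. *)
Definition polytopal (n : nat) (G : pred nat -> int) : Prop :=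
  exists s : seq (int * polytope R),
    (forall x, x \in s -> polytope_dim x.2 = n) /\
    forall p, G p = \sum_(x <- s) x.1 * polytope_flags n x.2 p.

Lemma polytopal_ext n G H : (forall p, G p = H p) -> polytopal n G -> polytopal n H.
Proof. by move=> GH [s [sn sG]]; exists s; split=> // p; rewrite -GH. Qed.

Lemma polytopal_lin n c G H : polytopal n G -> polytopal n H ->
  polytopal n (fun p => c * G p + H p).
Proof.
move=> [s [sn sG]] [t [tn tH]]; exists ([seq (c * x.1, x.2) | x <- s] ++ t); split.
  by move=> x; rewrite mem_cat => /orP[/mapP[y ys ->]|]; [exact: (sn y ys)|exact: tn].
move=> p; rewrite big_cat big_map sG tH mulr_sumr; congr (_ + _).
by apply: eq_bigr => x _; rewrite mulrA.
Qed.

(** A linear operator realized by some polytope for each polytope preserves the span: choose such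
    polytopes and apply them term by term. *)
Lemma polytopal_op (op : nat -> (pred nat -> int) -> pred nat -> int) :
  (forall P : polytope R, exists Q : polytope R,
     polytope_dim Q = (polytope_dim P).+1 /\
     forall p, polytope_flags (polytope_dim P).+1 Q p =
       op (polytope_dim P) (polytope_flags (polytope_dim P) P) p) ->
  (forall n h h', (forall p, h p = h' p) -> forall p, op n h p = op n h' p) ->
  (forall n (s : seq (int * polytope R)) (h : polytope R -> pred nat -> int) p,
     op n (fun q => \sum_(x <- s) x.1 * h x.2 q) p =
     \sum_(x <- s) x.1 * op n (h x.2) p) ->
  forall n G, polytopal n G -> polytopal n.+1 (op n G).
Proof.
move=> /choice[f fP] op_ext op_sum n G [s [sn sG]].
exists [seq (x.1, f x.2) | x <- s]; split.
  by move=> x /mapP[y ys ->] /=; rewrite (fP y.2).1 sn.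
move=> p; rewrite (op_ext _ _ _ sG) op_sum big_map.
by apply: eq_big_seq => x xs /=; rewrite -(sn x xs) (fP x.2).2.
Qed.

Lemma polytopal_cone n G : polytopal n G -> polytopal n.+1 (cone_op n G).
Proof.
apply: polytopal_op => [|{}n h h' hh' p|{}n s h p]; first exact: exists_pyramid.
  by rewrite /cone_op hh'; congr (_ + _); apply: eq_bigr => a _; rewrite hh'.
rewrite /cone_op; under [in RHS]eq_bigr do rewrite mulrDr.
rewrite big_split; congr (_ + _) => /=.
under eq_bigr do rewrite mulr_sumr.
rewrite exchange_big; apply: eq_bigr => x _; rewrite mulr_sumr.
by apply: eq_bigr => a _; rewrite mulrCA.
Qed.

Lemma polytopal_prism n G : polytopal n G -> polytopal n.+1 (prism_op n G).
Proof.
apply: polytopal_op => [|{}n h h' hh' p|{}n s h p]; first exact: exists_prism.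
  by rewrite /prism_op hh'; congr (_ + 2 * _); apply: eq_bigr => a _; rewrite hh'.
have exch : \sum_(a < n.+1) (p a)%:R * (\sum_(x <- s) x.1 * h x.2 (pmerge a p)) =
    \sum_(x <- s) x.1 * \sum_(a < n.+1) (p a)%:R * h x.2 (pmerge a p).
  under eq_bigr do rewrite mulr_sumr.
  rewrite exchange_big; apply: eq_bigr => x _; rewrite mulr_sumr.
  by apply: eq_bigr => a _; rewrite mulrCA.
rewrite /prism_op exch !mulr_sumr -big_split; apply: eq_bigr => x _ /=.
by rewrite mulrDr; congr (_ + _); rewrite mulrCA.
Qed.

Lemma polytopal_point : polytopal 0 (fun=> 1).
Proof.
have [P P0] := exists_point; exists [:: (1, P)]; split.
  by move=> x; rewrite inE => /eqP->.
by move=> p; rewrite big_seq1 mul1r /polytope_flags /= flag_number_nil.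
Qed.

Lemma polytopal_local n G : polytopal n G -> determined_below n G.
Proof.
move=> [s [sn sG]] p q pq; rewrite !sG; apply: eq_bigr => x _; congr (_ * _).
exact: polytope_flags_local.
Qed.

Lemma polytopal_ds n G : polytopal n G -> dehn_sommerville n G.
Proof.
move=> [s [sn sG]] p lo k lk hlo hk hp.
under eq_bigr => j _ do rewrite sG mulr_sumr.
rewrite exchange_big sG mulr_sumr; apply: eq_big_seq => x xs.
have := @polytope_flags_ds R x.2; rewrite (sn x xs) => /(_ p lo k lk hlo hk hp) e.
by rewrite [RHS]mulrCA -e mulr_sumr; apply: eq_bigr => j _; rewrite mulrCA.
Qed.

Lemma ds_polytopal n G : determined_below n G -> dehn_sommerville n G -> polytopal n G.
Proof.
exact: (ds_generated polytopal_ext polytopal_lin polytopal_cone polytopal_prism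
  polytopal_point polytopal_local polytopal_ds).
Qed.

End Span.

(** * Passage to classes of polytopes and the free group *)

Section Image.

Variables (R : realType) (n m : nat).
Hypothesis nm : (n <= m)%N.

Lemma f_polytopeE (P : polytope R) : polytope_dim P = n ->
  f_polytope m P = flag_polynomial m (fun S : {set 'I_n} => (flag_number P (elements S))%:Z).
Proof. by rewrite /f_polytope => e; case: n / e. Qed.

Lemma repr_comb_equivalent (P : polytope R) :
  comb_equivalent (repr (\pi_(comb_polytope R) P)%qT) P.
Proof.
have : (repr (\pi_(comb_polytope R) P) == P %[mod comb_polytope R])%qT by rewrite reprK.
by rewrite eqmodE => /asboolP.
Qed.

Lemma f_polytope_repr (P : polytope R) :
  f_polytope m (repr (\pi_(comb_polytope R) P)%qT) = f_polytope m P.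
Proof.
have e := repr_comb_equivalent P; rewrite /f_polytope (comb_equivalent_dim e).
congr flag_polynomial; apply/funext => S.
by rewrite (comb_equivalent_flag_number _ e).
Qed.

Lemma flag_polynomial_sum (I : Type) (s : seq I) (c : I -> int)
    (g : I -> {set 'I_n} -> int) :
  flag_polynomial m (fun S => \sum_(x <- s) c x * g x S) =
  \sum_(x <- s) flag_polynomial m (g x) *~ c x.
Proof.
rewrite flag_polynomialE //.
under [RHS]eq_bigr do rewrite flag_polynomialE // mulrz_suml.
rewrite [RHS]exchange_big; apply: eq_bigr => S _ /=.
rewrite mulrz_sumr; apply: eq_bigr => x _.
by rewrite -mulrzA [c x * _]mulrC.
Qed.

(** Equivalent polytopes in [s] merge and coefficients may cancel, so the domain of the sum can be
    smaller than its list of classes. Both sides are compared over that full list, where a cancelled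
    class contributes 0. *)
Lemma f_map_sum (s : seq (int * polytope R)) :
  f_map m (\sum_(x <- s) << x.1 *g (\pi_(comb_polytope R) x.2)%qT >>) =
  \sum_(x <- s) f_polytope m x.2 *~ x.1.
Proof.
set y : polytope_group R := \sum_(x <- s) _; pose l := undup [seq (\pi_(comb_polytope R) x.2)%qT | x <- s].
have dl p : p \in dom y -> p \in l.
  move=> /dom_sum_subset /flattenP[t /mapP[x]].
  rewrite mem_filter /= => xs ->; have [->|x0] := eqVneq x.1 0.
    by rewrite freegU0 dom0.
  by rewrite domU // inE => /eqP->; rewrite mem_undup map_f.
rewrite /f_map (eq_big_nonzero (s2 := l)) ?uniq_dom ?undup_uniq //; last first.
  move=> p nz; have py : p \in dom y.
    by rewrite mem_dom; apply: contraNneq nz => ->; rewrite mulr0z.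
  by rewrite py dl.
have cE p : coeff p y = \sum_(x <- s) x.1 * ((\pi_(comb_polytope R) x.2)%qT == p)%:R.
  by rewrite /y raddf_sum /=; apply: eq_bigr => x _; rewrite coeffU.
under eq_bigr => p _ do rewrite cE mulrz_sumr.
rewrite exchange_big; apply: eq_big_seq => x xs /=.
rewrite (bigD1_seq ((\pi_(comb_polytope R) x.2)%qT)) ?undup_uniq ?mem_undup ?map_f //=.
rewrite eqxx mulr1 f_polytope_repr big1 ?addr0 // => p px.
by rewrite eq_sym (negbTE px) mulr0 mulr0z.
Qed.

Lemma homogeneous_sum (s : seq (int * polytope R)) :
  (forall x, x \in s -> polytope_dim x.2 = n) ->
  homogeneous_polytopes R n (\sum_(x <- s) << x.1 *g (\pi_(comb_polytope R) x.2)%qT >>).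
Proof.
move=> sn p /dom_sum_subset /flattenP[t /mapP[x]].
rewrite mem_filter /= => xs ->; have [->|x0] := eqVneq x.1 0.
  by rewrite freegU0 dom0.
rewrite domU // inE => /eqP->.
by rewrite (comb_equivalent_dim (repr_comb_equivalent _)) sn.
Qed.

Lemma f_map_flag_polynomial (x : polytope_group R) : homogeneous_polytopes R n x ->
  exists2 g : {set 'I_n} -> int, f_map m x = flag_polynomial m g &
    dehn_sommerville n (set_function g).
Proof.
move=> hx; exists (fun S => \sum_(p <- dom x)
    coeff p x * (flag_number (repr p) (elements S))%:Z).
  rewrite flag_polynomial_sum; apply: eq_big_seq => p px.
  by rewrite f_polytopeE // hx.
apply: (@polytopal_ds R); exists [seq (coeff p x, repr p) | p <- dom x]; split.
  by move=> y /mapP[p px ->]; exact: hx.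
move=> p; rewrite big_map; apply: eq_bigr => q _.
by rewrite /polytope_flags -elements_pred natz.
Qed.

Lemma flag_polynomial_in_image (g : {set 'I_n} -> int) :
  dehn_sommerville n (set_function g) ->
  exists2 x : polytope_group R, homogeneous_polytopes R n x &
    f_map m x = flag_polynomial m g.
Proof.
move=> /(ds_polytopal R (@set_function_local n g))[s [sn sg]].
eexists; first exact: homogeneous_sum sn.
rewrite f_map_sum.
have -> : g = fun S => \sum_(x <- s) x.1 * (flag_number x.2 (elements S))%:Z.
  apply/funext => S; have := sg (fun i => i \in elements S).
  have ES : [set i : 'I_n | (i : nat) \in elements S]%SET = S.
    by apply/finset.setP => i; rewrite finset.in_set mem_elements.
  rewrite /set_function ES => ->; apply: eq_bigr => x _.
  by rewrite /polytope_flags natz -elements_pred ES.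
rewrite flag_polynomial_sum; apply: eq_big_seq => x xs.
by rewrite f_polytopeE // sn.
Qed.

End Image.

Theorem theorem2 (R : realType) (n m : nat) (hnm : (n <= m)%N) (hm : (1 <= m)%N) :
  [set f_map m x | x in homogeneous_polytopes R n] =
    [set g | [/\ Qsym_alpha g, homogeneous_of_degree n g,
                 sign_equations g & euler_equation g]] /\
  (forall g : {set 'I_n} -> int,
     sign_equations (flag_polynomial m g) /\
     euler_equation (flag_polynomial m g) <->
     bayer_billera g).
Proof.
split=> [|g]; last first.
  rewrite bayer_billera_ds; split=> [[]|ds]; first exact: equations_ds.
  by split; [exact: ds_sign_equations|exact: ds_euler_equation].
apply/seteqP; split=> [_ [x hx <-]|H [qH hH sH eH]] /=.
  have [g -> ds] := f_map_flag_polynomial hnm hx; split.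
  - exact: flag_polynomial_qsym.
  - exact: flag_polynomial_homogeneous.
  - exact: ds_sign_equations.
  - exact: ds_euler_equation.
have [g E] := qsym_flag_polynomial hnm qH hH; rewrite E in sH eH *.
have [x hx <-] := flag_polynomial_in_image R hnm (equations_ds hnm hm sH eH).
by exists x.
Qed.
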